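(* Let $\mathfrak f\colon\mathfrak R\to\mathfrak S$ be a left proflat continuous map of complete, separated two-sided linear topological rings with countable bases of neighborhoods of zero. Then the following five conditions are equivalent: (1) the functor of restriction of scalars $\mathfrak f_\diamond\colon\mathsf{Discr}\text{-}\mathfrak S\to\mathsf{Discr}\text{-}\mathfrak R$ is fully faithful; (2) the functor of restriction of scalars $\mathfrak f_\sharp\colon\mathfrak S\text{-}\mathsf{Flat}\to\mathfrak R\text{-}\mathsf{Flat}$ is fully faithful; (3) the functor of restriction of scalars $\mathfrak f_\sharp\colon\mathfrak S\text{-}\mathsf{Separ}\to\mathfrak R\text{-}\mathsf{Separ}$ is fully faithful; (4) the functor of restriction of scalars $\mathfrak f_\sharp\colon\mathfrak S\text{-}\mathsf{Contra}\to\mathfrak R\text{-}\mathsf{Contra}$ is fully faithful; (5) $\mathfrak f$ is a topological ring proepimorphism.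
   Context: All rings are associative and unital, and ring maps are unital ring homomorphisms. A topological ring is two-sided linear if open two-sided ideals form a base of neighborhoods of zero; it is complete and separated if the natural map to the projective limit of its quotients by all open subgroups is bijective. For a ring map $\mathfrak f\colon\mathfrak R\to\mathfrak S$ and $\mathfrak I\subset\mathfrak R$, $\mathfrak f(\mathfrak I)\mathfrak S$ is the right ideal generated by $\mathfrak f(\mathfrak I)$. The map $\mathfrak f$ is strongly right taut if those open two-sided ideals $\mathfrak I\subset\mathfrak R$ for which the closure of $\mathfrak f(\mathfrak I)\mathfrak S$ in $\mathfrak S$ is an open two-sided ideal of $\mathfrak S$ form a base of neighborhoods of zero in $\mathfrak R$. A strongly right taut continuous $\mathfrak f$ is left proflat if for every open two-sided ideal $\mathfrak I\subset\mathfrak R$ such that the closure $\mathfrak J$ of $\mathfrak f(\mathfrak I)\mathfrak S$ is an open two-sided ideal in $\mathfrak S$, the ring $\mathfrak S/\mathfrak J$ is a flat left $\mathfrak R/\mathfrak I$-module. (So left proflat maps are by definition continuous and strongly right taut.) A continuous $\mathfrak f$ is a topological ring proepimorphism if, for all open two-sided ideals $\mathfrak I\subset\mathfrak R$ and $\mathfrak J\subset\mathfrak S$ with $\mathfrak f(\mathfrak I)\subset\mathfrak J$, the induced map $\mathfrak R/\mathfrak I\to\mathfrak S/\mathfrak J$ is an epimorphism in the category of associative unital rings. Contramodules. For a set $X$, let $\mathfrak R[[X]]$ be the set of all infinite formal linear combinations $\sum_{x\in X}r_xx$ whose coefficient families $(r_x\in\mathfrak R)_{x\in X}$ converge to zero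 (for every open subgroup $\mathfrak U\subset\mathfrak R$, $r_x\in\mathfrak U$ for all but finitely many $x$). A map $g\colon X\to Y$ induces $\mathfrak R[[g]]\colon\sum_x r_xx\mapsto\sum_y\bigl(\sum_{g(x)=y}r_x\bigr)y$, where infinite sums in $\mathfrak R$ are limits of finite partial sums. The functor $\mathfrak R[[-]]$ is a monad on sets with unit $\epsilon_X\colon x\mapsto 1\cdot x$ and multiplication $\phi_X\colon\mathfrak R[[\mathfrak R[[X]]]]\to\mathfrak R[[X]]$ given by opening parentheses. A left $\mathfrak R$-contramodule is a module (algebra) over this monad, i.e. a set $\mathfrak P$ with a map $\pi_{\mathfrak P}\colon\mathfrak R[[\mathfrak P]]\to\mathfrak P$ satisfying $\pi_{\mathfrak P}\epsilon_{\mathfrak P}=\mathrm{id}$ and $\pi_{\mathfrak P}\circ\mathfrak R[[\pi_{\mathfrak P}]]=\pi_{\mathfrak P}\circ\phi_{\mathfrak P}$. These form an abelian category $\mathfrak R\text{-}\mathsf{Contra}$; restricting $\pi_{\mathfrak P}$ to finite linear combinations gives the underlying left $\mathfrak R$-module. For an open right ideal $\mathfrak I\subset\mathfrak R$, $\mathfrak I\rightthreetimes\mathfrak P\subset\mathfrak P$ is the image under $\pi_{\mathfrak P}$ of the set of those elements of $\mathfrak R[[\mathfrak P]]$ whose coefficients all lie in $\mathfrak I$. The contramodule $\mathfrak P$ is separated if $\bigcap_{\mathfrak I}(\mathfrak I\rightthreetimes\mathfrak P)=0$ (over all open right ideals). $\mathfrak R\text{-}\mathsf{Separ}\subset\mathfrak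 R\text{-}\mathsf{Contra}$ is the full subcategory of separated left contramodules. A right $\mathfrak R$-module is discrete if the annihilator of each of its elements is open in $\mathfrak R$; $\mathsf{Discr}\text{-}\mathfrak R$ is the full subcategory of discrete right $\mathfrak R$-modules in right $\mathfrak R$-modules. For a discrete right $\mathfrak R$-module $\mathcal N$ and a left $\mathfrak R$-contramodule $\mathfrak P$, the contratensor product $\mathcal N\odot_{\mathfrak R}\mathfrak P$ is the cokernel of the difference of the two maps $\mathcal N\otimes_{\mathbb Z}\mathfrak R[[\mathfrak P]]\rightrightarrows\mathcal N\otimes_{\mathbb Z}\mathfrak P$, the first being $\mathrm{id}\otimes\pi_{\mathfrak P}$ and the second $y\otimes\sum_pr_pp\mapsto\sum_p yr_p\otimes p$ (a finite sum). A left $\mathfrak R$-contramodule $\mathfrak F$ is flat if $-\odot_{\mathfrak R}\mathfrak F$ is an exact functor from $\mathsf{Discr}\text{-}\mathfrak R$ to abelian groups. $\mathfrak R\text{-}\mathsf{Flat}\subset\mathfrak R\text{-}\mathsf{Contra}$ is the full subcategory of flat left contramodules. Restriction of scalars. For continuous $\mathfrak f$, discrete right $\mathfrak S$-modules are discrete as right $\mathfrak R$-modules, giving $\mathfrak f_\diamond$. Also $\mathfrak f$ induces maps $\mathfrak R[[X]]\to\mathfrak S[[X]]$; precomposing $\pi_{\mathfrak Q}\colon\mathfrak S[[\mathfrak Q]]\to\mathfrak Q$ with $\mathfrak R[[\mathfrak Q]]\to\mathfrak S[[\mathfrak Q]]$ defines $\mathfrak f_\sharp\colon\mathfrak S\text{-}\mathsf{Contra}\to\mathfrak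 R\text{-}\mathsf{Contra}$. The functor $\mathfrak f_\sharp$ takes separated contramodules to separated ones and, for left proflat $\mathfrak f$ as in the claim, flat contramodules to flat ones. *)

(* Defs.v *)
From HB Require Import structures.
From mathcomp Require Import all_boot all_algebra finmap freeg.
From mathcomp Require Import all_classical topology tvs pseudometric_normed_Zmodule.
From mathcomp Require summability.

Set Implicit Arguments.
Unset Strict Implicit.
Unset Printing Implicit Defensive.

Import GRing.Theory.
Local Open Scope classical_set_scope.
Local Open Scope ring_scope.

Record category := Category {
  obj :> Type;
  mor : obj -> obj -> Type;
  idm : forall X, mor X X;
  mcomp : forall X Y Z, mor Y Z -> mor X Y -> mor X Z;
  compA : forall X Y Z W (h : mor Z W) (g : mor Y Z) (f : mor X Y),
    mcomp h (mcomp g f) = mcomp (mcomp h g) f;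
  comp1m : forall X Y (f : mor X Y), mcomp (idm Y) f = f;
  compm1 : forall X Y (f : mor X Y), mcomp f (idm X) = f }.

Record functor (C D : category) := Functor {
  fobj :> C -> D;
  fhom : forall X Y : C, mor X Y -> mor (fobj X) (fobj Y);
  fhom1 : forall X : C, fhom (idm X) = idm (fobj X);
  fhomM : forall (X Y Z : C) (g : mor Y Z) (f : mor X Y),
    fhom (mcomp g f) = mcomp (fhom g) (fhom f) }.

Definition fully_faithful (C D : category) (F : functor C D) : Prop :=
  forall X Y : C, bijective (@fhom C D F X Y).

Definition full_subcat (C : category) (P : C -> Prop) : category :=
  @Category {X : C | P X} (fun X Y => mor (sval X) (sval Y))
    (fun X => idm (sval X)) (fun X Y Z g f => mcomp g f)
    (fun X Y Z W h g f => compA h g f)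
    (fun X Y f => comp1m f) (fun X Y f => compm1 f).

Section RestrictedFunctors.
Variables (C D : category) (F : functor C D) (P : C -> Prop) (Q : D -> Prop).

Definition restr_dom : functor (full_subcat P) D :=
  @Functor (full_subcat P) D (fun X => F (sval X)) (fun X Y f => fhom F f)
    (fun X => fhom1 F (sval X)) (fun X Y Z g f => fhomM F g f).

Hypothesis PQ : forall X, P X -> Q (F X).

Definition restr_full : functor (full_subcat P) (full_subcat Q) :=
  @Functor (full_subcat P) (full_subcat Q)
    (fun X => exist Q (F (sval X)) (PQ (svalP X))) (fun X Y f => fhom F f)
    (fun X => fhom1 F (sval X)) (fun X Y Z g f => fhomM F g f).

End RestrictedFunctors.

Definition subgroup (G : zmodType) (A : set G) : Prop :=
  A 0 /\ forall x y, A x -> A y -> A (x - y).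

Definition right_ideal (R : pzRingType) (A : set R) : Prop :=
  subgroup A /\ forall x r, A x -> A (x * r).

Definition two_sided_ideal (R : pzRingType) (A : set R) : Prop :=
  right_ideal A /\ forall x r, A x -> A (r * x).

Section SubgroupTheory.
Variables (G : zmodType) (A : set G).

Lemma subgroupN : subgroup A -> forall x, A x -> A (- x).
Proof. by move=> [A0 AB] x Ax; rewrite -[- x]add0r; apply: AB. Qed.

Lemma subgroupD : subgroup A -> forall x y, A x -> A y -> A (x + y).
Proof.
by move=> sA x y Ax Ay; rewrite -[y]opprK; apply: sA.2 => //; apply: subgroupN.
Qed.

Lemma subgroupBC : subgroup A -> forall x y, A (x - y) -> A (y - x).
Proof. by move=> sA x y /(subgroupN sA); rewrite opprB. Qed.

Lemma subgroupBT : subgroup A ->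
  forall y x z, A (x - y) -> A (y - z) -> A (x - z).
Proof.
by move=> sA y x z xy yz; rewrite -(subrKA y); apply: subgroupD.
Qed.

Lemma subgroup_sum (I : Type) (s : seq I) (P : pred I) (F : I -> G) :
  subgroup A -> (forall i, P i -> A (F i)) -> A (\sum_(i <- s | P i) F i).
Proof. by move=> sA AF; apply: big_ind => //; [exact: sA.1|exact: subgroupD]. Qed.

Lemma smallest_subgroup : subgroup (smallest (@subgroup G) A).
Proof.
split=> [B [[B0 _] _] //|x y Ax Ay B BA].
by apply: BA.1.2; [apply: Ax|apply: Ay].
Qed.

Lemma smallest_subgroup_id : subgroup A -> smallest (@subgroup G) A = A.
Proof. exact: smallest_id. Qed.

End SubgroupTheory.

Lemma smallest_right_ideal (R : pzRingType) (A : set R) :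
  right_ideal (smallest (@right_ideal R) A).
Proof.
split=> [|x r Ax B BA]; last by apply: BA.1.2; apply: Ax.
split=> [B [[[]] //]|x y Ax Ay B BA].
by apply: BA.1.1.2; [apply: Ax|apply: Ay].
Qed.

Lemma smallest_two_sided (R : pzRingType) (A : set R) :
  two_sided_ideal (smallest (@two_sided_ideal R) A).
Proof.
split=> [|x r Ax B BA]; last by apply: BA.1.2; apply: Ax.
split=> [|x r Ax B BA]; last by apply: BA.1.1.2; apply: Ax.
split=> [B [[[[]]] //]|x y Ax Ay B BA].
by apply: BA.1.1.1.2; [apply: Ax|apply: Ay].
Qed.

(* [zquot A] is the quotient of G by the subgroup generated by A, that is G/A
   when A is a subgroup. *)
Section GroupQuotient.
Variables (G : zmodType) (A : set G).

Definition zspan : {pred G} := fun x => `[< smallest (@subgroup G) A x >].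

Fact zspan_closed : zmod_closed zspan.
Proof.
have [s0 sB] := smallest_subgroup A.
by split=> [|x y /asboolP xA /asboolP yA]; apply/asboolP; [|exact: sB].
Qed.

HB.instance Definition _ := GRing.isZmodClosed.Build G zspan zspan_closed.

Definition zquot : Type := Quotient.quot zspan.
HB.instance Definition _ := Choice.on zquot.
HB.instance Definition _ := GRing.Zmodule.on zquot.
HB.instance Definition _ := Quotient.on zquot.

Definition cls (x : G) : zquot := \pi_(Quotient.quot zspan)%qT x.

Fact cls_is_zmod_morphism : zmod_morphism cls.
Proof. exact: raddfB. Qed.
HB.instance Definition _ :=
  GRing.isZmodMorphism.Build G zquot cls cls_is_zmod_morphism.

Lemma cls_eq x y : cls x = cls y <-> smallest (@subgroup G) A (x - y).
Proof.
split=> [/eqP|xy]; first by rewrite -Quotient.idealrBE => /asboolP.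
by apply/eqP; rewrite -Quotient.idealrBE; apply/asboolP.
Qed.

Lemma cls_repr (q : zquot) : cls (repr q) = q.
Proof. exact: reprK. Qed.

Lemma repr_cls x : smallest (@subgroup G) A (repr (cls x) - x).
Proof. by apply/cls_eq; rewrite cls_repr. Qed.

Lemma cls_eq0 x : A x -> cls x = 0.
Proof.
by move=> Ax; rewrite -(raddf0 cls); apply/cls_eq; rewrite subr0 => B [_ AB]; apply: AB.
Qed.

End GroupQuotient.

(* Defined on representatives; independent of them when g is additive and
   maps A into the subgroup generated by B (see [zquot_map_cls]). *)
Definition zquot_map (G H : zmodType) (A : set G) (B : set H) (g : G -> H)
  (q : zquot A) : zquot B := cls B (g (repr q)).

Section QuotientMapTheory.
Variables (G H : zmodType) (A : set G) (B : set H) (g : G -> H).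
Hypothesis gB : zmod_morphism g.
Hypothesis gAB : g @` A `<=` smallest (@subgroup H) B.

Lemma zspan_map x : smallest (@subgroup G) A x -> smallest (@subgroup H) B (g x).
Proof.
have g0 : g 0 = 0 by rewrite -(subrr 0) gB subrr.
apply: (@smallest_sub _ (@subgroup G) A (g @^-1` smallest (@subgroup H) B)).
  split=> [|a b]; rewrite /= ?g0 ?gB; first by have [] := smallest_subgroup B.
  by case: (smallest_subgroup B) => _; apply.
by move=> a Aa; apply: gAB; exists a.
Qed.

Lemma zquot_map_cls x : zquot_map B g (cls A x) = cls B (g x).
Proof. by apply/cls_eq; rewrite -gB; apply: zspan_map; exact: repr_cls. Qed.

End QuotientMapTheory.

(* [rquot I] is the quotient of R by the two-sided ideal generated by I, that
   is R/I when I is a two-sided ideal. *)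
Section RingQuotient.
Variables (R : pzRingType) (I : set R).

Definition rquot : Type := zquot (smallest (@two_sided_ideal R) I).
HB.instance Definition _ := Choice.on rquot.
HB.instance Definition _ := GRing.Zmodule.on rquot.
HB.instance Definition _ := Quotient.on rquot.

Definition rcls (x : R) : rquot := cls (smallest (@two_sided_ideal R) I) x.

Lemma rcls_eq x y : rcls x = rcls y <-> smallest (@two_sided_ideal R) I (x - y).
Proof.
rewrite cls_eq smallest_subgroup_id //.
by have [[]] := smallest_two_sided I.
Qed.

Lemma rcls_repr (q : rquot) : rcls (repr q) = q.
Proof. exact: cls_repr. Qed.

Definition rquot_one : rquot := rcls 1.
Definition rquot_mul (a b : rquot) : rquot := rcls (repr a * repr b).

Lemma rcls_mul x y : rquot_mul (rcls x) (rcls y) = rcls (x * y).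
Proof.
have [[[s0 sB] sr] sl] := smallest_two_sided I.
apply/rcls_eq.
set x' := repr (rcls x); set y' := repr (rcls y).
have -> : x' * y' - x * y = (x' - x) * y' - x * (y - y').
  by rewrite mulrBl mulrBr opprB addrA subrK.
have xx' : smallest (@two_sided_ideal R) I (x' - x).
  by apply/rcls_eq; rewrite rcls_repr.
have yy' : smallest (@two_sided_ideal R) I (y - y').
  by apply/rcls_eq; rewrite rcls_repr.
exact: (sB _ _ (sr _ _ xx') (sl _ _ yy')).
Qed.

Let rclsP (a : rquot) : {x | a = rcls x}.
Proof. by exists (repr a); exact/esym/rcls_repr. Qed.

Fact rquot_mulA : associative rquot_mul.
Proof.
move=> a b c; have [x ->] := rclsP a; have [y ->] := rclsP b.
by have [z ->] := rclsP c; rewrite !rcls_mul mulrA.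
Qed.

Fact rquot_mul1 : left_id rquot_one rquot_mul.
Proof. by move=> a; have [x ->] := rclsP a; rewrite rcls_mul mul1r. Qed.

Fact rquot_mulr1 : right_id rquot_one rquot_mul.
Proof. by move=> a; have [x ->] := rclsP a; rewrite rcls_mul mulr1. Qed.

Lemma rclsD x y : rcls (x + y) = rcls x + rcls y.
Proof. exact: raddfD. Qed.

Fact rquot_mulDl : left_distributive rquot_mul +%R.
Proof.
move=> a b c; have [x ->] := rclsP a; have [y ->] := rclsP b.
by have [z ->] := rclsP c; rewrite -rclsD !rcls_mul -rclsD mulrDl.
Qed.

Fact rquot_mulDr : right_distributive rquot_mul +%R.
Proof.
move=> a b c; have [x ->] := rclsP a; have [y ->] := rclsP b.
by have [z ->] := rclsP c; rewrite -rclsD !rcls_mul -rclsD mulrDr.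
Qed.

HB.instance Definition _ := GRing.Zmodule_isPzRing.Build rquot
  rquot_mulA rquot_mul1 rquot_mulr1 rquot_mulDl rquot_mulDr.

Fact rcls_is_zmod_morphism : zmod_morphism rcls.
Proof. exact: raddfB. Qed.
Fact rcls_is_monoid_morphism : monoid_morphism rcls.
Proof. by split=> // x y; rewrite -rcls_mul. Qed.
HB.instance Definition _ :=
  GRing.isZmodMorphism.Build R rquot rcls rcls_is_zmod_morphism.
HB.instance Definition _ :=
  GRing.isMonoidMorphism.Build R rquot rcls rcls_is_monoid_morphism.

End RingQuotient.

Section RingQuotientMap.
Variables (R S : pzRingType) (f : {rmorphism R -> S}) (I : set R) (J : set S).

Definition rquot_map of f @` I `<=` J : rquot I -> rquot J :=
  fun a => rcls J (f (repr a)).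

Hypothesis fIJ : f @` I `<=` J.

Lemma rquot_map_cls x : rquot_map fIJ (rcls I x) = rcls J (f x).
Proof.
apply/rcls_eq; rewrite -rmorphB.
have xI : smallest (@two_sided_ideal R) I (repr (rcls I x) - x).
  exact/rcls_eq/rcls_repr.
have [[[s0 sB] sr] sl] := smallest_two_sided J.
move: xI; apply: (@smallest_sub _ (@two_sided_ideal R) I
  (f @^-1` smallest (@two_sided_ideal S) J)) => [|a Ia]; last by apply: sub_gen_smallest; apply: fIJ; exists a.
split=> [|a r]; last by rewrite /= rmorphM; apply: sl.
split=> [|a r]; last by rewrite /= rmorphM; apply: sr.
by split=> [|a b]; rewrite /= ?rmorph0 ?rmorphB //; apply: sB.
Qed.

Fact rquot_map_is_zmod_morphism : zmod_morphism (rquot_map fIJ).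
Proof.
move=> a b; rewrite -[a]rcls_repr -[b]rcls_repr -rmorphB !rquot_map_cls.
by rewrite !rmorphB.
Qed.
Fact rquot_map_is_monoid_morphism : monoid_morphism (rquot_map fIJ).
Proof.
split=> [|a b]; first by rewrite -(rmorph1 (rcls I)) rquot_map_cls !rmorph1.
rewrite -[a]rcls_repr -[b]rcls_repr -rmorphM !rquot_map_cls.
by rewrite !rmorphM.
Qed.
HB.instance Definition _ := GRing.isZmodMorphism.Build (rquot I) (rquot J)
  (rquot_map fIJ) rquot_map_is_zmod_morphism.
HB.instance Definition _ := GRing.isMonoidMorphism.Build (rquot I) (rquot J)
  (rquot_map fIJ) rquot_map_is_monoid_morphism.

End RingQuotientMap.

HB.mixin Record TopologicalZmodule_isTopologicalRing R
    of TopologicalZmodule R & GRing.PzRing R := {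
  mul_continuous : continuous (fun x : R * R => x.1 * x.2)
}.

#[short(type="topologicalRingType")]
HB.structure Definition TopologicalRing :=
  {R of TopologicalZmodule R & GRing.PzRing R
      & TopologicalZmodule_isTopologicalRing R}.

Definition base_at0 (G : topologicalZmodType) (B : set (set G)) : Prop :=
  B `<=` nbhs (0 : G) /\
  forall U, nbhs (0 : G) U -> exists2 V, B V & V `<=` U.

Definition countable_base_at0 (G : topologicalZmodType) : Prop :=
  exists2 B : set (set G), countable B & base_at0 B.

Definition two_sided_linear (R : topologicalRingType) : Prop :=
  @base_at0 R [set I | open I /\ two_sided_ideal I].

Record open_subgroup (G : topologicalZmodType) := OpenSubgroup {
  osg_set :> set G;
  osg_open : open osg_set;
  osg_subgroup : subgroup osg_set }.

Definition coherent (G : topologicalZmodType)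
    (x : forall U : open_subgroup G, zquot U) : Prop :=
  forall U V : open_subgroup G, U `<=` V -> zquot_map V idfun (x U) = x V.

Definition complete_separated (G : topologicalZmodType) : Prop :=
  set_bij [set: G] [set x | @coherent G x] (fun g U => cls U g).

HB.mixin Record TopologicalRing_isTwoSidedLinear R of TopologicalRing R := {
  two_sided_linearP : two_sided_linear R
}.

HB.mixin Record TopologicalZmodule_isCompleteSeparated G
    of TopologicalZmodule G := {
  complete_separatedP : complete_separated G
}.

#[short(type="clRingType")]
HB.structure Definition CompleteLinearRing :=
  {R of TopologicalRing R & TopologicalRing_isTwoSidedLinear R
      & TopologicalZmodule_isCompleteSeparated R}.

(* Right modules over A are left modules over the converse ring A^c, and
   [rsc y a] is y a. *)
Definition rsc (A : pzRingType) (N : lmodType A^c) (y : N) (a : A) : N :=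
  (a : A^c) *: y.

Section ConverseMap.
Variables (A B : pzRingType) (g : {rmorphism A -> B}).

Definition conv_map : A^c -> B^c := g.

Fact conv_map_is_zmod_morphism : zmod_morphism conv_map.
Proof. exact: (rmorphB g). Qed.
Fact conv_map_is_monoid_morphism : monoid_morphism conv_map.
Proof. by split=> [|x y]; [exact: (rmorph1 g)|exact: (rmorphM g)]. Qed.
HB.instance Definition _ :=
  GRing.isZmodMorphism.Build A^c B^c conv_map conv_map_is_zmod_morphism.
HB.instance Definition _ :=
  GRing.isMonoidMorphism.Build A^c B^c conv_map conv_map_is_monoid_morphism.

Definition conv_rmorphism : {rmorphism A^c -> B^c} := conv_map.

End ConverseMap.

Section RestrictionOfScalars.
Variables (A B : pzRingType) (g : {rmorphism A -> B}).

Definition restr (h : {rmorphism A -> B}) (M : lmodType B) : Type := M.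

Section Object.
Variable M : lmodType B.
HB.instance Definition _ := GRing.Zmodule.on (restr g M).

Definition restr_scale (a : A) (x : restr g M) : restr g M := g a *: (x : M).

Fact restr_scaleA a b x :
  restr_scale a (restr_scale b x) = restr_scale (a * b) x.
Proof. by rewrite /restr_scale rmorphM scalerA. Qed.
Fact restr_scale1 : left_id 1 restr_scale.
Proof. by move=> x; rewrite /restr_scale rmorph1 scale1r. Qed.
Fact restr_scaleDr : right_distributive restr_scale +%R.
Proof. by move=> a x y; apply: scalerDr. Qed.
Fact restr_scaleDl x : {morph restr_scale^~ x : a b / a + b}.
Proof. by move=> a b; rewrite /restr_scale rmorphD; apply: scalerDl. Qed.

HB.instance Definition _ := GRing.Zmodule_isLmodule.Build A (restr g M)
  restr_scaleA restr_scale1 restr_scaleDr restr_scaleDl.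
End Object.

Section Morphism.
Variables (M N : lmodType B) (h : {linear M -> N}).

Definition restr_hom : restr g M -> restr g N := h.

Fact restr_hom_is_zmod_morphism : zmod_morphism restr_hom.
Proof. exact: (raddfB h). Qed.
Fact restr_hom_is_scalable : scalable restr_hom.
Proof. by move=> a x; apply: (linearZZ h (g a) x). Qed.
HB.instance Definition _ := GRing.isZmodMorphism.Build
  (restr g M) (restr g N) restr_hom restr_hom_is_zmod_morphism.
HB.instance Definition _ := GRing.isScalable.Build
  A (restr g M) (restr g N) *:%R restr_hom restr_hom_is_scalable.
End Morphism.

End RestrictionOfScalars.
Arguments restr_hom {A B} g {M N} h _.

Section TensorZ.
Variables M N : zmodType.

Definition ztens_rel : set {freeg (M * N)} :=
  [set t | exists m m' n, t = << (m + m', n) >> - << (m, n) >> - << (m', n) >>]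
  `|`
  [set t | exists m n n', t = << (m, n + n') >> - << (m, n) >> - << (m, n') >>].

(* the tensor product of M and N over the ring of integers *)
Definition ztens : Type := zquot ztens_rel.
HB.instance Definition _ := Choice.on ztens.
HB.instance Definition _ := GRing.Zmodule.on ztens.

Definition tpure (m : M) (n : N) : ztens := cls ztens_rel << (m, n) >>.

Lemma tpureDl m m' n : tpure (m + m') n = tpure m n + tpure m' n.
Proof.
apply/eqP; rewrite -subr_eq0 opprD addrA; apply/eqP.
by rewrite -!raddfB; apply: cls_eq0; left; exists m, m', n.
Qed.

Lemma tpureDr m n n' : tpure m (n + n') = tpure m n + tpure m n'.
Proof.
apply/eqP; rewrite -subr_eq0 opprD addrA; apply/eqP.
by rewrite -!raddfB; apply: cls_eq0; right; exists m, n, n'.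
Qed.

Lemma ztens_ind (Q : set ztens) : subgroup Q ->
  (forall m n, Q (tpure m n)) -> forall t, Q t.
Proof.
move=> sQ Qp t; rewrite -[t](@cls_repr _ ztens_rel) -[repr t]freeg_sumE raddf_sum.
apply: subgroup_sum => // -[m n] _.
have Qn k : Q (tpure m n *+ k).
  by elim: k => [|k IH]; rewrite ?mulr0n ?mulrS; [exact: sQ.1|exact: subgroupD].
rewrite -[coeff _ _]intz -freegU_mulz raddfMz /= -/(tpure m n).
by case: (coeff _ _) => k; [exact: Qn|apply: subgroupN => //; exact: Qn].
Qed.

(* The homomorphism sending m (x) n to b m n, for biadditive b; it is computed
   on a representative in the free abelian group (see [tlift_pure]). *)
Definition tlift (H : zmodType) (b : M -> N -> H) (t : ztens) : H :=
  fglift (fun k : M * N => b k.1 k.2 : zmodule H) (repr (t : zquot ztens_rel)).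

Section LiftTheory.
Variables (H : zmodType) (b : M -> N -> H).
Hypothesis bDl : forall m m' n, b (m + m') n = b m n + b m' n.
Hypothesis bDr : forall m n n', b m (n + n') = b m n + b m n'.

Let b' := fun k : M * N => b k.1 k.2 : zmodule H.

Lemma tlift_cls u : tlift b (cls ztens_rel u) = fglift b' u.
Proof.
have fB : zmod_morphism (fglift b' : _ -> zmodule H) := lift_is_additive b'.
apply/eqP; rewrite -subr_eq0; apply/eqP.
rewrite /tlift -/b' -[LHS](fB _ _).
have := repr_cls (A := ztens_rel) u.
move: (_ - u).
have f0 : fglift b' 0 = 0 by rewrite -(subrr 0) fB subrr.
apply: (@smallest_sub _ (@subgroup {freeg (M * N)}) ztens_rel
  [set v | fglift b' v = 0]).
  by split=> // v w /= v0 w0; rewrite fB v0 w0 subrr.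
move=> v [] [m] [n] [n'] -> /=; rewrite !fB !liftU !scale1r /b' /=.
  by rewrite bDl addrAC addrK subrr.
by rewrite bDr addrAC addrK subrr.
Qed.

Lemma tlift_pure m n : tlift b (tpure m n) = b m n.
Proof. by rewrite tlift_cls liftU scale1r. Qed.

Lemma tlift_is_zmod_morphism : zmod_morphism (tlift b).
Proof.
move=> s t; rewrite -[s](@cls_repr _ ztens_rel) -[t](@cls_repr _ ztens_rel).
have -> : cls ztens_rel (repr s) - cls ztens_rel (repr t) =
    cls ztens_rel (repr s - repr t) by rewrite raddfB.
rewrite !tlift_cls; exact: (lift_is_additive b').
Qed.

End LiftTheory.
End TensorZ.

Definition tmap (M M' N N' : zmodType) (g : M -> M') (h : N -> N') :
    ztens M N -> ztens M' N' :=
  tlift (fun m n => tpure (g m) (h n)).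

Section TensorMapTheory.
Variables (M M' N N' : zmodType) (g : {additive M -> M'}) (h : {additive N -> N'}).

Let bDl m m' n :
  tpure (g (m + m')) (h n) = tpure (g m) (h n) + tpure (g m') (h n).
Proof. by rewrite raddfD tpureDl. Qed.
Let bDr m n n' :
  tpure (g m) (h (n + n')) = tpure (g m) (h n) + tpure (g m) (h n').
Proof. by rewrite raddfD tpureDr. Qed.

Lemma tmap_pure m n : tmap g h (tpure m n) = tpure (g m) (h n).
Proof. exact: (tlift_pure bDl bDr). Qed.

Lemma tmap_is_zmod_morphism : zmod_morphism (tmap g h).
Proof. exact: (tlift_is_zmod_morphism bDl bDr). Qed.

End TensorMapTheory.

Section Tensor.
Variables (A : pzRingType).

Definition tens_rel (N : lmodType A^c) (F : lmodType A) : set (ztens N F) :=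
  [set t | exists y a x, t = tpure (rsc y a) x - tpure y (a *: x)].

(* the tensor product of N and F over A *)
Definition tens (N : lmodType A^c) (F : lmodType A) : Type :=
  zquot (@tens_rel N F).
HB.instance Definition _ N F := Choice.on (tens N F).
HB.instance Definition _ N F := GRing.Zmodule.on (tens N F).

Definition tens_map (N N' : lmodType A^c) (F : lmodType A) (g : N -> N') :
    tens N F -> tens N' F :=
  zquot_map (@tens_rel N' F) (tmap g idfun).

Lemma tens_map_pure (N N' : lmodType A^c) (F : lmodType A)
    (g : {linear N -> N'}) (y : N) (x : F) :
  tens_map g (cls (@tens_rel N F) (tpure y x)) =
  cls (@tens_rel N' F) (tpure (g y) x).
Proof.
have tB := tmap_is_zmod_morphism g (idfun : {additive F -> F}).
have tE := tmap_pure g (idfun : {additive F -> F}).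
rewrite /tens_map zquot_map_cls //; first by rewrite tE.
move=> _ [_ [z [a [w ->]]] <-]; rewrite tB !tE; apply: sub_gen_smallest.
exists (g z), a, w; have e : g (rsc z a) = rsc (g z) a := linearZZ g _ _.
exact: (congr1 (fun u => tpure u w - tpure (g z) (a *: w)) e).
Qed.

End Tensor.

Definition short_exact (K M N : zmodType) (i : K -> M) (p : M -> N) : Prop :=
  [/\ injective i, range i = [set x | p x = 0] & range p = setT].

Definition flat_module (A : pzRingType) (F : lmodType A) : Prop :=
  forall (K M N : lmodType A^c) (i : {linear K -> M}) (p : {linear M -> N}),
    short_exact i p ->
    short_exact (tens_map (F := F) i) (tens_map (F := F) p).

Section Proflat.
Variables (R S : topologicalRingType) (f : {rmorphism R -> S}).

(* the closure of f(I)S *)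
Definition ext_closure (I : set R) : set S :=
  closure (smallest (@right_ideal S) (f @` I)).

Definition strongly_right_taut : Prop :=
  @base_at0 R [set I | [/\ open I, two_sided_ideal I,
                           open (ext_closure I)
                         & two_sided_ideal (ext_closure I)]].

(* S/J as a left R/I-module, by restriction of scalars along R/I -> S/J *)
Definition quot_module (I : set R) (J : set S) (fIJ : f @` I `<=` J) :
    lmodType (rquot I) :=
  restr (rquot_map fIJ) (rquot J)^o.

(* The inclusion [fIJ] of f(I) in J holds as soon as J is the closure of
   f(I)S; it is quantified over because it occurs in the definition of the
   R/I-module structure on S/J. *)
Definition left_proflat : Prop :=
  [/\ continuous f, strongly_right_taut
    & forall (I : set R) (J : set S) (fIJ : f @` I `<=` J),
        open I -> two_sided_ideal I -> J = ext_closure I ->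
        open J -> two_sided_ideal J -> flat_module (quot_module fIJ)].

Definition ring_epimorphism (A B : pzRingType) (g : {rmorphism A -> B}) : Prop :=
  forall (C : pzRingType) (h k : {rmorphism B -> C}),
    h \o g =1 k \o g -> h =1 k.

Definition top_ring_proepimorphism : Prop :=
  continuous f /\
  forall (I : set R) (J : set S) (fIJ : f @` I `<=` J),
    open I -> two_sided_ideal I -> open J -> two_sided_ideal J ->
    ring_epimorphism (rquot_map fIJ).

End Proflat.

Record discr_module (R : topologicalRingType) := DiscrModule {
  discr_sort :> lmodType R^c;
  discrP : forall y : discr_sort, open [set r : R | rsc y r = 0] }.

Section LinearEquality.
Variables (A : pzRingType) (M N : lmodType A).

Lemma linear_ext (g h : {linear M -> N}) : g =1 h -> g = h.
Proof.
case: g h => [g [[g1] [g2]]] [h [[h1] [h2]]] /= /funext gh; subst h.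
by rewrite (Prop_irrelevance h1 g1) (Prop_irrelevance h2 g2).
Qed.

End LinearEquality.

Section DiscrCategory.
Variable R : topologicalRingType.

Definition discr_hom (M N : discr_module R) : Type := {linear M -> N}.
Definition discr_id (M : discr_module R) : discr_hom M M := idfun : {linear M -> M}.
Definition discr_comp (K M N : discr_module R)
  (g : discr_hom M N) (f : discr_hom K M) : discr_hom K N :=
  (g : {linear M -> N}) \o (f : {linear K -> M}) : {linear K -> N}.

Definition Discr : category.
Proof.
by refine (@Category (discr_module R) discr_hom discr_id discr_comp _ _ _);
  move=> *; apply: linear_ext.
Defined.

End DiscrCategory.

Section DiscrRestriction.
Variables (R S : topologicalRingType) (f : {rmorphism R -> S}).
Hypothesis f_cont : continuous f.

Fact discr_restr_subproof (N : discr_module S) (y : restr (conv_rmorphism f) N) :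
  open [set r : R | rsc y r = 0].
Proof.
have /continuousP fo := f_cont.
exact: fo (discrP (y : N)).
Qed.

Definition discr_restr_obj (N : discr_module S) : discr_module R :=
  @DiscrModule R (restr (conv_rmorphism f) N) (@discr_restr_subproof N).

Definition discr_restr_hom (M N : discr_module S) (h : discr_hom M N) :
    discr_hom (discr_restr_obj M) (discr_restr_obj N) :=
  restr_hom (conv_rmorphism f) h :
    {linear restr (conv_rmorphism f) M -> restr (conv_rmorphism f) N}.

Definition f_diamond : functor (Discr S) (Discr R).
Proof.
by refine (@Functor (Discr S) (Discr R) discr_restr_obj discr_restr_hom _ _);
  move=> *; apply: linear_ext.
Defined.

End DiscrRestriction.

Definition null_family (R : topologicalRingType) (X : choiceType)
    (r : X -> R) : Prop :=
  forall U : set R, open U -> subgroup U -> finite_set [set x | ~ U (r x)].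

(* the limit of the finite partial sums, and 0 when there is no limit *)
Definition isum (R : topologicalRingType) (X : choiceType) (r : X -> R) : R :=
  xget 0 [set s | summability.partial_sum r @ summability.totally --> s].

Section InfiniteSums.
Variable R : clRingType.
Implicit Types (X Y : choiceType) (V : set R).
#[local] Existing Instance summability.totally_filter.

Definition open_ideal V := open V /\ two_sided_ideal V.

Lemma open_ideal_sub U : open U -> subgroup U ->
  exists2 V : set R, open_ideal V & V `<=` U.
Proof.
move=> oU sU; have [_ /(_ U)] := @two_sided_linearP R; apply.
by apply: open_nbhs_nbhs; split=> //; exact: sU.1.
Qed.

Lemma sub_open_ideal_eq (x y : R) : (forall V, open_ideal V -> V (x - y)) -> x = y.
Proof.
move=> xy; have [_ inj _] := @complete_separatedP R.
apply: inj; rewrite ?in_setT //; apply/functional_extensionality_dep => U.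
apply/cls_eq; rewrite smallest_subgroup_id; last exact: osg_subgroup.
have [V oV VU] := open_ideal_sub (osg_open U) (osg_subgroup U).
exact: (VU _ (xy _ oV)).
Qed.

Lemma nbhs_addl (s : R) (W : set R) :
  nbhs s W -> exists2 V : set R, open_ideal V & forall x, V (x - s) -> W x.
Proof.
move=> sW; have : nbhs (0 : R) [set x | W (s + x)].
  have := @tvs.add_continuous R (s, 0); rewrite /continuous_at /= addr0.
  move=> /(_ W sW) [[A B] /= [sA B0] AB].
  apply: filterS B0 => x Bx; apply: (AB (s, x)); split=> //=.
  exact: nbhs_singleton.
have [_ h] := @two_sided_linearP R.
move=> /h[V oV VW]; exists V => // x /VW /=.
by rewrite addrC subrK.
Qed.

Lemma openB (V : set R) (s : R) : open_ideal V -> nbhs s [set x | V (x - s)].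
Proof.
move=> [oV [[sV _] _]].
have := @tvs.add_continuous R (s, - s); rewrite /continuous_at /= subrr.
have V0 : nbhs (0 : R) V by apply: open_nbhs_nbhs; split=> //; exact: sV.1.
move=> /(_ V V0) [[A B] /= [sA sB] AB].
apply: filterS sA => x Ax; apply: (AB (x, - s)); split=> //=.
exact: nbhs_singleton.
Qed.

Lemma partial_sumE X (r : X -> R) (A : {fset X}) :
  summability.partial_sum r A = \sum_(x <- A) r x.
Proof. by rewrite /summability.partial_sum big_seq_fsetE. Qed.

Lemma sum_fsetB X (r : X -> R) U (A B : {fset X}) : subgroup U ->
  (forall x, x \notin A -> U (r x)) -> (A `<=` B)%fset ->
  U (\sum_(x <- B) r x - \sum_(x <- A) r x).
Proof.
move=> sU Ar AB.
rewrite (big_fsetID _ (mem A)) /= addrC.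
have -> : [fset x in B | x \in A]%fset = A.
  by apply/fsetP => x; rewrite !inE /= andbC; case: (boolP (x \in A)) => // /(fsubsetP AB) ->.
rewrite addrK big_seq; apply: subgroup_sum => // x.
by rewrite !inE /= => /andP[_]; exact: Ar.
Qed.

Lemma sum_fset_mod X (r : X -> R) U (A B : {fset X}) : subgroup U ->
  (forall x, x \notin A -> U (r x)) -> (forall x, x \notin B -> U (r x)) ->
  U (\sum_(x <- B) r x - \sum_(x <- A) r x).
Proof.
move=> sU Ar Br; apply: (@subgroupBT _ _ sU (\sum_(x <- (A `|` B)%fset) r x)).
  by apply: subgroupBC => //; apply: sum_fsetB => //; exact: fsubsetUr.
by apply: sum_fsetB => //; exact: fsubsetUl.
Qed.

Lemma null_fset X (r : X -> R) U : null_family r -> open U -> subgroup U ->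
  exists A : {fset X}, forall x, x \notin A -> U (r x).
Proof.
move=> rn oU sU; exists (fset_set [set x | ~ U (r x)]) => x.
by rewrite in_fset_set ?inE; [move/negP; rewrite inE => /contrapT|exact: rn].
Qed.

Lemma fset_null X (r : X -> R) :
  (forall V, open_ideal V ->
    exists A : {fset X}, forall x, x \notin A -> V (r x)) -> null_family r.
Proof.
move=> h U oU sU; have [V oV VU] := open_ideal_sub oU sU; have [A Ar] := h V oV.
apply: (@sub_finite_set _ _ [set` A]) => [x /= nU|]; last exact: finite_fset.
by apply: contrapT => /negP/Ar/VU.
Qed.

Lemma null_cvg X (r : X -> R) : null_family r ->
  exists s : R, summability.partial_sum r @ summability.totally --> s.
Proof.
move=> rn.
have /choice[A AP] : forall U : open_subgroup R, exists A : {fset X},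
    forall x, x \notin A -> osg_set U (r x).
  by move=> U; apply: null_fset => //; [exact: osg_open|exact: osg_subgroup].
have [_ _ surj] := @complete_separatedP R.
pose a (U : open_subgroup R) := cls U (\sum_(x <- A U) r x).
have /surj[s _ sa] : [set x | @coherent R x] a.
  move=> U V UV; rewrite /a zquot_map_cls //=; last first.
    by move=> _ [x Ux <-]; apply: sub_gen_smallest; exact: UV.
  apply/cls_eq; rewrite smallest_subgroup_id; last exact: osg_subgroup.
  apply: sum_fset_mod; [exact: osg_subgroup|exact: AP|move=> x /AP; exact: UV].
exists s => W sW; have [V [oV [[sV _] _]] VW] := nbhs_addl sW.
pose V' := OpenSubgroup oV sV.
have /cls_eq : cls V' s = cls V' (\sum_(x <- A V') r x) by rewrite -/(a V') -sa.
rewrite smallest_subgroup_id // => Vs.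
exists (A V') => // B /= AB; apply: VW; rewrite partial_sumE.
apply: (subgroupBT sV _ (subgroupBC sV Vs)).
by apply: sum_fsetB => //; exact: (AP V').
Qed.

Lemma isum_mod X (r : X -> R) (A : {fset X}) V : null_family r -> open_ideal V ->
  (forall x, x \notin A -> V (r x)) -> V (isum r - \sum_(x <- A) r x).
Proof.
move=> rn oV Ar; have := xgetPex 0 (null_cvg rn); rewrite -/(isum r) /=.
move=> /(_ _ (openB (isum r) oV)) [B _ BP].
have sV := oV.2.1.1.
apply: (@subgroupBT _ _ sV (\sum_(x <- (B `|` A)%fset) r x)).
  by apply: subgroupBC => //; rewrite -partial_sumE; apply: BP; exact: fsubsetUl.
by apply: sum_fsetB => //; exact: fsubsetUr.
Qed.

Lemma isum_in X (r : X -> R) V : null_family r -> open_ideal V ->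
  (forall x, V (r x)) -> V (isum r).
Proof.
move=> rn oV Vr; have := @isum_mod X r fset0 V rn oV (fun x _ => Vr x).
by rewrite big_seq_fset0 subr0.
Qed.

Lemma isumP X (r : X -> R) s : null_family r ->
  (forall V, open_ideal V -> exists A : {fset X},
    (forall x, x \notin A -> V (r x)) /\ V (\sum_(x <- A) r x - s)) ->
  isum r = s.
Proof.
move=> rn h; apply: sub_open_ideal_eq => V oV; have [A [Ar As]] := h V oV.
exact: (subgroupBT oV.2.1.1 (isum_mod rn oV Ar) As).
Qed.

Lemma null_fsetV X (r : X -> R) V : null_family r -> open_ideal V ->
  exists A : {fset X}, forall x, x \notin A -> V (r x).
Proof. by move=> rn oV; apply: null_fset => //; [exact: oV.1|exact: oV.2.1.1]. Qed.

Lemma null_family0 X : null_family (fun _ : X => 0 : R).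
Proof.
move=> U _ sU; rewrite (_ : [set _ | _] = set0); first exact: finite_set0.
by apply/seteqP; split=> x //=; apply; exact: sU.1.
Qed.

Lemma null_familyB X (r r' : X -> R) : null_family r -> null_family r' ->
  null_family (fun x => r x - r' x).
Proof.
move=> rn rn'; apply: fset_null => V oV.
have [A Ar] := null_fsetV rn oV; have [B Br] := null_fsetV rn' oV.
exists (A `|` B)%fset => x; rewrite in_fsetU negb_or => /andP[xA xB].
by apply: oV.2.1.1.2; [exact: Ar|exact: Br].
Qed.

Lemma null_familyMr X (r : X -> R) (s : X -> R) : null_family r ->
  null_family (fun x => r x * s x).
Proof.
move=> rn; apply: fset_null => V oV; have [A Ar] := null_fsetV rn oV.
by exists A => x /Ar; exact: oV.2.1.2.
Qed.

Lemma null_family_if X (r : X -> R) (p : pred X) : null_family r ->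
  null_family (fun x => if p x then r x else 0).
Proof.
move=> rn; apply: fset_null => V oV; have [A Ar] := null_fsetV rn oV.
by exists A => x /Ar; case: ifP => // _ _; exact: oV.2.1.1.1.
Qed.

Lemma null_family1 X (x0 : X) (r : X -> R) : (forall x, x != x0 -> r x = 0) ->
  null_family r.
Proof.
move=> r0; apply: fset_null => V oV; exists [fset x0]%fset => x.
by rewrite in_fset1 => /r0 ->; exact: oV.2.1.1.1.
Qed.

Lemma isumB X (r r' : X -> R) : null_family r -> null_family r' ->
  isum (fun x => r x - r' x) = isum r - isum r'.
Proof.
move=> rn rn'; apply: isumP; first exact: null_familyB.
move=> V oV; have sV := oV.2.1.1.
have [A Ar] := null_fsetV rn oV; have [B Br] := null_fsetV rn' oV.
have ABr x : x \notin (A `|` B)%fset -> V (r x).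
  by rewrite in_fsetU negb_or => /andP[/Ar].
have ABr' x : x \notin (A `|` B)%fset -> V (r' x).
  by rewrite in_fsetU negb_or => /andP[_ /Br].
exists (A `|` B)%fset; split=> [x xAB|].
  by apply: sV.2; [exact: ABr|exact: ABr'].
rewrite sumrB; have -> (a b c d : R) : a - b - (c - d) = (a - c) - (b - d).
  by rewrite !opprB [d - c]addrC addrACA [- b + d]addrC.
by apply: sV.2; apply: subgroupBC => //; exact: isum_mod.
Qed.

Lemma isum0 X : isum (fun _ : X => 0 : R) = 0.
Proof.
apply: isumP; first exact: null_family0.
by move=> V oV; exists fset0; rewrite big_seq_fset0 subrr; split=> [x _|];
  exact: oV.2.1.1.1.
Qed.

Lemma isum1 X (x0 : X) (r : X -> R) : (forall x, x != x0 -> r x = 0) ->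
  isum r = r x0.
Proof.
move=> r0; apply: isumP; first exact: null_family1 r0.
move=> V oV; exists [fset x0]%fset; rewrite big_seq_fset1 subrr.
split=> [x|]; last exact: oV.2.1.1.1.
by rewrite in_fset1 => /r0 ->; exact: oV.2.1.1.1.
Qed.

Lemma isumMr X (r : X -> R) s : null_family r ->
  isum (fun x => r x * s) = isum r * s.
Proof.
move=> rn; apply: isumP; first exact: null_familyMr.
move=> V oV; have [A Ar] := null_fsetV rn oV; exists A; split=> [x /Ar|].
  exact: oV.2.1.2.
rewrite -mulr_suml -mulrBl; apply: oV.2.1.2; apply: subgroupBC oV.2.1.1 _ _ _.
exact: isum_mod.
Qed.

Section Fibers.
Variables (X Y : choiceType) (g : X -> Y) (r : X -> R).
Hypothesis rn : null_family r.

Lemma null_fibers :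
  null_family (fun y => isum (fun x => if g x == y then r x else 0)).
Proof.
apply: fset_null => V oV; have [A Ar] := null_fsetV rn oV.
exists [fset g x | x in A]%fset => y yA.
apply: isum_in => // [|x]; first exact: null_family_if.
case: eqP => [gx|_]; last exact: oV.2.1.1.1.
by apply: Ar; apply: contra yA => xA; rewrite -gx; apply/imfsetP; exists x.
Qed.

Lemma isum_fibers :
  isum (fun y => isum (fun x => if g x == y then r x else 0)) = isum r.
Proof.
apply: isumP; first exact: null_fibers.
move=> V oV; have sV := oV.2.1.1; have [A Ar] := null_fsetV rn oV.
have Ar' y x : x \notin A -> V (if g x == y then r x else 0).
  by move=> /Ar; case: ifP => // _ _; exact: sV.1.
have inA x : x \in A -> g x \in [fset g x | x in A]%fset.
  by move=> xA; apply/imfsetP; exists x.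
exists [fset g x | x in A]%fset; split=> [y yA|].
  apply: isum_in => // [|x]; first exact: null_family_if.
  case: eqP => [gx|_]; last exact: sV.1.
  by apply: Ar; apply: contra yA => xA; rewrite -gx inA.
apply: (@subgroupBT _ _ sV (\sum_(x <- A) r x)); last first.
  by apply: subgroupBC => //; exact: isum_mod.
have -> : \sum_(x <- A) r x = \sum_(y <- [fset g x | x in A]%fset)
    \sum_(x <- A) (if g x == y then r x else 0).
  rewrite exchange_big /= !big_seq; apply: eq_bigr => x xA.
  rewrite (big_fsetD1 (g x)) ?inA //= eqxx big_seq big1 ?addr0 // => y.
  by rewrite !inE => /andP[+ _]; rewrite eq_sym => /negbTE ->.
rewrite -sumrB; apply: subgroup_sum => // y _.
by apply: isum_mod => //; [exact: null_family_if|exact: Ar'].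
Qed.

End Fibers.
End InfiniteSums.

Section InfiniteSumMap.
Variables (R S : clRingType) (f : {rmorphism R -> S}).
Hypothesis f_cont : continuous f.

Lemma null_family_map (X : choiceType) (r : X -> R) :
  null_family r -> null_family (f \o r).
Proof.
move=> rn U oU [U0 UB]; apply: (rn (f @^-1` U)).
  by have /continuousP := f_cont; apply.
by split=> [|x y]; rewrite /= ?rmorph0 ?rmorphB //; exact: UB.
Qed.

Lemma open_ideal_preimage V : open_ideal V -> open_ideal (f @^-1` V).
Proof.
move=> [oV [[[V0 VB] Vr] Vl]]; split; first by have /continuousP := f_cont; apply.
split=> [|x r]; last by rewrite /= rmorphM; exact: Vl.
split=> [|x r]; last by rewrite /= rmorphM; exact: Vr.
by split=> [|x y]; rewrite /= ?rmorph0 ?rmorphB //; exact: VB.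
Qed.

Lemma isum_map (X : choiceType) (r : X -> R) :
  null_family r -> isum (f \o r) = f (isum r).
Proof.
move=> rn; apply: isumP; first exact: null_family_map.
move=> V oV; have oV' := open_ideal_preimage oV.
have [A Ar] := null_fsetV rn oV'; exists A; split=> //=.
rewrite -rmorph_sum -rmorphB; apply: (subgroupBC oV'.2.1.1).
exact: isum_mod.
Qed.

End InfiniteSumMap.

(* The elements of R[[X]], as functions X -> R; contramodules have their
   carrier in [choiceType], which is classically no restriction on sets. *)
Record lincomb (R : topologicalRingType) (X : choiceType) := LinComb {
  coef :> X -> R;
  coef_null : `[< null_family coef >] }.

Lemma coefP (R : topologicalRingType) (X : choiceType) (r : lincomb R X) :
  null_family r.
Proof. by apply/asboolP; exact: coef_null. Qed.

Section LinComb.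
Variables (R : clRingType) (X : choiceType).

HB.instance Definition _ := [isSub of lincomb R X for @coef R X].
HB.instance Definition _ := [Choice of lincomb R X by <:].

Definition mk_lincomb (r : X -> R) (rn : null_family r) : lincomb R X :=
  @LinComb R X r (asboolT rn).

Lemma lincombP (r r' : lincomb R X) : r =1 r' -> r = r'.
Proof. by move=> /funext; exact: val_inj. Qed.

Definition lc0 : lincomb R X := mk_lincomb (@null_family0 R X).
Definition lcB (r r' : lincomb R X) : lincomb R X :=
  mk_lincomb (null_familyB (coefP r) (coefP r')).
Definition lcN r := lcB lc0 r.
Definition lcD r r' := lcB r (lcN r').

Fact lcDA : associative lcD.
Proof. by move=> r s t; apply: lincombP => x /=; rewrite !sub0r !opprK addrA. Qed.
Fact lcDC : commutative lcD.
Proof. by move=> r s; apply: lincombP => x /=; rewrite !sub0r !opprK addrC. Qed.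
Fact lc0D : left_id lc0 lcD.
Proof. by move=> r; apply: lincombP => x /=; rewrite !sub0r opprK. Qed.
Fact lcND : left_inverse lc0 lcN lcD.
Proof. by move=> r; apply: lincombP => x /=; rewrite !sub0r opprK addNr. Qed.
HB.instance Definition _ :=
  GRing.isZmodule.Build (lincomb R X) lcDA lcDC lc0D lcND.

Lemma coefB (r s : lincomb R X) x : (r - s) x = r x - s x.
Proof. by rewrite /= !sub0r !opprK. Qed.

Fact eps_subproof (x : X) : null_family (fun y => (y == x)%:R : R).
Proof. by apply: (@null_family1 R X x) => y /negbTE ->. Qed.
Definition eps (x : X) : lincomb R X := mk_lincomb (@eps_subproof x).

Fact phi_subproof (Xi : lincomb R (lincomb R X)) :
  null_family (fun x => isum (fun rho : lincomb R X => Xi rho * rho x)).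
Proof.
apply: fset_null => V oV; have [[sV Vr] Vl] := oV.2.
have [A AP] := null_fsetV (coefP Xi) oV.
have /choice[B BP] : forall rho : lincomb R X, exists B : {fset X},
    forall x, x \notin B -> V (rho x).
  by move=> rho; apply: null_fsetV oV; exact: coefP.
exists (\bigcup_(rho <- A) B rho)%fset => x xB.
apply: isum_in => // [|rho]; first exact: null_familyMr (coefP Xi).
have [rhoA|/AP] := boolP (rho \in A); last exact: Vr.
apply: Vl; apply: BP; apply: contra xB => xB.
by apply/bigfcupP; exists rho; rewrite ?rhoA.
Qed.
Definition phi (Xi : lincomb R (lincomb R X)) : lincomb R X :=
  mk_lincomb (phi_subproof Xi).

End LinComb.

Section LinCombMap.
Variable R : clRingType.

Definition lcmap (X Y : choiceType) (g : X -> Y) (r : lincomb R X) :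
    lincomb R Y :=
  mk_lincomb (null_fibers g (coefP r)).

Lemma lcmapE (X Y : choiceType) (g : X -> Y) (r : lincomb R X) y :
  lcmap g r y = isum (fun x => if g x == y then r x else 0).
Proof. by []. Qed.

Lemma eq_isum (X : choiceType) (r s : X -> R) : r =1 s -> isum r = isum s.
Proof. by move=> /funext ->. Qed.

Fact lcmap_is_zmod_morphism (X Y : choiceType) (g : X -> Y) :
  zmod_morphism (lcmap g).
Proof.
move=> r s; apply: lincombP => y; rewrite [RHS]coefB !lcmapE -isumB; first last.
- exact: null_family_if (coefP s).
- exact: null_family_if (coefP r).
by apply: eq_isum => x; case: ifP; rewrite ?coefB ?subr0.
Qed.
HB.instance Definition _ (X Y : choiceType) (g : X -> Y) :=
  GRing.isZmodMorphism.Build (lincomb R X) (lincomb R Y) (lcmap g)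
    (lcmap_is_zmod_morphism g).

Lemma lcmap_eps (X Y : choiceType) (g : X -> Y) x :
  lcmap g (eps R x) = eps R (g x).
Proof.
apply: lincombP => y; rewrite lcmapE (@isum1 _ _ x) /= ?eqxx.
  by rewrite eq_sym; case: ifP.
by move=> z /negbTE ->; rewrite if_same.
Qed.

Lemma lcmap_comp (X Y Z : choiceType) (g : Y -> Z) (h : X -> Y) r :
  lcmap g (lcmap h r) = lcmap (g \o h) r.
Proof.
apply: lincombP => z; rewrite !lcmapE /=.
rewrite -(isum_fibers h) /=; last exact: null_family_if (coefP r).
apply: eq_isum => y; case: ifPn => [/eqP <-|gy].
  by apply: eq_isum => x; case: eqP => // ->; rewrite eqxx.
rewrite (_ : (fun _ => _) = (fun=> 0)).
  by rewrite isum0.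
by apply/funext => x; case: eqP => // ->; rewrite (negbTE gy).
Qed.

Lemma eq_lcmap (X Y : choiceType) (g h : X -> Y) : g =1 h -> lcmap g =1 lcmap h.
Proof. by move=> /funext ->. Qed.

Lemma phiE (X : choiceType) (Xi : lincomb R (lincomb R X)) x :
  phi Xi x = isum (fun rho : lincomb R X => Xi rho * rho x).
Proof. by []. Qed.

Fact phi_is_zmod_morphism (X : choiceType) : zmod_morphism (@phi R X).
Proof.
move=> r s; apply: lincombP => x; rewrite [RHS]coefB !phiE -isumB; first last.
- exact: null_familyMr (coefP s).
- exact: null_familyMr (coefP r).
by apply: eq_isum => y; rewrite coefB mulrBl.
Qed.
HB.instance Definition _ (X : choiceType) :=
  GRing.isZmodMorphism.Build (lincomb R (lincomb R X)) (lincomb R X) (@phi R X)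
    (@phi_is_zmod_morphism X).

Lemma phi_eps (X : choiceType) (r : lincomb R X) : phi (eps R r) = r.
Proof.
apply: lincombP => x /=; rewrite (@isum1 _ _ r) /= ?eqxx ?mul1r //.
by move=> s /negbTE ->; rewrite mul0r.
Qed.

End LinCombMap.

Record contramodule (R : clRingType) := Contramodule {
  ctr_sort :> choiceType;
  ctr_act : lincomb R ctr_sort -> ctr_sort;
  ctr_unit : forall p, ctr_act (eps R p) = p;
  ctr_assoc : forall Xi, ctr_act (lcmap ctr_act Xi) = ctr_act (phi Xi) }.

Record contra_hom (R : clRingType) (P Q : contramodule R) := ContraHom {
  chom :> P -> Q;
  chomP : forall r, chom (ctr_act r) = ctr_act (lcmap chom r) }.

Lemma contra_hom_ext (R : clRingType) (P Q : contramodule R)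
  (g h : contra_hom P Q) : g =1 h -> g = h.
Proof.
case: g h => [g gP] [h hP] /= /funext gh; subst h.
by rewrite (Prop_irrelevance hP gP).
Qed.

Section ContraCategory.
Variable R : clRingType.

Fact contra_id_subproof (P : contramodule R) (r : lincomb R P) :
  idfun (ctr_act r) = ctr_act (lcmap idfun r).
Proof.
congr ctr_act; apply: lincombP => p; rewrite lcmapE (@isum1 _ _ p) ?eqxx //.
by move=> q /negbTE ->.
Qed.
Definition contra_id (P : contramodule R) : contra_hom P P :=
  ContraHom (@contra_id_subproof P).

Fact contra_comp_subproof (K P Q : contramodule R)
    (g : contra_hom P Q) (h : contra_hom K P) (r : lincomb R K) :
  (g \o h) (ctr_act r) = ctr_act (lcmap (g \o h) r).
Proof. by rewrite /= chomP chomP lcmap_comp. Qed.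
Definition contra_comp (K P Q : contramodule R)
    (g : contra_hom P Q) (h : contra_hom K P) : contra_hom K Q :=
  ContraHom (contra_comp_subproof g h).

Definition Contra : category.
Proof.
by refine (@Category (contramodule R) (@contra_hom R) contra_id contra_comp
  _ _ _); move=> *; apply: contra_hom_ext.
Defined.

End ContraCategory.

Section UnderlyingGroup.
Variables (R : clRingType) (P : contramodule R).

Definition ugroup : Type := ctr_sort P.
HB.instance Definition _ := Choice.on ugroup.

Definition uact : lincomb R P -> ugroup := @ctr_act R P.

Definition ctr_zero : ugroup := uact 0.
Definition ctr_opp (p : ugroup) : ugroup := uact (- eps R (p : P)).
Definition ctr_add (p q : ugroup) : ugroup := uact (eps R (p : P) + eps R (q : P)).

Lemma uact_eps (p : ugroup) : p = uact (eps R (p : P)).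
Proof. by rewrite /uact ctr_unit. Qed.

Lemma uact_add r s : ctr_add (uact r) (uact s) = uact (r + s).
Proof.
have := @ctr_assoc R P (eps R r + eps R s).
by rewrite !raddfD /= !phi_eps !lcmap_eps.
Qed.

Lemma uact_opp r : ctr_opp (uact r) = uact (- r).
Proof.
have := @ctr_assoc R P (- eps R r).
by rewrite !raddfN /= !phi_eps !lcmap_eps.
Qed.

Fact ctr_addA : associative ctr_add.
Proof.
move=> p q t; rewrite [p]uact_eps [q]uact_eps [t]uact_eps.
by rewrite !uact_add addrA.
Qed.
Fact ctr_addC : commutative ctr_add.
Proof. by move=> p q; rewrite /ctr_add addrC. Qed.
Fact ctr_add0 : left_id ctr_zero ctr_add.
Proof. by move=> p; rewrite {1}[p]uact_eps /ctr_zero uact_add add0r -uact_eps. Qed.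
Fact ctr_addN : left_inverse ctr_zero ctr_opp ctr_add.
Proof.
by move=> p; rewrite {2}[p]uact_eps /ctr_opp uact_add addNr.
Qed.
HB.instance Definition _ :=
  GRing.isZmodule.Build ugroup ctr_addA ctr_addC ctr_add0 ctr_addN.

Fact uact_is_zmod_morphism : zmod_morphism uact.
Proof. move=> r s; rewrite -[RHS]/(ctr_add (uact r) (ctr_opp (uact s))).
by rewrite uact_opp uact_add. Qed.
HB.instance Definition _ := GRing.isZmodMorphism.Build (lincomb R P) ugroup uact
  uact_is_zmod_morphism.

End UnderlyingGroup.

Definition contra_image (R : clRingType) (I : set R) (P : contramodule R) :
    set (ugroup P) :=
  @uact R P @` [set r : lincomb R P | forall p, I (r p)].
Arguments contra_image {R} I P _.

Definition separated (R : clRingType) (P : contramodule R) : Prop :=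
  \bigcap_(I in [set I : set R | open I /\ right_ideal I]) contra_image I P
    = [set 0].

Section Contratensor.
Variable R : clRingType.

Definition ctens_l (N : discr_module R) (P : contramodule R) :
    ztens N (lincomb R P) -> ztens N (ugroup P) :=
  tmap idfun (@uact R P).

(* The sum over p in P is finite, as y (r p) = 0 for all but finitely many p *)
Definition ctens_r (N : discr_module R) (P : contramodule R) :
    ztens N (lincomb R P) -> ztens N (ugroup P) :=
  tlift (fun (y : N) (r : lincomb R P) =>
    \sum_(p \in [set: P]) tpure (rsc y (r p)) (p : ugroup P)).

Lemma discr_fset (N : discr_module R) (X : choiceType) (y : N)
    (r : lincomb R X) :
  exists A : {fset X}, forall x, x \notin A -> rsc y (r x) = 0.
Proof.
have sU : subgroup [set a : R | rsc y a = 0].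
  split=> [|a b] /=; rewrite /rsc; first exact: scale0r.
  move=> ya yb; have -> : (a - b : R) = ((a : R^c) - (b : R^c))%R by [].
  by rewrite scalerBl ya yb subrr.
exact: null_fset (coefP r) (discrP y) sU.
Qed.

Section ContratensorTheory.
Variables (N : discr_module R) (P : contramodule R).

Let b (y : N) (r : lincomb R P) : ztens N (ugroup P) :=
  \sum_(p \in [set: P]) tpure (rsc y (r p)) (p : ugroup P).

Let tpure0 (p : ugroup P) : tpure (0 : N) p = 0.
Proof. by apply: (addrI (tpure 0 p)); rewrite -tpureDl !addr0. Qed.

Let bE y (r : lincomb R P) (A : {fset P}) : (forall p, p \notin A -> rsc y (r p) = 0) ->
  b y r = \sum_(p <- A) tpure (rsc y (r p)) (p : ugroup P).
Proof. by move=> A0; apply: fsbigTE => p /A0 ->; exact: tpure0. Qed.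

Let bDl y y' r : b (y + y') r = b y r + b y' r.
Proof.
have [A A0] := discr_fset y r; have [B B0] := discr_fset y' r.
rewrite !(@bE _ _ (A `|` B)%fset) -?big_split /= => [|p|p|p].
- by apply: eq_bigr => p _; rewrite /rsc scalerDr tpureDl.
- by rewrite in_fsetU negb_or => /andP[_ /B0].
- by rewrite in_fsetU negb_or => /andP[/A0].
rewrite in_fsetU negb_or => /andP[/A0 yp /B0 y'p].
by rewrite /rsc scalerDr -!/(rsc _ _) yp y'p addr0.
Qed.

Let bDr y r r' : b y (r + r') = b y r + b y r'.
Proof.
have cD p : rsc y ((r + r') p) = rsc y (r p) + rsc y (r' p).
  have -> : (r + r') p = r p + r' p by rewrite /= sub0r opprK.
  by rewrite /rsc -scalerDl.
have [A A0] := discr_fset y r; have [B B0] := discr_fset y r'.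
rewrite !(@bE _ _ (A `|` B)%fset) -?big_split /= => [|p|p|p].
- by apply: eq_bigr => p _; rewrite cD tpureDl.
- by rewrite in_fsetU negb_or => /andP[_ /B0].
- by rewrite in_fsetU negb_or => /andP[/A0].
by rewrite in_fsetU negb_or cD => /andP[/A0 -> /B0 ->]; rewrite addr0.
Qed.

Lemma ctens_r_pure (y : N) (r : lincomb R P) : @ctens_r N P (tpure y r) =
  \sum_(p \in [set: P]) tpure (rsc y (r p)) (p : ugroup P).
Proof. exact: (tlift_pure bDl bDr). Qed.

Lemma ctens_r_is_zmod_morphism : zmod_morphism (@ctens_r N P).
Proof. exact: (tlift_is_zmod_morphism bDl bDr). Qed.

End ContratensorTheory.

Definition ctens_rel (N : discr_module R) (P : contramodule R) :
    set (ztens N (ugroup P)) :=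
  range (fun t => ctens_l t - ctens_r t).

Definition ctens (N : discr_module R) (P : contramodule R) : Type :=
  zquot (@ctens_rel N P).
HB.instance Definition _ N P := Choice.on (ctens N P).
HB.instance Definition _ N P := GRing.Zmodule.on (ctens N P).

Definition ctens_map (N N' : discr_module R) (P : contramodule R)
    (g : discr_hom N N') : ctens N P -> ctens N' P :=
  zquot_map (@ctens_rel N' P)
    (tmap (g : {linear N -> N'}) (idfun : ugroup P -> ugroup P)).

Lemma ctens_lr_map (N N' : discr_module R) (P : contramodule R)
    (g : {linear N -> N'}) (t : ztens N (lincomb R P)) :
  let G := tmap g (idfun : ugroup P -> ugroup P) in
  let G' := tmap g (idfun : lincomb R P -> lincomb R P) in
  G (ctens_l t - ctens_r t) = ctens_l (G' t) - ctens_r (G' t).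
Proof.
move=> G G'.
have GB : zmod_morphism G := tmap_is_zmod_morphism g idfun.
have G'B : zmod_morphism G' := tmap_is_zmod_morphism g idfun.
have lB (M : discr_module R) : zmod_morphism (@ctens_l M P) :=
  tmap_is_zmod_morphism idfun (@uact R P).
have rB (M : discr_module R) : zmod_morphism (@ctens_r M P) :=
  @ctens_r_is_zmod_morphism M P.
have Gp y p : G (tpure y p) = tpure (g y) p := tmap_pure g idfun y p.
have G'p y r : G' (tpure y r) = tpure (g y) r := tmap_pure g idfun y r.
have lp (M : discr_module R) (y : M) r :
  @ctens_l M P (tpure y r) = tpure y (uact r) := tmap_pure idfun (@uact R P) y r.
have G0 : G 0 = 0 by rewrite -(subrr 0) GB subrr.
have GD u v : G (u + v) = G u + G v by rewrite -{1}[v]opprK GB -[- v]sub0r GB G0 sub0r opprK.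
rewrite GB; move: t; apply: ztens_ind => [|y r].
  split=> [|s t /= es et].
    have l0 (M : discr_module R) : @ctens_l M P 0 = 0 by rewrite -(subrr 0) lB subrr.
    have r0 (M : discr_module R) : @ctens_r M P 0 = 0 by rewrite -(subrr 0) rB subrr.
    by rewrite /= (_ : G' 0 = 0) ?l0 ?r0 ?G0 // -(subrr 0) G'B subrr.
  have BB (V : zmodType) (a b c d : V) : a - b - (c - d) = (a - c) - (b - d).
    by rewrite !opprB [d - c]addrC addrACA [- b + d]addrC.
  by rewrite !(lB, rB, GB, G'B) /= BB es et [RHS]BB.
rewrite /= lp G'p lp Gp !ctens_r_pure.
have [A A0] := discr_fset y r.
have A0' p : p \notin A -> rsc (g y) (r p) = 0.
  move=> /A0 e; have <- : g (rsc y (r p)) = rsc (g y) (r p) := linearZZ g _ _.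
  by rewrite e raddf0.
have t0 (M : discr_module R) (p : ugroup P) : tpure (0 : M) p = 0.
  by apply: (addrI (tpure 0 p)); rewrite -tpureDl !addr0.
rewrite !(@fsbigTE _ _ _ _ A) => [|p /A0' ->|p /A0 ->]; rewrite ?t0 //.
congr (_ - _); rewrite (big_morph G GD G0); apply: eq_bigr => p _.
have e : g (rsc y (r p)) = rsc (g y) (r p) := linearZZ g _ _.
by rewrite Gp e.
Qed.

Lemma ctens_map_pure (N N' : discr_module R) (P : contramodule R)
    (g : {linear N -> N'}) (y : N) (p : ugroup P) :
  ctens_map g (cls (@ctens_rel N P) (tpure y p)) =
  cls (@ctens_rel N' P) (tpure (g y) p).
Proof.
have tB := tmap_is_zmod_morphism g (idfun : {additive ugroup P -> ugroup P}).
have tE := tmap_pure g (idfun : {additive ugroup P -> ugroup P}).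
rewrite /ctens_map zquot_map_cls //; first by rewrite tE.
move=> _ [_ [t _ <-] <-]; apply: sub_gen_smallest.
by exists (tmap g (idfun : lincomb R P -> lincomb R P) t) => //; rewrite ctens_lr_map.
Qed.

(* A sequence of discrete modules is exact in the category of discrete modules
   if and only if it is exact as a sequence of abelian groups, since
   submodules and quotients of discrete modules are discrete. *)
Definition flat_contra (F : contramodule R) : Prop :=
  forall (K M N : discr_module R)
      (i : discr_hom K M) (p : discr_hom M N),
    short_exact (i : {linear K -> M}) (p : {linear M -> N}) ->
    short_exact (ctens_map (P := F) i) (ctens_map (P := F) p).

End Contratensor.

Section ContraRestriction.
Variables (R S : clRingType) (f : {rmorphism R -> S}).
Hypothesis f_cont : continuous f.

Definition lcbase (X : choiceType) (r : lincomb R X) : lincomb S X :=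
  mk_lincomb (null_family_map f_cont (coefP r)).

Lemma lcbase_eps (X : choiceType) (x : X) : lcbase (eps R x) = eps S x.
Proof. by apply: lincombP => y /=; rewrite rmorph_nat. Qed.

Lemma lcbase_lcmap (X Y : choiceType) (g : X -> Y) (r : lincomb R X) :
  lcbase (lcmap g r) = lcmap g (lcbase r).
Proof.
apply: lincombP => y /=; rewrite -(isum_map f_cont).
  by apply: eq_isum => x /=; case: ifP; rewrite ?rmorph0.
exact: null_family_if (coefP r).
Qed.

Lemma lcbase_phi (X : choiceType) (Xi : lincomb R (lincomb R X)) :
  lcbase (phi Xi) = phi (lcmap (@lcbase X) (lcbase Xi)).
Proof.
apply: lincombP => x; rewrite phiE /= -(isum_map f_cont); last first.
  exact: null_familyMr (coefP Xi).
rewrite -(isum_fibers (@lcbase X)); last first.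
  apply: null_family_map => //; exact: null_familyMr (coefP Xi).
apply: eq_isum => sigma; rewrite -isumMr; last first.
  exact: null_family_if (coefP (lcbase Xi)).
apply: eq_isum => rho /=; case: eqP => [<-|_]; last by rewrite mul0r.
by rewrite rmorphM.
Qed.

Definition sharp_act (Q : contramodule S) (r : lincomb R Q) : Q :=
  ctr_act (lcbase r).

Fact sharp_unit (Q : contramodule S) (q : Q) : sharp_act (eps R q) = q.
Proof. by rewrite /sharp_act lcbase_eps ctr_unit. Qed.

Fact sharp_assoc (Q : contramodule S) (Xi : lincomb R (lincomb R Q)) :
  sharp_act (lcmap (@sharp_act Q) Xi) = sharp_act (phi Xi).
Proof.
rewrite /sharp_act lcbase_phi -ctr_assoc lcmap_comp.
by congr ctr_act; rewrite lcbase_lcmap.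
Qed.

Definition sharp_obj (Q : contramodule S) : contramodule R :=
  @Contramodule R Q (@sharp_act Q) (@sharp_unit Q) (@sharp_assoc Q).

Fact sharp_hom_subproof (P Q : contramodule S) (g : contra_hom P Q)
    (r : lincomb R P) :
  g (@ctr_act R (sharp_obj P) r) = @ctr_act R (sharp_obj Q) (lcmap g r).
Proof. by rewrite /= /sharp_act chomP lcbase_lcmap. Qed.
Definition sharp_hom (P Q : contramodule S) (g : contra_hom P Q) :
    contra_hom (sharp_obj P) (sharp_obj Q) :=
  @ContraHom R (sharp_obj P) (sharp_obj Q) g (sharp_hom_subproof g).

Definition f_sharp : functor (Contra S) (Contra R).
Proof.
by refine (@Functor (Contra S) (Contra R) sharp_obj sharp_hom _ _);
  move=> *; apply: contra_hom_ext.
Defined.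

Lemma sharp_separated (Q : contramodule S) :
  separated Q -> separated (sharp_obj Q).
Proof.
move=> sepQ; have z0 : (0 : ugroup (sharp_obj Q)) = (0 : ugroup Q).
  rewrite -(raddf0 (@uact R (sharp_obj Q))) -(raddf0 (@uact S Q)).
  apply: (congr1 (@ctr_act S Q) _ : ctr_act (lcbase (0 : lincomb R Q)) = _).
  by apply: lincombP => q /=; rewrite rmorph0.
apply/seteqP; split=> [q qI|_ -> I [oI [[I0 _] _]]]; last first.
  by exists 0 => //; rewrite raddf0.
rewrite /= z0; suff : [set 0] (q : ugroup Q) by [].
rewrite -sepQ => J [oJ [[J0 JB] Jr]].
have [|r rI <-] := qI (f @^-1` J); last by exists (lcbase r).
split; first by have /continuousP := f_cont; apply.
split=> [|x s]; last by rewrite /= rmorphM; exact: Jr.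
by split=> [|x y]; rewrite /= ?rmorph0 ?rmorphB //; exact: JB.
Qed.

End ContraRestriction.

Definition Separ (R : clRingType) : category :=
  @full_subcat (Contra R) (@separated R).

Definition Flat (R : clRingType) : category :=
  @full_subcat (Contra R) (@flat_contra R).

Section SharpRestrictions.
Variables (R S : clRingType) (f : {rmorphism R -> S}) (f_cont : continuous f).

Definition f_sharp_separ : functor (Separ S) (Separ R) :=
  @restr_full (Contra S) (Contra R) (f_sharp f_cont) (@separated S) (@separated R)
    (@sharp_separated R S f f_cont).

(* That the values lie in Flat R, for f left proflat, is a theorem. As Flat R is
   a full subcategory of Contra R, this functor is fully faithful if and only if
   its corestriction to Flat R is. *)
Definition f_sharp_flat : functor (Flat S) (Contra R) :=
  @restr_dom (Contra S) (Contra R) (f_sharp f_cont) (@flat_contra S).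

End SharpRestrictions.

(* Main.v *)
(* Strong tautness and the countable base give a decreasing base I_n of open
   ideals of R for which the closures J_n of f(I_n)S form a base of open ideals
   of S. Conditions (1) and (3) imply (5), because two ring maps S/J -> C that
   agree on R/I make C a discrete right S-module, and a separated left
   S-contramodule, in two ways that become equal over R.
   Assume (5). Elements of J_n are infinite sums of f(a)s with a in I_n, so J_n
   and I_n have the same image in any S-contramodule; as b (x) 1 = 1 (x) b in
   S/J_n (x)_{R/I_n} S/J_n, an R-homomorphism of S-contramodules is S-linear
   modulo J_n for all n, hence S-linear when its target is separated. Since flat
   contramodules over a ring with a countable base are separated, (2) follows.
   Discrete modules are treated in the same way, which gives (1).
   Assume (2). The functor N |-> N (.)_R S[[X]] is exact because S/J_n is flat
   over R/I_n. For the S-contramodule T obtained from F = S[[X]] by restriction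
   to R followed by base change to S one has N (.)_S T = N (.)_R F, so T is flat,
   and by (2) the unit F -> T is S-linear. Every R-homomorphism from F to an
   S-contramodule factors through this unit, hence is S-linear. Covering an
   arbitrary S-contramodule by some S[[X]] gives (4). *)
Require Import Defs.
From HB Require Import structures.
From mathcomp Require Import all_boot all_algebra finmap freeg.
From mathcomp Require Import all_classical topology.
Import Defs.

Set Implicit Arguments.
Unset Strict Implicit.
Unset Printing Implicit Defensive.

Import GRing.Theory.
Local Open Scope classical_set_scope.
Local Open Scope ring_scope.

(** * Infinite linear combinations *)

(** Two obstacles shape the proof. In a contramodule that is not separated, an infinite sum is not
    determined by its finite partial sums, so limits are of no use there. Instead an element of
    S[[X]] is rewritten as one sum with explicit coefficients: successive approximation collects the
    corrections of all levels into a single null family. The same device shows that flat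
    contramodules are separated. Flatness is applied to 0 -> I_n/I_{n+1} -> R/I_{n+1} -> R/I_n -> 0
    and permits to push an expression of x from coefficients in I_n to coefficients in I_{n+1} at
    the cost of multiples of expressions of 0; in the end x is an infinite sum of multiples of 0.
    The other obstacle is that N (.)_R S[[X]] is not a tensor product over one discrete ring. N is
    the union of the submodules N_n killed by I_n, and the comparison with the tensor products of
    N_n and S/J_n over R/I_n works one coordinate x at a time and only for large n, where the bound
    depends on the elements involved. *)

Lemma zmod_morphism0 (U V : zmodType) (u : U -> V) : zmod_morphism u -> u 0 = 0.
Proof. by move=> uB; rewrite -[X in u X](subrr (0 : U)) uB subrr. Qed.

Lemma zmod_morphismD (U V : zmodType) (u : U -> V) :
  zmod_morphism u -> {morph u : x y / x + y}.
Proof. by move=> uB x y; apply: (addIr (- u y)); rewrite -uB !addrK. Qed.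

Lemma zmod_morphism_sum (U V : zmodType) (u : U -> V) : zmod_morphism u ->
  forall (I : Type) (s : seq I) (F : I -> U),
  u (\sum_(i <- s) F i) = \sum_(i <- s) u (F i).
Proof.
move=> uB I s F.
exact: (big_morph u (zmod_morphismD uB) (zmod_morphism0 uB)).
Qed.

Lemma subgroup_range (U V : zmodType) (u : U -> V) :
  zmod_morphism u -> subgroup (range u).
Proof.
move=> uB; split=> [|_ _ [x _ <-] [y _ <-]].
  by exists 0 => //; exact: zmod_morphism0.
by exists (x - y).
Qed.

Lemma inj_ker0 (U V : zmodType) (u : U -> V) : zmod_morphism u ->
  (forall x, u x = 0 -> x = 0) -> injective u.
Proof.
move=> uB u0 x y xy; apply/eqP; rewrite -subr_eq0; apply/eqP/u0.
by rewrite uB xy subrr.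
Qed.

Section Sums.
Variable R : clRingType.
Implicit Types X Y : choiceType.

Lemma null_familyMl X (r : X -> R) (s : R) : null_family r ->
  null_family (fun x => s * r x).
Proof.
move=> rn; apply: fset_null => V oV; have [A Ar] := null_fsetV rn oV.
by exists A => x /Ar; exact: oV.2.2.
Qed.

Lemma isumMl X (r : X -> R) s : null_family r ->
  isum (fun x => s * r x) = s * isum r.
Proof.
move=> rn; apply: isumP; first exact: null_familyMl.
move=> V oV; have [A Ar] := null_fsetV rn oV; exists A; split=> [x /Ar|].
  exact: oV.2.2.
rewrite -mulr_sumr -mulrBr; apply: oV.2.2; apply: subgroupBC oV.2.1.1 _ _ _.
exact: isum_mod.
Qed.

(** An open subgroup is closed: modulo an open ideal contained in U the sum is a finite one. *)
Lemma isum_subgroup X (r : X -> R) (U : set R) : null_family r -> open U -> subgroup U ->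
  (forall x, U (r x)) -> U (isum r).
Proof.
move=> rn oU sU Ur; have [V oV VU] := open_ideal_sub oU sU.
have [A Ar] := null_fsetV rn oV.
rewrite -(subrK (\sum_(x <- A) r x) (isum r)).
apply: subgroupD => //; last by apply: subgroup_sum.
by apply: VU; exact: isum_mod.
Qed.

Section Exchange.
Variables (X Y : choiceType) (a : X -> Y -> R).
Hypothesis an : forall V, open_ideal V -> exists (A : {fset X}) (B : {fset Y}),
  forall x y, ~~ ((x \in A) && (y \in B)) -> V (a x y).

Lemma null_family2 x : null_family (a x).
Proof.
apply: fset_null => V /an[A [B AB]]; exists B => y yB.
by apply: AB; rewrite negb_and yB orbT.
Qed.

Lemma null_family_isum : null_family (fun x => isum (a x)).
Proof.
apply: fset_null => V oV; have [A [B AB]] := an oV; exists A => x xA.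
apply: (isum_in (null_family2 x) oV) => y.
by apply: AB; rewrite negb_and xA.
Qed.

Lemma isum2_mod (V : set R) (A : {fset X}) (B : {fset Y}) : open_ideal V ->
  (forall x y, ~~ ((x \in A) && (y \in B)) -> V (a x y)) ->
  V (isum (fun x => isum (a x)) - \sum_(x <- A) \sum_(y <- B) a x y).
Proof.
move=> oV AB; have sV := oV.2.1.1.
apply: (@subgroupBT _ _ sV (\sum_(x <- A) isum (a x))).
  apply: isum_mod => //; first exact: null_family_isum.
  move=> x xA; apply: (isum_in (null_family2 x) oV) => y.
  by apply: AB; rewrite negb_and xA.
rewrite -sumrB; apply: subgroup_sum => // x _.
apply: isum_mod => //; first exact: null_family2.
by move=> y yB; apply: AB; rewrite negb_and yB orbT.
Qed.

End Exchange.

(** Modulo any open ideal V both iterated sums agree with the same finite double sum over [A] and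
    [B]; separatedness of R does the rest. *)
Lemma isum_exchange X Y (a : X -> Y -> R) :
  (forall V, open_ideal V -> exists (A : {fset X}) (B : {fset Y}),
    forall x y, ~~ ((x \in A) && (y \in B)) -> V (a x y)) ->
  isum (fun x => isum (a x)) = isum (fun y => isum (a^~ y)).
Proof.
move=> an; apply: sub_open_ideal_eq => V oV; have [A [B AB]] := an V oV.
apply: (@subgroupBT _ _ oV.2.1.1 (\sum_(x <- A) \sum_(y <- B) a x y)).
  exact: isum2_mod.
apply: (subgroupBC oV.2.1.1); rewrite exchange_big /=; apply: isum2_mod => //.
  move=> W /an[A' [B' AB']]; exists B', A' => y x; rewrite andbC; exact: AB'.
by move=> y x; rewrite andbC; exact: AB.
Qed.

(** Outside a finite [A] the outer coefficient is in V. Each s in [A] has finitely many coefficients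
    outside V, and [B] collects their indices. This is the finite rectangle demanded by
    [isum_exchange]. *)
Lemma phi_null2 X (Xi : lincomb R (lincomb R X)) V : open_ideal V ->
  exists (A : {fset lincomb R X}) (B : {fset X}),
    forall s x, ~~ ((s \in A) && (x \in B)) -> V (Xi s * s x).
Proof.
move=> oV; have [A AP] := null_fsetV (coefP Xi) oV.
have /choice[B BP] : forall rho : lincomb R X, exists B : {fset X},
    forall x, x \notin B -> V (rho x).
  by move=> rho; apply: null_fsetV oV; exact: coefP.
exists A, (\bigcup_(rho <- A) B rho)%fset => s x.
rewrite negb_and; have [sA|/AP + _] := boolP (s \in A); last exact: oV.2.1.2.
move=> /= xB; apply: oV.2.2; apply: BP; apply: contra xB => xB.
by apply/bigfcupP; exists s; rewrite ?sA.
Qed.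

(** The pushforward along [rho] merges indices with equal values; summing over the fibres undoes
    this, so a combination of combinations can be treated as an indexed family. *)
Lemma phi_lcmap X Y (rho : X -> lincomb R Y) (r : lincomb R X) y :
  phi (lcmap rho r) y = isum (fun x => r x * rho x y).
Proof.
rewrite phiE -[RHS](isum_fibers rho); last exact: null_familyMr (coefP r).
apply: eq_isum => s /=; rewrite -isumMr; last exact: null_family_if (coefP r).
by apply: eq_isum => x; case: eqP => [<-|_] //; rewrite mul0r.
Qed.

Lemma lcmap_phi X Y (g : X -> Y) (Xi : lincomb R (lincomb R X)) :
  lcmap g (phi Xi) = phi (lcmap (lcmap g) Xi).
Proof.
apply: lincombP => y; rewrite phi_lcmap lcmapE.
rewrite (_ : (fun x => _) = fun x => isum (fun s : lincomb R X =>
    if g x == y then Xi s * s x else 0)); last first.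
  apply/funext => x; case: ifP => // _; by rewrite isum0.
rewrite isum_exchange => [|V oV]; last first.
  have [A [B AB]] := phi_null2 Xi oV; exists B, A => x s.
  by rewrite andbC; case: ifP => // _ => [/AB//|_]; exact: oV.2.1.1.1.
apply: eq_isum => s; rewrite lcmapE -isumMl; last exact: null_family_if (coefP s).
by apply: eq_isum => x; case: ifP; rewrite ?mulr0.
Qed.

Lemma phi_assoc X (Xi : lincomb R (lincomb R (lincomb R X))) :
  phi (lcmap (@phi R X) Xi) = phi (phi Xi).
Proof.
apply: lincombP => x; rewrite phi_lcmap phiE.
transitivity (isum (fun s : lincomb R (lincomb R X) =>
    isum (fun t : lincomb R X => Xi s * s t * t x))).
  apply: eq_isum => s; rewrite phiE -isumMl; last exact: null_familyMr (coefP s).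
  by apply: eq_isum => t; rewrite mulrA.
rewrite isum_exchange => [|V oV]; last first.
  have [A [B AB]] := phi_null2 Xi oV; exists A, B => s t /AB; exact: oV.2.1.2.
apply: eq_isum => t; rewrite phiE -isumMr //.
exact: null_familyMr (coefP Xi).
Qed.

Fact mono_subproof X (a : R) (x : X) :
  null_family (fun y => if y == x then a else 0).
Proof. by apply: (@null_family1 R X x) => y /negbTE ->. Qed.
Definition mono X (a : R) (x : X) : lincomb R X := mk_lincomb (@mono_subproof X a x).

Lemma lcmap_mono X Y (g : X -> Y) a x : lcmap g (mono a x) = mono a (g x).
Proof.
apply: lincombP => y; rewrite lcmapE (@isum1 _ _ x) /= ?eqxx.
  by rewrite eq_sym.
by move=> z /negbTE ->; rewrite if_same.
Qed.

Lemma mono1 X (x : X) : mono 1 x = eps R x.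
Proof. by apply: lincombP => y /=; case: eqP. Qed.

Lemma mono_is_zmod_morphism X (x : X) : zmod_morphism ((@mono X)^~ x).
Proof.
by move=> a b; apply: lincombP => y; rewrite [RHS]coefB /=; case: eqP; rewrite ?subr0.
Qed.

Lemma phi_mono X (a : R) (r : lincomb R X) x : phi (mono a r) x = a * r x.
Proof.
by rewrite phiE (@isum1 _ _ r) /= ?eqxx // => s /negbTE ->; rewrite mul0r.
Qed.

Lemma lc_coefD X (r s : lincomb R X) x : (r + s) x = r x + s x.
Proof. by rewrite -{1}[s]opprK coefB -[- s]sub0r coefB /= sub0r opprK. Qed.

Lemma lc_coef_sum X (I : Type) (l : seq I) (F : I -> lincomb R X) x :
  (\sum_(i <- l) F i) x = \sum_(i <- l) F i x.
Proof. by apply: (big_morph (fun r : lincomb R X => r x)) => // r s; exact: lc_coefD. Qed.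

(** With [A] the finite set of indices whose coefficients lie outside an open ideal, what remains
    has all coefficients in that ideal. The passages from infinite to finite sums rest on this. *)
Lemma lincomb_split X (r : lincomb R X) (A : {fset X}) x :
  (r - \sum_(z <- A) mono (r z) z) x = if x \in A then 0 else r x.
Proof.
rewrite coefB lc_coef_sum; case: ifPn => xA.
  rewrite (big_fsetD1 x) //= eqxx big_seq big1 ?addr0 ?subrr // => z.
  by rewrite !inE eq_sym => /andP[/negbTE ->].
rewrite big_seq big1 ?subr0 //= => z zA; case: eqP => // xz.
by move: xA; rewrite xz zA.
Qed.

End Sums.

(** * Infinite sums in contramodules, homomorphisms, free contramodules *)

Section ContraSums.
Variables (R : clRingType) (P : contramodule R).
Implicit Types X Y : choiceType.

(** The sum of r_x p_x for an indexed family: equal p_x may occur at different indices, so sums of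
    sums compose by [phi] without any merging of terms. *)
Definition csum X (r : lincomb R X) (p : X -> ugroup P) : ugroup P :=
  uact (@lcmap R X P p r).

Lemma uact_phi (Xi : lincomb R (lincomb R P)) :
  @uact R P (phi Xi) = csum Xi (@uact R P).
Proof. by rewrite /csum /uact ctr_assoc. Qed.

Lemma csum_uact X (r : lincomb R X) (rho : X -> lincomb R P) :
  csum r (fun x => uact (rho x)) = uact (phi (lcmap rho r)).
Proof. by rewrite uact_phi /csum lcmap_comp. Qed.

Lemma csum_phi X Y (r : lincomb R X) (rho : X -> lincomb R Y) (p : Y -> ugroup P) :
  csum r (fun x => csum (rho x) p) = csum (phi (lcmap rho r)) p.
Proof. by rewrite /csum lcmap_phi lcmap_comp -csum_uact. Qed.

Lemma csum_is_zmod_morphism X (p : X -> ugroup P) : zmod_morphism ((@csum X)^~ p).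
Proof. by move=> r s; rewrite /csum !raddfB. Qed.

Lemma csum_lcmap X Y (g : X -> Y) (r : lincomb R X) (p : Y -> ugroup P) :
  csum (lcmap g r) p = csum r (p \o g).
Proof. by rewrite /csum lcmap_comp. Qed.

Lemma csumB X (r : lincomb R X) (p q : X -> ugroup P) :
  csum r (fun x => p x - q x) = csum r p - csum r q.
Proof.
have -> : (fun x => p x - q x) =
    fun x => uact (eps R (p x : P) - eps R (q x : P)).
  by apply/funext => x; rewrite raddfB /= -!uact_eps.
rewrite csum_uact /csum -raddfB; congr uact; apply: lincombP => y.
rewrite phi_lcmap coefB !lcmapE -isumB; try exact: null_family_if (coefP r).
apply: eq_isum => x; rewrite coefB mulrBr /= ![y == _]eq_sym.
by congr (_ - _); case: eqP; rewrite ?mulr1 ?mulr0.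
Qed.

Lemma csum0 X (r : lincomb R X) : csum r (fun=> 0) = 0.
Proof. by rewrite -[X in csum r X](_ : (fun x => 0 - 0) = _) ?csumB ?subrr //; apply/funext => x; rewrite subrr. Qed.

Lemma csum_mono X a (x : X) p : csum (mono a x) p = uact (mono a (p x : P)).
Proof. by rewrite /csum lcmap_mono. Qed.

Lemma csum_eps X (x : X) p : csum (eps R x) p = p x.
Proof. by rewrite /csum lcmap_eps -uact_eps. Qed.

Definition cact (a : R) (p : ugroup P) : ugroup P := uact (mono a (p : P)).

(** A difference is itself a contramodule sum, with coefficients 1 and -1. Whatever respects [csum]
    is therefore additive. *)
Lemma csum_sub (p q : ugroup P) :
  p - q = csum (eps R true - eps R false) (fun b => if b then p else q).
Proof. by rewrite csum_is_zmod_morphism !csum_eps. Qed.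

Lemma cactE a p : cact a p = csum (mono a tt) (fun=> p).
Proof. by rewrite csum_mono. Qed.

Lemma cactA a b p : cact a (cact b p) = cact (a * b) p.
Proof.
rewrite /cact; have := csum_uact (mono a p) (fun q => mono b (q : P)).
rewrite csum_mono => ->; congr uact; rewrite lcmap_mono; apply: lincombP => x.
by rewrite phi_mono /=; case: ifP; rewrite ?mulr0.
Qed.

Lemma cact1 p : cact 1 p = p.
Proof. by rewrite /cact mono1 -uact_eps. Qed.

Lemma cactBl p : zmod_morphism (cact^~ p).
Proof. by move=> a b; rewrite /cact mono_is_zmod_morphism raddfB. Qed.

Lemma cactBr a : zmod_morphism (cact a).
Proof.
by move=> p q; rewrite !cactE csumB.
Qed.

Lemma csum_split X (r : lincomb R X) (A : {fset X}) p :
  csum r p = \sum_(x <- A) cact (r x) (p x) +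
    csum (r - \sum_(x <- A) mono (r x) x) p.
Proof.
have e : csum (\sum_(x <- A) mono (r x) x) p = \sum_(x <- A) cact (r x) (p x).
  rewrite /csum !raddf_sum; apply: eq_bigr => x _.
  by rewrite /= lcmap_mono.
have /= -> := csum_is_zmod_morphism p r (\sum_(x <- A) mono (r x) x).
by rewrite e addrC subrK.
Qed.

End ContraSums.

Lemma lcmap_id (R : clRingType) (X : choiceType) (r : lincomb R X) : lcmap id r = r.
Proof.
apply: lincombP => x; rewrite lcmapE (@isum1 _ _ x) ?eqxx //.
by move=> y /negbTE ->.
Qed.

Lemma csum_id (R : clRingType) (P : contramodule R) (r : lincomb R P) :
  csum r (id : P -> ugroup P) = uact r.
Proof. by rewrite /csum lcmap_id. Qed.

Section ContraHoms.
Variables (R : clRingType) (P Q : contramodule R) (g : contra_hom P Q).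

Definition uhom : ugroup P -> ugroup Q := g.

Lemma uhom_csum (X : choiceType) (r : lincomb R X) p :
  uhom (csum r p) = csum r (uhom \o p).
Proof. by rewrite /uhom /csum /uact chomP lcmap_comp. Qed.

Lemma uhom_act a p : uhom (cact a p) = cact a (uhom p).
Proof. by rewrite !cactE uhom_csum. Qed.

Fact uhom_is_zmod_morphism : zmod_morphism uhom.
Proof.
move=> p q; rewrite !csum_sub uhom_csum.
by congr csum; apply/funext => -[].
Qed.
HB.instance Definition _ := GRing.isZmodMorphism.Build (ugroup P) (ugroup Q) uhom
  uhom_is_zmod_morphism.
End ContraHoms.

Section FreeContra.
Variables (R : clRingType) (X : choiceType).

Definition free_contra : contramodule R :=
  @Contramodule R (lincomb R X) (@phi R X) (@phi_eps R X) (@phi_assoc R X).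

(** The subtraction of [ugroup] is built from the contramodule action and has to be identified with
    the coefficientwise one. *)
Lemma free_zmodB (r s : lincomb R X) :
  ((r : ugroup free_contra) - (s : ugroup free_contra) : ugroup free_contra) =
  (r - s : lincomb R X).
Proof.
transitivity (@uact R free_contra (eps R r - eps R s)).
  rewrite (raddfB (@uact R free_contra)).
  exact: (congr2 (fun u v : ugroup free_contra => u - v)
    (@uact_eps R free_contra r) (@uact_eps R free_contra s)).
by rewrite /uact /= raddfB /= !phi_eps.
Qed.

Lemma free_eps (r : lincomb R X) : r = csum r (@eps R X : X -> ugroup free_contra).
Proof.
apply: lincombP => x; rewrite -[RHS]/(phi (lcmap (@eps R X) r) x).
rewrite phi_lcmap (@isum1 _ _ x) /= ?eqxx ?mulr1 //.
by move=> y /negbTE yx; rewrite eq_sym yx mulr0.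
Qed.

End FreeContra.

(** * Ring epimorphisms and tensor products *)

Section QuotientLift.
Variables (G H : zmodType) (A : set G) (g : G -> H).
Hypothesis gB : zmod_morphism g.
Hypothesis gA : forall x, A x -> g x = 0.

Definition zlift (q : zquot A) : H := g (repr q).

Lemma zlift_cls x : zlift (cls A x) = g x.
Proof.
apply/eqP; rewrite -subr_eq0 -gB; apply/eqP.
have : smallest (@subgroup G) A (repr (cls A x) - x) by exact: repr_cls.
apply: (@smallest_sub _ (@subgroup G) A [set z | g z = 0]) => //.
split=> [|y z /= gy gz]; first by rewrite /= -(subrr 0) gB subrr.
by rewrite gB gy gz subrr.
Qed.

Lemma zlift_is_zmod_morphism : zmod_morphism zlift.
Proof.
by move=> p q; rewrite -[p]cls_repr -[q]cls_repr -raddfB !zlift_cls gB.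
Qed.

End QuotientLift.

Lemma zquot_ind (G : zmodType) (A : set G) (Q : zquot A -> Prop) :
  (forall x, Q (cls A x)) -> forall q, Q q.
Proof. by move=> h q; rewrite -[q]cls_repr. Qed.

Lemma tlift_rel0 (M N H : zmodType) (b : M -> N -> H)
    (bDl : forall m m' n, b (m + m') n = b m n + b m' n)
    (bDr : forall m n n', b m (n + n') = b m n + b m n') (t u : ztens M N) :
  tlift b t = tlift b u -> tlift b (t - u) = 0.
Proof. by move=> e; rewrite tlift_is_zmod_morphism // e subrr. Qed.

Section TensorLift.
Variables (A : pzRingType) (N : lmodType A^c) (F : lmodType A).

Definition tp (y : N) (x : F) : tens N F := cls (@tens_rel A N F) (tpure y x).

Lemma tpDl y y' x : tp (y + y') x = tp y x + tp y' x.
Proof. by rewrite /tp tpureDl raddfD. Qed.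

Lemma tpDr y x x' : tp y (x + x') = tp y x + tp y x'.
Proof. by rewrite /tp tpureDr raddfD. Qed.

Lemma tp0l x : tp 0 x = 0.
Proof. by apply: (addrI (tp 0 x)); rewrite -tpDl !addr0. Qed.

Lemma tp0r y : tp y 0 = 0.
Proof. by apply: (addrI (tp y 0)); rewrite -tpDr !addr0. Qed.

Lemma tp_bal y a x : tp (rsc y a) x = tp y (a *: x).
Proof.
apply/eqP; rewrite -subr_eq0 -raddfB; apply/eqP.
by apply: cls_eq0; exists y, a, x.
Qed.

Lemma tens_ind (Q : set (tens N F)) : subgroup Q ->
  (forall y x, Q (tp y x)) -> forall t, Q t.
Proof.
move=> [Q0 QB] Qp; apply: zquot_ind; apply: ztens_ind => //.
by split=> [|s t]; rewrite /= ?raddf0 ?raddfB //; exact: QB.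
Qed.

Variables (H : zmodType) (b : N -> F -> H).
Hypothesis bDl : forall y y' x, b (y + y') x = b y x + b y' x.
Hypothesis bDr : forall y x x', b y (x + x') = b y x + b y x'.
Hypothesis bal : forall y a x, b (rsc y a) x = b y (a *: x).

Definition tens_lift : tens N F -> H := zlift (tlift b).

Let rel0 t : @tens_rel A N F t -> tlift b t = 0.
Proof.
by move=> [y [a [x ->]]]; apply: tlift_rel0 => //; rewrite !tlift_pure.
Qed.

Lemma tens_lift_tp y x : tens_lift (tp y x) = b y x.
Proof.
rewrite /tens_lift /tp zlift_cls ?tlift_pure //.
exact: (tlift_is_zmod_morphism bDl bDr).
Qed.

Lemma tens_lift_is_zmod_morphism : zmod_morphism tens_lift.
Proof. exact: zlift_is_zmod_morphism (tlift_is_zmod_morphism bDl bDr) rel0. Qed.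

End TensorLift.

Section EpiTensor.
Variables (A B : pzRingType) (g : {rmorphism A -> B}).

Let NB : lmodType A^c := restr (conv_rmorphism g) (B^c)^o.
Let FB : lmodType A := restr g B^o.

Definition sqten : Type := tens NB FB.
HB.instance Definition _ := Choice.on sqten.
HB.instance Definition _ := GRing.Zmodule.on sqten.

Definition tb (x y : B) : sqten := @tp A NB FB x y.

Lemma tbDl x x' y : tb (x + x') y = tb x y + tb x' y.
Proof. exact: (@tpDl A NB FB). Qed.

Lemma tbDr x y y' : tb x (y + y') = tb x y + tb x y'.
Proof. exact: (@tpDr A NB FB). Qed.

Lemma tb_bal x a y : tb (x * g a) y = tb x (g a * y).
Proof. exact: (@tp_bal A NB FB x a y). Qed.

Lemma tb_ind (Q : set sqten) : subgroup Q -> (forall x y, Q (tb x y)) ->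
  forall t, Q t.
Proof. exact: (@tens_ind A NB FB). Qed.

Section Lift.
Variables (H : zmodType) (b : B -> B -> H).
Hypothesis bDl : forall y y' x, b (y + y') x = b y x + b y' x.
Hypothesis bDr : forall y x x', b y (x + x') = b y x + b y x'.
Hypothesis bal : forall y a x, b (y * g a) x = b y (g a * x).

Definition tb_lift : sqten -> H := @tens_lift A NB FB H b.

Lemma tb_liftE x y : tb_lift (tb x y) = b x y.
Proof. exact: (@tens_lift_tp A NB FB H b bDl bDr bal). Qed.

Lemma tb_lift_is_zmod_morphism : zmod_morphism tb_lift.
Proof. exact: (@tens_lift_is_zmod_morphism A NB FB H b bDl bDr bal). Qed.

End Lift.

Definition lact (c : B) : sqten -> sqten := tb_lift (fun x y => tb (c * x) y).
Definition ract (t : sqten) (c : B) : sqten := tb_lift (fun x y => tb x (y * c)) t.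

Lemma lact_tb c x y : lact c (tb x y) = tb (c * x) y.
Proof.
by apply: tb_liftE => *; rewrite ?mulrDr ?tbDl ?tbDr ?mulrA ?tb_bal.
Qed.

Fact lact_is_zmod_morphism c : zmod_morphism (lact c).
Proof.
by apply: tb_lift_is_zmod_morphism => *; rewrite ?mulrDr ?tbDl ?tbDr ?mulrA ?tb_bal.
Qed.
HB.instance Definition _ c :=
  GRing.isZmodMorphism.Build sqten sqten (lact c) (lact_is_zmod_morphism c).

Lemma ract_tb c x y : ract (tb x y) c = tb x (y * c).
Proof.
by apply: tb_liftE => *; rewrite ?mulrDl ?tbDl ?tbDr -?mulrA ?tb_bal.
Qed.

Fact ract_is_zmod_morphism c : zmod_morphism (ract^~ c).
Proof.
by apply: tb_lift_is_zmod_morphism => *; rewrite ?mulrDl ?tbDl ?tbDr -?mulrA ?tb_bal.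
Qed.

Lemma ract0 c : ract 0 c = 0.
Proof.
by rewrite -[X in ract X](subrr (0 : sqten)) ract_is_zmod_morphism subrr.
Qed.

Lemma ractD s t c : ract (s + t) c = ract s c + ract t c.
Proof.
have rB := ract_is_zmod_morphism c.
by apply: (addIr (- ract t c)); rewrite -rB !addrK.
Qed.

Lemma sqten_eq (V : zmodType) (u v : sqten -> V) :
  (forall s t, u (s + t) = u s + u t) -> (forall s t, v (s + t) = v s + v t) ->
  (forall x y, u (tb x y) = v (tb x y)) -> u =1 v.
Proof.
move=> uD vD uv; apply: tb_ind => //.
have h (w : sqten -> V) : (forall s t, w (s + t) = w s + w t) ->
    (w 0 = 0) * (forall s t, w (s - t) = w s - w t).
  move=> wD; split=> [|s t]; first by apply: (addrI (w 0)); rewrite -wD !addr0.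
  by apply: (addIr (w t)); rewrite -wD !subrK.
split=> [|s t /= es et]; rewrite /= ?(h _ uD) ?(h _ vD) //.
by rewrite es et.
Qed.

(* The square-zero extension of B by the bimodule B (x)_A B: the maps
   b |-> (b, 0) and b |-> (b, b (x) 1 - 1 (x) b) agree on A. *)
Definition sqz : Type := (B * sqten)%type.
HB.instance Definition _ := Choice.on sqz.
HB.instance Definition _ := GRing.Zmodule.on sqz.

Definition sqz_one : sqz := (1, 0).
Definition sqz_mul (u v : sqz) : sqz :=
  (u.1 * v.1, lact u.1 v.2 + ract u.2 v.1).

Lemma lactM c d t : lact c (lact d t) = lact (c * d) t.
Proof.
by move: t; apply: sqten_eq => [s t|s t|x y]; rewrite ?raddfD // !lact_tb mulrA.
Qed.
Lemma ractM c d t : ract (ract t c) d = ract t (c * d).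
Proof.
by move: t; apply: sqten_eq => [s t|s t|x y]; rewrite ?ractD // !ract_tb mulrA.
Qed.
Lemma lract c d t : lact c (ract t d) = ract (lact c t) d.
Proof.
move: t; apply: sqten_eq => [s t|s t|x y]; last by rewrite ract_tb !lact_tb ract_tb.
  by rewrite ractD raddfD.
by rewrite raddfD ractD.
Qed.
Lemma lact1 t : lact 1 t = t.
Proof.
by move: t; apply: sqten_eq => [s t|s t|x y]; rewrite ?raddfD // lact_tb mul1r.
Qed.
Lemma ract1 t : ract t 1 = t.
Proof.
by move: t; apply: sqten_eq => [s t|s t|x y]; rewrite ?ractD // ract_tb mulr1.
Qed.
Lemma lactDl c d t : lact (c + d) t = lact c t + lact d t.
Proof.
move: t; apply: sqten_eq => [s t|s t|x y]; rewrite ?raddfD //=.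
  by rewrite addrACA.
by rewrite !lact_tb mulrDl tbDl.
Qed.
Lemma ractDr c d t : ract t (c + d) = ract t c + ract t d.
Proof.
move: t; apply: sqten_eq => [s t|s t|x y]; rewrite ?ractD //=.
  by rewrite addrACA.
by rewrite !ract_tb mulrDr tbDr.
Qed.

Fact sqz_mulA : associative sqz_mul.
Proof.
move=> [b e] [c s] [d t]; rewrite /sqz_mul /=; congr (_, _); first exact: mulrA.
by rewrite raddfD /= ractD lactM ractM lract addrA.
Qed.
Fact sqz_mul1 : left_id sqz_one sqz_mul.
Proof.
by move=> [b e]; rewrite /sqz_mul /= mul1r lact1 ract0 addr0.
Qed.
Fact sqz_mulr1 : right_id sqz_one sqz_mul.
Proof. by move=> [b e]; rewrite /sqz_mul /= mulr1 ract1 raddf0 add0r. Qed.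
Fact sqz_mulDl : left_distributive sqz_mul +%R.
Proof.
move=> [b e] [c s] [d t]; rewrite /sqz_mul /=; congr (_, _); first exact: mulrDl.
by rewrite /= lactDl ractD addrACA.
Qed.
Fact sqz_mulDr : right_distributive sqz_mul +%R.
Proof.
move=> [b e] [c s] [d t]; rewrite /sqz_mul /=; congr (_, _); first exact: mulrDr.
by rewrite /= ractDr raddfD addrACA.
Qed.
HB.instance Definition _ := GRing.Zmodule_isPzRing.Build sqz
  sqz_mulA sqz_mul1 sqz_mulr1 sqz_mulDl sqz_mulDr.

Definition sqz_triv (b : B) : sqz := (b, 0).
Fact sqz_triv_is_zmod_morphism : zmod_morphism sqz_triv.
Proof. by move=> b c; congr (_, _); rewrite subrr. Qed.
Fact sqz_triv_is_monoid_morphism : monoid_morphism sqz_triv.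
Proof.
split=> // b c; congr (_, _); rewrite /= raddf0 add0r.
by rewrite ract0.
Qed.
HB.instance Definition _ :=
  GRing.isZmodMorphism.Build B sqz sqz_triv sqz_triv_is_zmod_morphism.
HB.instance Definition _ :=
  GRing.isMonoidMorphism.Build B sqz sqz_triv sqz_triv_is_monoid_morphism.

Lemma tbBl x x' y : tb (x - x') y = tb x y - tb x' y.
Proof. by apply: (addIr (tb x' y)); rewrite -tbDl !subrK. Qed.
Lemma tbBr x y y' : tb x (y - y') = tb x y - tb x y'.
Proof. by apply: (addIr (tb x y')); rewrite -tbDr !subrK. Qed.

Definition sqz_der (b : B) : sqz := (b, tb b 1 - tb 1 b).
Fact sqz_der_is_zmod_morphism : zmod_morphism sqz_der.
Proof.
move=> b c; congr (_, _); rewrite /= tbBl tbBr !opprB.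
by rewrite [tb 1 c - tb 1 b]addrC addrACA [- tb c 1 + tb 1 c]addrC.
Qed.
(** Multiplicativity is the Leibniz rule for the inner derivation b |-> b (x) 1 - 1 (x) b. *)
Fact sqz_der_is_monoid_morphism : monoid_morphism sqz_der.
Proof.
split=> [|b c]; first by rewrite /sqz_der subrr.
congr (_, _); rewrite /= raddfB /= ract_is_zmod_morphism !lact_tb !ract_tb.
by rewrite mulr1 mul1r addrA subrK.
Qed.
HB.instance Definition _ :=
  GRing.isZmodMorphism.Build B sqz sqz_der sqz_der_is_zmod_morphism.
HB.instance Definition _ :=
  GRing.isMonoidMorphism.Build B sqz sqz_der sqz_der_is_monoid_morphism.

Lemma epi_tb : ring_epimorphism g -> forall b, tb b 1 = tb 1 b.
Proof.
move=> epi b; apply/eqP; rewrite -subr_eq0; apply/eqP.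
have /(congr1 snd) /= : sqz_der b = sqz_triv b; last by [].
apply: (epi sqz sqz_der sqz_triv) => a; congr (_, _).
by rewrite /= -[in tb (g a)](mul1r (g a)) tb_bal mulr1 subrr.
Qed.

(** The form in which epimorphy is used below: a balanced biadditive map factors through B (x)_A B,
    where c (x) 1 = 1 (x) c. *)
Lemma epi_bilinear (H : zmodType) (b : B -> B -> H) : ring_epimorphism g ->
  (forall y y' x, b (y + y') x = b y x + b y' x) ->
  (forall y x x', b y (x + x') = b y x + b y x') ->
  (forall y a x, b (y * g a) x = b y (g a * x)) -> forall c, b c 1 = b 1 c.
Proof.
by move=> epi bDl bDr bal c; rewrite -!(tb_liftE bDl bDr bal) (epi_tb epi).
Qed.

End EpiTensor.

(** * The contratensor product *)

Section RightScaling.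
Variables (A : pzRingType) (N : lmodType A^c).
Implicit Types (y : N) (a b : A).

Lemma rscM y a b : rsc (rsc y a) b = rsc y (a * b).
Proof. exact: scalerA. Qed.
Lemma rsc1 y : rsc y (1 : A) = y.
Proof. exact: scale1r. Qed.
Lemma rscDr y a b : rsc y (a + b) = rsc y a + rsc y b.
Proof. exact: scalerDl. Qed.
Lemma rscBr y a b : rsc y (a - b) = rsc y a - rsc y b.
Proof. exact: scalerBl. Qed.
Lemma rsc0r y : rsc y (0 : A) = 0.
Proof. exact: scale0r. Qed.
Lemma rscDl y z a : rsc (y + z) a = rsc y a + rsc z a.
Proof. exact: scalerDr. Qed.
Lemma rscBl y z a : rsc (y - z) a = rsc y a - rsc z a.
Proof. exact: scalerBr. Qed.
Lemma rsc0l a : rsc (0 : N) a = 0.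
Proof. exact: scaler0. Qed.
Lemma rsc_sumr y (I : Type) (s : seq I) (F : I -> A) :
  rsc y (\sum_(i <- s) F i) = \sum_(i <- s) rsc y (F i).
Proof. by apply: (big_morph (rsc y)) => [x x'|]; rewrite ?rscDr ?rsc0r. Qed.
Lemma rsc_lin (M : lmodType A^c) (g : {linear N -> M}) y a :
  g (rsc y a) = rsc (g y) a.
Proof. exact: linearZZ. Qed.
Lemma ann_subgroup y : subgroup [set a : A | rsc y a = 0].
Proof. by split=> [|a b /= ya yb]; rewrite /= ?rsc0r // rscBr ya yb subrr. Qed.

End RightScaling.

Section Ctens.
Variables (R : clRingType) (N : discr_module R) (P : contramodule R).
Implicit Types (y : N) (p q : ugroup P) (X : choiceType).

Definition ct y p : ctens N P := cls (@ctens_rel R N P) (tpure y p).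

Lemma ctDl y y' p : ct (y + y') p = ct y p + ct y' p.
Proof. by rewrite /ct tpureDl raddfD. Qed.

Lemma ctDr y p q : ct y (p + q) = ct y p + ct y q.
Proof. by rewrite /ct tpureDr raddfD. Qed.

Lemma ct0l p : ct 0 p = 0.
Proof. by apply: (addrI (ct 0 p)); rewrite -ctDl !addr0. Qed.

Lemma ct0r y : ct y 0 = 0.
Proof. by apply: (addrI (ct y 0)); rewrite -ctDr !addr0. Qed.

Lemma ctBl y y' p : ct (y - y') p = ct y p - ct y' p.
Proof. by apply: (addIr (ct y' p)); rewrite -ctDl !subrK. Qed.

Lemma ctBr y p q : ct y (p - q) = ct y p - ct y q.
Proof. by apply: (addIr (ct y q)); rewrite -ctDr !subrK. Qed.

Lemma ct_sumr y (I : Type) (s : seq I) (F : I -> ugroup P) :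
  ct y (\sum_(i <- s) F i) = \sum_(i <- s) ct y (F i).
Proof. by apply: (big_morph (ct y)) => [x x'|]; rewrite ?ctDr ?ct0r. Qed.

Lemma ctens_ind (Q : set (ctens N P)) : subgroup Q ->
  (forall y p, Q (ct y p)) -> forall t, Q t.
Proof.
move=> [Q0 QB] Qp; apply: zquot_ind; apply: ztens_ind => //.
by split=> [|s t]; rewrite /= ?raddf0 ?raddfB //; exact: QB.
Qed.

Lemma ctens_sum (t : ctens N P) : exists l : seq (N * ugroup P),
  t = \sum_(u <- l) ct u.1 u.2.
Proof.
move: t; apply: ctens_ind => [|y p]; last by exists [:: (y, p)]; rewrite big_seq1.
split=> [|_ _ [l ->] [l' ->]]; first by exists [::]; rewrite big_nil.
exists (l ++ [seq (- u.1, u.2) | u <- l']); rewrite big_cat big_map /= -sumrN.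
by congr (_ + _); apply: eq_bigr => u _; rewrite -[- u.1]sub0r ctBl ct0l sub0r.
Qed.

Lemma ct_uact y (r : lincomb R P) (A : {fset P}) :
  (forall p : P, p \notin A -> rsc y (r p) = 0) ->
  ct y (uact r) = \sum_(p <- A) ct (rsc y (r p)) p.
Proof.
move=> A0; apply/eqP; rewrite -subr_eq0 /ct.
have -> : \sum_(p <- A) cls (@ctens_rel R N P) (tpure (rsc y (r p)) (p : ugroup P)) =
   cls (@ctens_rel R N P) (ctens_r (tpure y r)).
  rewrite ctens_r_pure (@fsbigTE _ _ _ _ A) => [|p /A0 ->]; first by rewrite raddf_sum.
  by apply: (addrI (tpure 0 (p : ugroup P))); rewrite -tpureDl !addr0.
rewrite -raddfB; apply/eqP; apply: cls_eq0; exists (tpure y r) => //.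
by congr (_ - _); exact: (tmap_pure idfun (@uact R P)).
Qed.

Lemma ct_act y a p : ct y (cact a p) = ct (rsc y a) p.
Proof.
pose p1 : ctr_sort P := p.
rewrite /cact (@ct_uact _ _ [fset p1]%fset) ?big_seq_fset1 /= ?eqxx //.
by move=> q; rewrite in_fset1 => /negbTE ->; rewrite rsc0r.
Qed.

(** The annihilator of y is an open subgroup, so it also contains the infinite sums that are the
    coefficients of the pushforward to P. The defining relation of the contratensor product then has
    no term left. *)
Lemma ct_csum0 X y (r : lincomb R X) (p : X -> ugroup P) :
  (forall x, rsc y (r x) = 0) -> ct y (csum r p) = 0.
Proof.
move=> r0; rewrite /csum (@ct_uact _ _ fset0) ?big_seq_fset0 // => q _.
rewrite lcmapE; apply: (isum_subgroup _ (@discrP R N y) (ann_subgroup y)) => [|x].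
  exact: null_family_if (coefP r).
by rewrite /=; case: ifP => //; rewrite rsc0r.
Qed.

Lemma ct_csum X y (r : lincomb R X) (p : X -> ugroup P) (A : {fset X}) :
  (forall x, x \notin A -> rsc y (r x) = 0) ->
  ct y (csum r p) = \sum_(x <- A) ct (rsc y (r x)) (p x).
Proof.
move=> A0; rewrite (csum_split r A) ctDr ct_csum0 ?addr0 => [|x].
  by rewrite ct_sumr; apply: eq_bigr => x _; rewrite ct_act.
by rewrite lincomb_split; case: ifPn => [_|/A0//]; rewrite rsc0r.
Qed.

Section Lift.
Variables (H : zmodType) (b : N -> ugroup P -> H).
Hypothesis bDl : forall y y' p, b (y + y') p = b y p + b y' p.
Hypothesis bDr : forall y p q, b y (p + q) = b y p + b y q.
Hypothesis bal : forall y (r : lincomb R P), exists2 A : {fset P},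
  (forall p : P, p \notin A -> rsc y (r p) = 0) &
  b y (uact r) = \sum_(p <- A) b (rsc y (r p)) p.

Definition ct_lift : ctens N P -> H := zlift (tlift b).

Let rel0 t : @ctens_rel R N P t -> tlift b t = 0.
Proof.
have tB := tlift_is_zmod_morphism bDl bDr.
have t0 : tlift b 0 = 0 by rewrite -(subrr (0 : ztens N (ugroup P))) tB subrr.
have lB : zmod_morphism (@ctens_l R N P) := tmap_is_zmod_morphism idfun (@uact R P).
have rB : zmod_morphism (@ctens_r R N P) := @ctens_r_is_zmod_morphism R N P.
move=> [u _ <-]; rewrite tB; apply/eqP; rewrite subr_eq0; apply/eqP.
move: u; apply: ztens_ind => [|y r].
  split=> [|s v /= es ev]; last by rewrite /= lB rB !tB es ev.
  have l0 : @ctens_l R N P 0 = 0 by rewrite -[X in ctens_l X](subrr 0) lB subrr.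
  have r0 : @ctens_r R N P 0 = 0 by rewrite -[X in ctens_r X](subrr 0) rB subrr.
  by rewrite /= l0 r0.
have -> : ctens_l (tpure y r) = tpure y (uact r) := tmap_pure idfun (@uact R P) y r.
have [A A0 bA] := bal y r.
rewrite tlift_pure // bA ctens_r_pure (@fsbigTE _ _ _ _ A) => [|p /A0 ->]; last first.
  by apply: (addrI (tpure 0 (p : ugroup P))); rewrite -tpureDl !addr0.
have tD u v : tlift b (u + v) = tlift b u + tlift b v.
  by apply: (addIr (- tlift b v)); rewrite -tB !addrK.
rewrite (big_morph (tlift b) tD t0); apply: eq_bigr => p _.
by rewrite tlift_pure.
Qed.

Lemma ct_lift_ct y p : ct_lift (ct y p) = b y p.
Proof.
rewrite /ct_lift /ct zlift_cls ?tlift_pure //.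
exact: (tlift_is_zmod_morphism bDl bDr).
Qed.

Lemma ct_lift_is_zmod_morphism : zmod_morphism ct_lift.
Proof. exact: zlift_is_zmod_morphism (tlift_is_zmod_morphism bDl bDr) rel0. Qed.

End Lift.
End Ctens.

Section CtensMap.
Variables (R : clRingType) (P : contramodule R).

Lemma ctens_map_is_zmod_morphism (N N' : discr_module R)
  (g : {linear N -> N'}) : zmod_morphism (@ctens_map R N N' P g).
Proof.
have tB := tmap_is_zmod_morphism g (idfun : {additive ugroup P -> ugroup P}).
have e u : @ctens_map R N N' P g (cls _ u) = cls _ (tmap g idfun u).
  rewrite /ctens_map zquot_map_cls // => _ [_ [t _ <-] <-].
  apply: sub_gen_smallest.
  by exists (tmap g (idfun : lincomb R P -> lincomb R P) t) => //; rewrite ctens_lr_map.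
move=> s t; rewrite -[s](@cls_repr _ (@ctens_rel R N P)).
by rewrite -[t](@cls_repr _ (@ctens_rel R N P)) -raddfB !e tB raddfB.
Qed.

Lemma ctens_map_ct (N N' : discr_module R) (g : {linear N -> N'}) y p :
  @ctens_map R N N' P g (ct y p) = ct (g y) p.
Proof. exact: ctens_map_pure. Qed.

Section RightExact.
Variables (K M N : discr_module R) (i : {linear K -> M}) (q : {linear M -> N}).
Hypothesis ex : short_exact i q.

Let qi k : q (i k) = 0.
Proof. by case: ex => _ h _; have : range i (i k) by [exists k]; rewrite h. Qed.

(** A section [s] of q as a map of sets gives n (x) p |-> s n (x) p with values in the cokernel of
    the first map. There the choice of preimages does not matter, so the assignment is additive and
    balanced, and it is a left inverse of the map from the cokernel to N (.)_R P. *)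
Lemma ctens_right_exact :
  range (@ctens_map R K M P i) = [set t | @ctens_map R M N P q t = 0] /\
  range (@ctens_map R M N P q) = setT.
Proof.
have [_ ei eq] := ex.
have iB := ctens_map_is_zmod_morphism i.
have qB := ctens_map_is_zmod_morphism q.
split; last first.
  apply/seteqP; split=> // t _; move: t; apply: ctens_ind => [|n p].
    exact: subgroup_range.
  have [m _ <-] : range q n by rewrite eq.
  by exists (ct m p) => //; rewrite ctens_map_ct.
apply/seteqP; split=> [_ [t _ <-]|t /= qt].
  move: t; apply: ctens_ind => [|k p]; last by rewrite /= !ctens_map_ct qi ct0l.
  split=> [|s t /= es et]; rewrite /=; first by rewrite !zmod_morphism0.
  by rewrite iB qB es et subrr.
pose A := range (@ctens_map R K M P i).
have sA : subgroup A := subgroup_range iB.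
have /choice[s sP] : forall n, exists m, q m = n.
  by move=> n; have [m _ <-] : range q n; [rewrite eq|exists m].
have modA m m' p : q m = q m' -> cls A (ct m p) = cls A (ct m' p).
  move=> mm'; apply/eqP; rewrite -subr_eq0 -raddfB -ctBl; apply/eqP/cls_eq0.
  have [k _ <-] : range i (m - m') by rewrite ei /= raddfB /= mm' subrr.
  by exists (ct k p) => //; rewrite ctens_map_ct.
pose b n p := cls A (ct (s n) p).
have bDl n n' p : b (n + n') p = b n p + b n' p.
  by rewrite /b -raddfD -ctDl; apply: modA; rewrite raddfD /= !sP.
have bDr n p p' : b n (p + p') = b n p + b n p' by rewrite /b -raddfD -ctDr.
have bal n (r : lincomb R P) : exists2 B : {fset P},
    (forall p, p \notin B -> rsc n (r p) = 0) &
    b n (uact r) = \sum_(p <- B) b (rsc n (r p)) p.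
  have [B B0] := discr_fset (s n) r; exists B => [p /B0 e|].
    by rewrite -(sP n) -rsc_lin e raddf0.
  rewrite /b (ct_uact B0) raddf_sum; apply: eq_bigr => p _.
  by apply: modA; rewrite sP rsc_lin sP.
have lB := ct_lift_is_zmod_morphism bDl bDr bal.
have lE u : ct_lift b (@ctens_map R M N P q u) = cls A u.
  apply/eqP; rewrite -subr_eq0; apply/eqP; move: u; apply: ctens_ind => [|m p].
    split=> [|u v /= eu ev]; first by rewrite /= (zmod_morphism0 qB) (zmod_morphism0 lB) raddf0 subrr.
    rewrite /= qB lB raddfB; move/eqP: eu; rewrite subr_eq0 => /eqP ->.
    by move/eqP: ev; rewrite subr_eq0 => /eqP ->; rewrite subrr.
  rewrite /= ctens_map_ct ct_lift_ct // /b.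
  by rewrite (modA _ m) ?subrr // sP.
have : cls A t = cls A 0 by rewrite -lE qt (zmod_morphism0 lB) raddf0.
by move/cls_eq; rewrite subr0 smallest_subgroup_id.
Qed.

End RightExact.

(** Right exactness holds for every P, so flatness is a matter of injectivity alone. *)
Lemma flat_contra_inj :
  (forall (K M N : discr_module R) (i : {linear K -> M}) (q : {linear M -> N}),
    short_exact i q -> forall t : ctens K P, @ctens_map R K M P i t = 0 -> t = 0) ->
  flat_contra P.
Proof.
move=> h K M N i q ex; have [e1 e2] := ctens_right_exact ex.
split=> //; apply: inj_ker0; first exact: ctens_map_is_zmod_morphism.
exact: h ex.
Qed.

End CtensMap.

(** * Filtrations by open ideals *)

(** B need not be stable under intersection, so its members are picked one at a time, each inside
    its predecessor and inside one more member of the countable base. *)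
Lemma base_seq (R : topologicalRingType) (B : set (set R)) :
  countable_base_at0 R -> base_at0 B ->
  exists I : nat -> set R, [/\ forall n, B (I n), forall n, I n.+1 `<=` I n
    & forall U, nbhs (0 : R) U -> exists n, I n `<=` U].
Proof.
move=> [C /countable_injP[c cinj] [C0 CU]] [B0 BU].
(* The member of [C] that the injection [c] numbers n, or the whole ring if there is none. *)
pose V n := xget setT [set W | C W /\ c W = n].
have V0 n : nbhs (0 : R) (V n).
  rewrite /V; case: xgetP => [W _ [CW _]|_]; first exact: C0.
  exact: filterT.
have CV W : C W -> V (c W) = W.
  move=> CW; rewrite /V; case: xgetP => [W' _ [CW' e]|/(_ W)[]//].
  by apply: cinj; rewrite ?inE.
have /choice[d dP] : forall W, exists I, nbhs (0 : R) W -> B I /\ I `<=` W.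
  by move=> W; have [/BU[I BI IW]|nW] := pselect (nbhs (0 : R) W); [exists I|exists W].
pose I := fix I n := if n is m.+1 then d (I m `&` V m) else d setT.
have BI n : B (I n).
  by elim: n => [|n IH] /=; [apply: (dP _ _).1; exact: filterT|
    apply: (dP _ _).1; apply: filterI => //; exact: B0].
have IS n : I n.+1 `<=` I n `&` V n.
  by apply: (dP _ _).2; apply: filterI => //; exact: B0.
exists I; split=> // [n x /IS[]//|U /CU[W CW WU]].
(* [V n] is taken into account only at stage n+1, hence the successor. *)
by exists (c W).+1 => x /IS[_]; rewrite CV // => /WU.
Qed.

Lemma open_supgroup (R : clRingType) (V U : set R) :
  open_ideal V -> subgroup U -> V `<=` U -> open U.
Proof.
move=> oV sU VU; rewrite openE => s Us; rewrite /interior.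
apply: filterS (openB s oV) => x /VU Uxs.
by rewrite -(subrK s x); exact: subgroupD.
Qed.

(** * Restriction of scalars and images of open ideals *)

Section Sharp.
Variables (R S : clRingType) (f : {rmorphism R -> S}) (f_cont : continuous f).
Variable Q : contramodule S.

Lemma csum_sharp (X : choiceType) (r : lincomb R X) (q : X -> Q) :
  @csum R (sharp_obj f_cont Q) X r q = @csum S Q X (lcbase f_cont r) q.
Proof. by rewrite /csum /uact /= /sharp_act lcbase_lcmap. Qed.

Lemma lcbaseB (X : choiceType) (r s : lincomb R X) :
  lcbase f_cont (r - s) = lcbase f_cont r - lcbase f_cont s.
Proof.
apply: lincombP => x; rewrite [RHS]coefB.
by rewrite -[LHS]/(f ((r - s) x)) coefB rmorphB.
Qed.

Lemma lcbase_mono (X : choiceType) a (x : X) :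
  lcbase f_cont (mono a x) = mono (f a) x.
Proof. by apply: lincombP => y /=; case: ifP; rewrite ?rmorph0. Qed.

(** The two group structures come from different actions, but both differences are sums over [bool]
    with coefficients 1 and -1, which f preserves. *)
Lemma sharpB (p q : Q) :
  ((p : ugroup (sharp_obj f_cont Q)) - (q : ugroup (sharp_obj f_cont Q))
    : ugroup (sharp_obj f_cont Q)) =
  ((p : ugroup Q) - (q : ugroup Q) : ugroup Q).
Proof.
by rewrite csum_sub [RHS]csum_sub csum_sharp lcbaseB !lcbase_eps.
Qed.

Lemma sharp_cact a (q : Q) :
  @cact R (sharp_obj f_cont Q) a q = @cact S Q (f a) q.
Proof.
by rewrite [LHS]cactE [RHS]cactE csum_sharp lcbase_mono.
Qed.

End Sharp.

Section SharpHoms.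
Variables (R S : clRingType) (f : {rmorphism R -> S}) (f_cont : continuous f).
Variables (P Q : contramodule S).
Variable g : contra_hom (sharp_obj f_cont P) (sharp_obj f_cont Q).

Definition shom : ugroup P -> ugroup Q := g.

Lemma shom_is_zmod_morphism : zmod_morphism shom.
Proof.
move=> p q; rewrite -!(sharpB f_cont).
exact: (@uhom_is_zmod_morphism R _ _ g).
Qed.

Lemma shom_act a p : shom (cact (f a) p) = cact (f a) (shom p).
Proof. by rewrite -!(sharp_cact f_cont); exact: (@uhom_act R _ _ g). Qed.

Lemma shom_csum (X : choiceType) (r : lincomb R X) (p : X -> ugroup P) :
  shom (csum (lcbase f_cont r) p) = csum (lcbase f_cont r) (shom \o p).
Proof. by rewrite -!csum_sharp; exact: (@uhom_csum R _ _ g). Qed.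

End SharpHoms.

Section ContraImage.
Variables (R : clRingType) (P : contramodule R) (J : set R).
Hypothesis oJ : open_ideal J.
Let sJ : subgroup J := oJ.2.1.1.

Lemma csum_image (X : choiceType) (r : lincomb R X) (p : X -> ugroup P) :
  (forall x, J (r x)) -> contra_image J P (csum r p).
Proof.
move=> Jr; exists (@lcmap R X P p r) => // q; rewrite lcmapE.
apply: isum_in => // [|x]; first exact: null_family_if (coefP r).
by case: ifP => // _; exact: sJ.1.
Qed.

Lemma image_subgroup : subgroup (contra_image J P).
Proof.
split=> [|_ _ [r Jr <-] [s Js <-]].
  by exists 0 => [p|]; rewrite ?raddf0 //; exact: sJ.1.
exists (r - s); rewrite ?raddfB // => p; rewrite coefB; exact: sJ.2.
Qed.

Lemma cact_image a p : J a -> contra_image J P (cact a p).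
Proof.
by move=> Ja; rewrite cactE; apply: csum_image => -[].
Qed.

Lemma cact_imager a p : contra_image J P p -> contra_image J P (cact a p).
Proof.
move=> [r Jr <-]; rewrite cactE (csum_uact _ (fun=> r)).
exists (phi (lcmap (fun=> r) (mono a tt))) => // q.
by rewrite lcmap_mono phi_mono; exact: oJ.2.2.
Qed.

End ContraImage.

Lemma seq_fset_sum (X : choiceType) (V : zmodType) (s : seq X) (F : X -> V) :
  uniq s -> \sum_(x <- seq_fset tt s) F x = \sum_(x <- s) F x.
Proof.
by move=> us; apply: perm_big; rewrite -[X in perm_eq _ X]undup_id // seq_fset_perm.
Qed.

(** * Successive approximation *)

Section Filtration.
Variables (R S : clRingType) (f : {rmorphism R -> S}) (f_cont : continuous f).
Variables (I : nat -> set R) (J : nat -> set S).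
Hypothesis oI : forall n, open_ideal (I n).
Hypothesis oJ : forall n, open_ideal (J n).
Hypothesis IS : forall n, I n.+1 `<=` I n.
Hypothesis JS : forall n, J n.+1 `<=` J n.
Hypothesis Ibase : forall V, open_ideal V -> exists n, I n `<=` V.
Hypothesis Jbase : forall V, open_ideal V -> exists n, J n `<=` V.
Hypothesis fIJ : forall n, f @` I n `<=` J n.

Lemma Jle m n : (m <= n)%N -> J n `<=` J m.
Proof.
elim: n => [|n IH]; first by rewrite leqn0 => /eqP ->.
by rewrite leq_eqVlt => /predU1P[->//|/IH h x /JS/h].
Qed.

Lemma Ile m n : (m <= n)%N -> I n `<=` I m.
Proof.
elim: n => [|n IH]; first by rewrite leqn0 => /eqP ->.
by rewrite leq_eqVlt => /predU1P[->//|/IH h x /IS/h].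
Qed.

(* W is an invariant of the successive remainders; the finite corrections L of
   all levels are indexed by pairs (level, position in L). *)
Lemma approximation_sum (X : choiceType) (W E : set (lincomb S X)) (n0 : nat)
    (xi : lincomb S X) :
  E 0 ->
  (forall n xi, W xi -> (forall x, J n (xi x)) ->
    exists L : seq (R * lincomb S X),
    [/\ forall u, u \in L -> I n u.1 /\ E u.2,
        forall x, J n.+1 ((xi - \sum_(u <- L) phi (mono (f u.1) u.2)) x)
      & W (xi - \sum_(u <- L) phi (mono (f u.1) u.2))]) ->
  W xi -> (forall x, J n0 (xi x)) ->
  exists (rho : lincomb R (nat * nat)%type) (eta : nat * nat -> lincomb S X),
    [/\ forall k, I n0 (rho k), forall k, E (eta k)
      & xi = phi (lcmap eta (lcbase f_cont rho))].
Proof.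
move=> E0 step Wxi Jxi.
(* Corrections are chosen for all levels and all remainders at once, so that the remainders [xs] can
   be defined by recursion. *)
have /choice[L LP] : forall p : nat * lincomb S X, exists L : seq (R * lincomb S X),
    W p.2 -> (forall x, J p.1 (p.2 x)) ->
    [/\ forall u, u \in L -> I p.1 u.1 /\ E u.2,
        forall x, J p.1.+1 ((p.2 - \sum_(u <- L) phi (mono (f u.1) u.2)) x)
      & W (p.2 - \sum_(u <- L) phi (mono (f u.1) u.2))].
  move=> [n s] /=; have [Ws|nW] := pselect (W s /\ forall x, J n (s x)).
    by have [L LP] := step n s Ws.1 Ws.2; exists L.
  by exists [::] => Ws Js; case: nW.
pose xs := fix xs k := if k is m.+1 then
   xs m - \sum_(u <- L ((n0 + m)%N, xs m)) phi (mono (f u.1) u.2) else xi.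
pose l k := L ((n0 + k)%N, xs k).
have xsS k : xs k.+1 = xs k - \sum_(u <- l k) phi (mono (f u.1) u.2) by [].
have inv k : W (xs k) /\ forall x, J (n0 + k)%N (xs k x).
  elim: k => [|k [Wk Jk]]; first by rewrite addn0.
  by have [_ h1 h2] := LP ((n0 + k)%N, xs k) Wk Jk; rewrite addnS.
have lP k u : u \in l k -> I (n0 + k)%N u.1 /\ E u.2.
  by have [Wk Jk] := inv k; have [h _ _] := LP ((n0 + k)%N, xs k) Wk Jk; exact: h.
pose rho k := (nth (0, 0) (l k.1) k.2).1.
pose eta k := (nth (0, 0) (l k.1) k.2).2.
have rhoI k : I (n0 + k.1)%N (rho k).
  rewrite /rho; have [/(mem_nth (0, 0))/lP[]//|/(nth_default (0, 0)) ->] :=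
    ltnP k.2 (size (l k.1)).
  exact: (oI _).2.1.1.1.
(* The positions of the first n levels. At any other index the coefficient vanishes or belongs to a
   level at least n. *)
pose A n := seq_fset tt [seq (k, i) | k <- iota 0 n, i <- iota 0 (size (l k))].
have AP n k : k \notin A n -> (n <= k.1)%N \/ rho k = 0.
  rewrite /A seq_fsetE => kA; have [|kn] := leqP n k.1; first by left.
  right; have [ks|ks] := ltnP k.2 (size (l k.1)); last by rewrite /rho nth_default.
  case/negP: kA; apply/allpairsPdep; exists k.1, k.2.
  by rewrite !mem_iota /= !add0n kn ks -surjective_pairing.
have rhon : null_family rho.
  apply: fset_null => V oV; have [n nV] := Ibase oV; exists (A n) => k /AP[nk|->].
    by apply: nV; apply: (Ile _ (rhoI k)); rewrite (leq_trans nk) // leq_addl.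
  exact: oV.2.1.1.1.
exists (mk_lincomb rhon), eta; split=> [k|k|] /=.
- by apply: (Ile _ (rhoI k)); exact: leq_addr.
(* Past the end of a list the entry is the default 0; this is where [E 0] enters. *)
- rewrite /eta; have [/(mem_nth (0, 0))/lP[]//|/(nth_default (0, 0)) ->//] :=
    ltnP k.2 (size (l k.1)).
apply: lincombP => x; rewrite phi_lcmap /=; apply/esym/isumP.
  exact: null_familyMr (null_family_map f_cont rhon).
move=> V oV; have [n nV] := Jbase oV; exists (A n); split=> [k /AP[nk|->]|].
- apply: nV; apply: (oJ _).2.1.2; apply: fIJ; exists (rho k) => //.
  by apply: (Ile _ (rhoI k)); rewrite (leq_trans nk) // leq_addl.
- by rewrite rmorph0 mul0r; exact: oV.2.1.1.1.
(* The sum telescopes: level m contributes [xs m] - [xs m.+1]. The remainder [xs n] has coefficients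
   in J_{n0+n}, hence in J_n. *)
have -> : \sum_(k <- A n) f (rho k) * eta k x = xi x - xs n x.
  rewrite /A seq_fset_sum; last first.
    apply: allpairs_uniq_dep => [|k _|]; try exact: iota_uniq.
    by move=> [? ?] [? ?] _ _ [-> ->].
  rewrite big_allpairs_dep /=; elim: n {nV} => [|n IH]; first by rewrite big_nil subrr.
  rewrite -addn1 iotaD big_cat /= IH big_seq1 add0n addn1 xsS coefB opprB.
  rewrite [X in _ = _ + X]addrC [RHS]addrA; congr (_ + _); rewrite lc_coef_sum (big_nth (0, 0)) /index_iota subn0.
  by apply: eq_bigr => i _; rewrite phi_mono.
rewrite addrAC subrr add0r; apply: (subgroupN oV.2.1.1); apply: nV.
by apply: (Jle _ ((inv n).2 x)); exact: leq_addl.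
Qed.

End Filtration.

Section IdealQuotient.
Variables (R : clRingType) (I : set R) (oI : open_ideal I).

Lemma rcls_repr_mod s (q : rquot I) : rcls I s = q -> I (repr q - s).
Proof.
move=> e; have /rcls_eq : rcls I (repr q) = rcls I s by rewrite rcls_repr.
by rewrite smallest_id //; exact: oI.2.
Qed.

Lemma rcls0P s : rcls I s = 0 <-> I s.
Proof.
rewrite -(raddf0 (rcls I)); split=> [/rcls_eq|Is].
  by rewrite subr0 smallest_id //; exact: oI.2.
by apply/rcls_eq; rewrite subr0 smallest_id //; exact: oI.2.
Qed.

End IdealQuotient.

(** * Taut maps and separated contramodules *)

Lemma mem_right_ideal_sums (R S : pzRingType) (f : {rmorphism R -> S})
    (I : set R) : subgroup I ->
  smallest (@right_ideal S) (f @` I) `<=`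
  [set s | exists2 L : seq (R * S), forall u, u \in L -> I u.1
      & s = \sum_(u <- L) f u.1 * u.2].
Proof.
move=> sI; apply: smallest_sub => [|_ [a Ia <-]]; last first.
  exists [:: (a, 1)]; last by rewrite big_seq1 mulr1.
  by move=> u; rewrite inE => /eqP ->.
split=> [|_ r [L LI ->]]; last first.
  exists [seq (u.1, u.2 * r) | u <- L] => [u /mapP[v /LI Iv ->] //|].
  by rewrite big_map mulr_suml; apply: eq_bigr => u _; rewrite mulrA.
split=> [|_ _ [L LI ->] [M MI ->]]; first by exists [::]; rewrite ?big_nil.
exists (L ++ [seq (u.1, - u.2) | u <- M]) => [u|].
  by rewrite mem_cat => /orP[/LI//|/mapP[v /MI Iv ->]].
rewrite big_cat big_map /= -sumrN; congr (_ + _).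
by apply: eq_bigr => u _; rewrite mulrN.
Qed.

Section Taut.
Variables (R S : clRingType) (f : {rmorphism R -> S}) (f_cont : continuous f).
Variable I : nat -> set R.
Hypothesis oI : forall n, open_ideal (I n).
Hypothesis IS : forall n, I n.+1 `<=` I n.
Hypothesis Ibase : forall V, open_ideal V -> exists n, I n `<=` V.
Let J n := ext_closure f (I n).
Hypothesis oJ : forall n, open_ideal (J n).

Lemma taut_map n : f @` I n `<=` J n.
Proof. by move=> x Ix; apply: subset_closure; exact: sub_gen_smallest. Qed.

Lemma taut_dec n : J n.+1 `<=` J n.
Proof.
apply: closure_subset; apply: smallest_sub; first exact: smallest_right_ideal.
by move=> _ [a /IS Ia <-]; apply: sub_gen_smallest; exists a.
Qed.

(** V is closed, being an open subgroup, and is a right ideal; so it contains the closure of f(I_n)S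
    once I_n lies in the preimage of V. *)
Lemma taut_base V : open_ideal V -> exists n, J n `<=` V.
Proof.
move=> oV; have [n nV] := Ibase (open_ideal_preimage f_cont oV).
exists n => x /(_ _ (openB x oV))[y [Iy Vyx]].
have Vy : V y.
  move: Iy; apply: smallest_sub; first exact: oV.2.1.
  by move=> _ [a /nV Va <-].
by rewrite -(subKr y x); exact: oV.2.1.1.2.
Qed.

Lemma taut_dense n m x : J n x -> exists L : seq (R * S),
  (forall u, u \in L -> I n u.1) /\ J m (x - \sum_(u <- L) f u.1 * u.2).
Proof.
move=> /(_ _ (openB x (oJ m)))[y [/mem_right_ideal_sums]].
move=> /(_ (oI n).2.1.1)[L LI ->] Jyx; exists L; split=> //.
exact: subgroupBC (oJ m).2.1.1 _ _ Jyx.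
Qed.

(* Hence J n and I n have the same contra_image in an S-contramodule. *)
Lemma taut_csum (P : contramodule S) (X : choiceType) (xi : lincomb S X)
    (p : X -> ugroup P) n0 : (forall x, J n0 (xi x)) ->
  exists (rho : lincomb R (nat * nat)%type) (q : nat * nat -> ugroup P),
    (forall k, I n0 (rho k)) /\ csum xi p = csum (lcbase f_cont rho) q.
Proof.
move=> Jxi.
have [//|n eta _ Jeta|//|//|rho [eta [Irho _ ->]]] := @approximation_sum R S f
  f_cont I J oI oJ IS taut_dec Ibase taut_base taut_map X setT setT n0 xi; last first.
  by exists rho, (fun k => csum (eta k) p); split; rewrite // csum_phi.
(* One approximation step: only the finitely many coefficients at [A] lie outside J_{n+1}, and each
   of them is a finite sum of f(a)s with a in I_n up to an element of J_{n+1}. *)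
have [A A0] := null_fsetV (coefP eta) (oJ n.+1).
have /choice[L LP] : forall x, exists L : seq (R * S),
    (forall u, u \in L -> I n u.1) /\ J n.+1 (eta x - \sum_(u <- L) f u.1 * u.2).
  by move=> x; exact: taut_dense.
exists (flatten [seq [seq (u.1, mono u.2 x) | u <- L x] | x <- A]); split=> //.
  move=> u /flatten_mapP[x _ /mapP[v /(LP x).1 Iv ->]] //.
have sJ : subgroup (J n.+1) := (oJ n.+1).2.1.1.
have -> : \sum_(u <- flatten [seq [seq (u.1, mono u.2 x) | u <- L x] | x <- A])
    phi (mono (f u.1) u.2) =
    \sum_(x <- A) mono (\sum_(u <- L x) f u.1 * u.2) x.
  rewrite big_flatten big_map; apply: eq_bigr => x _; rewrite big_map.
  rewrite (zmod_morphism_sum (@mono_is_zmod_morphism S X x)).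
  apply: eq_bigr => u _; apply: lincombP => y; rewrite phi_mono /=.
  by case: ifP; rewrite ?mulr0.
move=> x; rewrite -(subrK (\sum_(z <- A) mono (eta z) z) eta) -addrA [X in J _ X]lc_coefD.
apply: (subgroupD sJ).
  rewrite lincomb_split; case: ifPn => [_|/A0//]; exact: sJ.1.
rewrite -sumrB lc_coef_sum; apply: (@subgroup_sum _ (J n.+1)) => // z _.
rewrite -(mono_is_zmod_morphism z _ _) /=; case: ifP => _; last exact: sJ.1.
exact: (LP z).2.
Qed.

Section SeparatedHom.
Variables (P Q : contramodule S).
Variable g : contra_hom (sharp_obj f_cont P) (sharp_obj f_cont Q).

(** By [taut_csum] the element is a sum with coefficients in f(I_n). With such a sum g commutes,
    being R-linear, and f(I_n) lies in J_n. *)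
Lemma shom_image n p : contra_image (J n) P p -> contra_image (J n) Q (shom g p).
Proof.
move=> [xi Jxi <-]; have [rho [q [Irho]]] := @taut_csum P P xi id n Jxi.
rewrite -csum_id.
move=> ->; rewrite shom_csum; apply: csum_image; first exact: oJ.
by move=> k; apply: taut_map; exists (rho k).
Qed.

Variable n : nat.
Hypothesis epi : ring_epimorphism (rquot_map (@taut_map n)).

Let U := contra_image (J n) Q.
Let sU : subgroup U := image_subgroup Q (oJ n).
Let clsU (v w : ugroup Q) : U (v - w) -> cls U v = cls U w.
Proof. by move=> Uvw; apply/eqP; rewrite -subr_eq0 -raddfB; apply/eqP/cls_eq0. Qed.

Let b (x y : rquot (J n)) (p : ugroup P) :=
  cls U (cact (repr x) (shom g (cact (repr y) p))).

(** The expression x g(y p) depends only on x and y modulo J_n: for x because J_n acts into [U], for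
    y because g carries the J_n-image of P into [U]. *)
Let bE x y p : b (rcls _ x) (rcls _ y) p = cls U (cact x (shom g (cact y p))).
Proof.
apply: clsU; set x' := repr _; set y' := repr _.
rewrite -[X in U X](subrKA (cact x' (shom g (cact y p)))); apply: (subgroupD sU).
  rewrite -(cactBr x') -shom_is_zmod_morphism -(cactBl p) /=.
  apply: cact_imager; first exact: oJ.
  by apply: shom_image; apply: cact_image; [exact: oJ|exact: (rcls_repr_mod (oJ n))].
rewrite -(cactBl (shom g (cact y p)) x') /=.
by apply: cact_image; [exact: oJ|exact: (rcls_repr_mod (oJ n))].
Qed.

(** For fixed p the map (x, y) |-> x g(y p) modulo [U] is biadditive on S/J_n, and balanced over
    R/I_n because g is R-linear. By epimorphy its values at (s, 1) and (1, s) agree. *)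
Lemma shom_cact_mod s p : U (cact s (shom g p) - shom g (cact s p)).
Proof.
have gB := shom_is_zmod_morphism g; have gD := zmod_morphismD gB.
have bDl y y' x : b (y + y') x p = b y x p + b y' x p.
  elim/zquot_ind: y => y; elim/zquot_ind: y' => y'; elim/zquot_ind: x => x.
  rewrite -[_ + _]/(rcls _ y + rcls _ y') -rclsD !bE -raddfD.
  by rewrite (zmod_morphismD (cactBl _)).
have bDr y x x' : b y (x + x') p = b y x p + b y x' p.
  elim/zquot_ind: y => y; elim/zquot_ind: x => x; elim/zquot_ind: x' => x'.
  rewrite -[X in b _ X _]/(rcls _ x + rcls _ x') -rclsD !bE -raddfD.
  by rewrite (zmod_morphismD (cactBl _)) gD (zmod_morphismD (cactBr _)).
have bal y a x : b (y * rquot_map (@taut_map n) a) x p =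
    b y (rquot_map (@taut_map n) a * x) p.
  elim/zquot_ind: y => y; elim/zquot_ind: x => x; elim/zquot_ind: a => a.
  rewrite -[cls _ a]/(rcls _ a) rquot_map_cls.
  rewrite -[cls _ y]/(rcls _ y) -[cls _ x]/(rcls _ x) -!rmorphM !bE.
  by rewrite -!cactA shom_act.
have := @epi_bilinear _ _ _ _ (fun x y => b x y p) epi bDl bDr bal (rcls _ s).
rewrite -!(rmorph1 (rcls (J n))) !bE !cact1 => /cls_eq.
by rewrite smallest_subgroup_id.
Qed.

(** Finitely many terms are covered by [shom_cact_mod]. The tail has coefficients in J_n, so its
    contributions before and after applying g both lie in [U]. *)
Lemma shom_csum_mod (xi : lincomb S P) :
  U (csum xi (shom g) - shom g (uact xi)).
Proof.
have gB := shom_is_zmod_morphism g.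
have [A A0] := null_fsetV (coefP xi) (oJ n).
rewrite -csum_id.
rewrite !(csum_split xi A) (zmod_morphismD gB) (zmod_morphism_sum gB) opprD addrACA.
have JA x : J n ((xi - \sum_(z <- A) mono (xi z) z) x).
  by rewrite lincomb_split; case: ifPn => [_|/A0//]; exact: (oJ n).2.1.1.1.
apply: (subgroupD sU).
  rewrite -sumrB; apply: (@subgroup_sum _ U) => // x _; exact: shom_cact_mod.
apply: sU.2; first by apply: csum_image.
by apply: shom_image; apply: csum_image.
Qed.

End SeparatedHom.

Lemma separated_hom (P Q : contramodule S)
    (g : contra_hom (sharp_obj f_cont P) (sharp_obj f_cont Q)) :
  separated Q -> (forall n, ring_epimorphism (rquot_map (@taut_map n))) ->
  forall r : lincomb S P, g (ctr_act r) = ctr_act (lcmap g r).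
Proof.
move=> sepQ epi r.
suff : [set 0] (csum r (shom g) - shom g (uact r)) by move=> /subr0_eq/esym.
rewrite -sepQ => V [oV [sV Vr]].
have [W oW WV] := open_ideal_sub oV sV; have [n nW] := taut_base oW.
have [xi Jxi <-] := shom_csum_mod g (epi n) r.
by exists xi => // x; apply: WV; exact: nW.
Qed.

End Taut.

(** * Flat contramodules are separated *)

Definition submodule (A : pzRingType) (M : lmodType A) (Z : set M) : Prop :=
  subgroup Z /\ forall a x, Z x -> Z (a *: x).

Section SubModule.
Variables (A : pzRingType) (M : lmodType A) (Z : set M) (sZ : submodule Z).

(** The proof that Z is a submodule is an argument, so that the closure instances can be attached to
    the predicate. *)
Definition smod_pred of submodule Z : {pred M} := fun x => `[< Z x >].

Fact smod_closed : submod_closed (smod_pred sZ).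
Proof.
have [[Z0 ZB] Zs] := sZ; split=> [|a x y /asboolP Zx /asboolP Zy]; apply/asboolP => //.
by apply: (subgroupD sZ.1) => //; exact: Zs.
Qed.
HB.instance Definition _ :=
  GRing.isSubmodClosed.Build A M (smod_pred sZ) smod_closed.

Record smod := Smod { smod_val : M; _ : smod_val \in smod_pred sZ }.
HB.instance Definition _ := [isSub for smod_val].
HB.instance Definition _ := [Choice of smod by <:].
HB.instance Definition _ := [SubChoice_isSubLmodule of smod by <:].

Definition smod_in x (Zx : Z x) : smod := @Smod x (asboolT Zx).

Lemma smodP (u : smod) : Z (val u).
Proof. by have /asboolP := valP u. Qed.

Definition smod_incl : {linear smod -> M} := \val.

End SubModule.

Section QuotientModule.
Variables (R : clRingType) (I : set R) (oI : open_ideal I).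

Definition quot_rmod of open_ideal I : lmodType R^c :=
  restr (conv_rmorphism (rcls I)) ((rquot I)^c)^o.

Lemma quot_rmod_rsc (y : R) a :
  rsc (rcls I y : quot_rmod oI) a = rcls I (y * a).
Proof. by rewrite rmorphM. Qed.

Fact quot_rmod_discr (q : quot_rmod oI) : open [set a : R | rsc q a = 0].
Proof.
apply: (@open_supgroup R I) => // [|a Ia]; first exact: ann_subgroup.
rewrite /= -[q]rcls_repr quot_rmod_rsc.
by apply/(rcls0P oI); exact: oI.2.2.
Qed.

Definition quot_discr : discr_module R := DiscrModule quot_rmod_discr.

End QuotientModule.

Fact sub_discr_subproof (R : topologicalRingType) (M : discr_module R)
  (Z : set M) (sZ : submodule Z) (y : smod sZ) : open [set a : R | rsc y a = 0].
Proof.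
have -> : [set a : R | rsc y a = 0] = [set a : R | rsc (val y) a = 0].
  apply/seteqP; split=> a /= e.
    by have := congr1 val e; rewrite -(rsc_lin (smod_incl sZ)).
  by apply: val_inj; rewrite -[LHS](rsc_lin (smod_incl sZ)).
exact: discrP.
Qed.
Definition sub_discr (R : topologicalRingType) (M : discr_module R)
    (Z : set M) (sZ : submodule Z) : discr_module R :=
  DiscrModule (@sub_discr_subproof R M Z sZ).

Section FlatStep.
Variables (R : clRingType) (P : contramodule R) (I I' : set R).
Hypotheses (flatP : flat_contra P) (oI : open_ideal I) (oI' : open_ideal I').
Hypothesis I'I : I' `<=` I.

Let M := quot_discr oI'.
Let N := quot_discr oI.

Let idI : (idfun : {rmorphism R -> R}) @` I' `<=` I.
Proof. by move=> _ [a /I'I Ia <-]. Qed.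

Let q : M -> N := rquot_map idI.
Let qE a : q (rcls I' a) = rcls I a.
Proof. exact: rquot_map_cls. Qed.

Fact quot_discr_map_is_zmod_morphism : zmod_morphism q.
Proof. exact: rquot_map_is_zmod_morphism. Qed.
Fact quot_discr_map_is_scalable : scalable q.
Proof.
move=> a x; rewrite -[x]rcls_repr -[LHS]/(q (rsc (rcls I' (repr x) : M) a)).
rewrite (quot_rmod_rsc oI') qE -[RHS]/(rsc (q (rcls I' (repr x))) a) qE.
by rewrite (quot_rmod_rsc oI).
Qed.
HB.instance Definition _ := GRing.isZmodMorphism.Build M N q
  quot_discr_map_is_zmod_morphism.
HB.instance Definition _ := GRing.isScalable.Build R^c M N *:%R q
  quot_discr_map_is_scalable.

Let ql : {linear M -> N} := q.
Let Z : set M := [set x | ql x = 0].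
Let sZ : submodule Z.
Proof.
split=> [|a x x0]; last first.
  have e : ql x = 0 := x0.
  by have := linearZZ ql a x; rewrite e scaler0.
split=> [|x y x0 y0]; first exact: (raddf0 ql).
have [ex ey] : ql x = 0 /\ ql y = 0 := conj x0 y0.
apply: etrans (raddfB ql x y) _.
exact: etrans (congr2 (fun u v : N => u - v) ex ey) (subrr _).
Qed.
(** This is I/I', the kernel of R/I' -> R/I. *)
Let K := sub_discr sZ.

Let ex : short_exact (smod_incl sZ) ql.
Proof.
split; first by move=> u v /val_inj.
  apply/seteqP; split=> [_ [u _ <-]|x /= qx]; first exact: smodP.
  by exists (smod_in sZ qx).
apply/seteqP; split=> // y _; exists (rcls I' (repr y)) => //.
by rewrite -[RHS]rcls_repr; exact: qE.
Qed.

Let KP (k : K) : I (repr (val k : rquot I')).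
Proof.
have := smodP k; rewrite /Z /= -{1}[val k]rcls_repr => h.
by apply/(rcls0P oI); rewrite -qE.
Qed.

Let lin (L : seq (R * lincomb R P)) : lincomb R P :=
  \sum_(u <- L) phi (mono u.1 u.2).

(** Up to coefficients in I', the finite sums of a k with a in I and k in the kernel of [uact].
    Modulo [D] the assignment (a mod I') (x) p |-> a p becomes additive and balanced on I/I' (.)_R
    P. *)
Let D : set (lincomb R P) := [set eta | exists L : seq (R * lincomb R P),
  (forall u, u \in L -> I u.1 /\ @uact R P u.2 = 0) /\
  forall x, I' ((eta - lin L) x)].

Let D1 (eta : lincomb R P) : (forall x, I' (eta x)) -> D eta.
Proof. by move=> I'eta; exists [::]; split=> // x; rewrite /lin big_nil subr0. Qed.

Let D2 a (k : lincomb R P) : I a -> @uact R P k = 0 -> D (phi (mono a k)).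
Proof.
move=> Ia k0; exists [:: (a, k)]; split=> [u|x].
  by rewrite inE => /eqP ->.
by rewrite /lin big_seq1 subrr; exact: oI'.2.1.1.1.
Qed.

Let sD : subgroup D.
Proof.
have sI' := oI'.2.1.1.
split=> [|u v [L [LI Lu]] [L' [L'I Lv]]].
  by apply: D1 => x; exact: sI'.1.
exists (L ++ [seq (- w.1, w.2) | w <- L']); split=> [w|x].
  rewrite mem_cat => /orP[/LI//|/mapP[w' /L'I [Iw kw] ->]]; split=> //.
  exact: subgroupN oI.2.1.1 _ _.
have -> : lin (L ++ [seq (- w.1, w.2) | w <- L']) = lin L - lin L'.
  rewrite /lin big_cat big_map /= -sumrN; congr (_ + _); apply: eq_bigr => w _.
  by apply: lincombP => z; rewrite -sub0r coefB !phi_mono mulNr sub0r.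
rewrite -[_ - (_ - _)]/(u - v - (lin L - lin L')).
have -> : u - v - (lin L - lin L') = (u - lin L) - (v - lin L').
  by rewrite !opprB [lin L' - lin L]addrC addrACA [- v + lin L']addrC.
by rewrite coefB; apply: sI'.2.
Qed.

Let clsD (u v : lincomb R P) : D (u - v) -> cls D u = cls D v.
Proof. by move=> Duv; apply/eqP; rewrite -subr_eq0 -raddfB; apply/eqP/cls_eq0. Qed.

Let monoD a a' (p : P) : I' (a - a') -> cls D (mono a p) = cls D (mono a' p).
Proof.
move=> Ia; apply: clsD; rewrite -(mono_is_zmod_morphism p) /=.
by apply: D1 => x /=; case: ifP => // _; exact: oI'.2.1.1.1.
Qed.

Let b (k : K) (p : ugroup P) := cls D (mono (repr (val k : rquot I')) (p : P)).

Let bE (k : K) a p : val k = rcls I' a -> b k p = cls D (mono a (p : P)).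
Proof. by move=> e; apply: monoD; exact: rcls_repr_mod. Qed.

Let bDl k k' p : b (k + k') p = b k p + b k' p.
Proof.
rewrite (@bE (k + k') (repr (val k : rquot I') + repr (val k' : rquot I'))).
  by rewrite (zmod_morphismD (mono_is_zmod_morphism (p : P))) raddfD.
by apply: etrans (raddfD (smod_incl sZ) k k') _; rewrite rclsD !rcls_repr.
Qed.

Let bDr k p p' : b k (p + p') = b k p + b k p'.
Proof.
rewrite /b -raddfD; apply: clsD; set a := repr _.
have -> : mono a (p + p' : P) - (mono a (p : P) + mono a (p' : P)) =
    phi (mono a (eps R (p + p' : P) - (eps R (p : P) + eps R (p' : P)))).
  apply: lincombP => x; rewrite phi_mono !coefB !lc_coefD /= mulrBr mulrDr.
  by congr (_ - (_ + _)); case: eqP; rewrite ?mulr1 ?mulr0.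
apply: D2; first exact: KP.
by rewrite raddfB raddfD /= -!uact_eps -opprD subrr.
Qed.

Let bal k (r : lincomb R P) : exists2 A : {fset P},
  (forall p : P, p \notin A -> rsc k (r p) = 0) &
  b k (uact r) = \sum_(p <- A) b (rsc k (r p)) p.
Proof.
have vE p : val (rsc k (r p)) = rcls I' (repr (val k : rquot I') * r p).
  by rewrite -(quot_rmod_rsc oI') rcls_repr -(rsc_lin (smod_incl sZ)).
set a := repr (val k : rquot I') in vE.
have [A A0] := discr_fset k r; exists A => //.
under eq_bigr => p _ do rewrite (bE _ (vE p)).
rewrite /b -/a -raddf_sum; apply: clsD.
(* Replacing [uact r] by r costs a multiple of an element of the kernel of [uact] by a in I; cutting
   the result down to [A] costs coefficients in I'. *)
rewrite -(subrKA (phi (mono a r))); apply: (subgroupD sD).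
  have -> : mono a (uact r : P) - phi (mono a r) =
      phi (mono a (eps R (uact r : P) - r)).
    apply: lincombP => x; rewrite phi_mono !coefB phi_mono /= mulrBr.
    by congr (_ - _); case: eqP; rewrite ?mulr1 ?mulr0.
  by apply: D2; [exact: KP|rewrite raddfB /= -uact_eps subrr].
apply: D1 => x; have := lincomb_split (phi (mono a r)) A x.
under eq_bigr => p _ do rewrite phi_mono.
move=> ->; case: ifPn => [_|/A0 e]; first exact: oI'.2.1.1.1.
by rewrite phi_mono; apply/(rcls0P oI'); rewrite -vE e.
Qed.

(** The finite sum of the (xi p) (x) p in I/I' (.)_R P maps to 1 (x) [uact xi] in R/I' (.)_R P. This
    equals 1 (x) [uact xi'], which vanishes as xi' has coefficients in I'. By flatness the sum is
    already 0 in I/I' (.)_R P, and its image modulo [D] is the class of xi. *)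
Lemma flat_step (xi xi' : lincomb R P) :
  (forall p, I (xi p)) -> (forall p, I' (xi' p)) -> @uact R P xi = uact xi' ->
  exists L : seq (R * lincomb R P),
    (forall u, u \in L -> I u.1 /\ @uact R P u.2 = 0) /\
    forall x, I' ((xi - \sum_(u <- L) phi (mono u.1 u.2)) x).
Proof.
move=> Ixi Ixi' e; rewrite -/(D xi).
have Zxi p : Z (rcls I' (xi p)).
  by have /(rcls0P oI) e0 := Ixi p; apply: etrans (qE _) e0.
pose k p : K := smod_in sZ (Zxi p).
have [A A0] := null_fsetV (coefP xi) oI'.
pose t : ctens K P := \sum_(p <- A) ct (k p) (p : ugroup P).
have [inj _ _] := @flatP K M N (smod_incl sZ) ql ex.
have t0 : t = 0.
  apply: inj; have mB := @ctens_map_is_zmod_morphism R P K M (smod_incl sZ).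
  rewrite (zmod_morphism0 mB) (zmod_morphism_sum mB).
  transitivity (ct (rcls I' 1 : M) (@uact R P xi)).
    rewrite (@ct_uact _ M P (rcls I' 1) xi A) => [|p /A0 I'p]; last first.
      by rewrite (quot_rmod_rsc oI') mul1r; apply/(rcls0P oI').
    apply: eq_bigr => p _; rewrite (@ctens_map_ct R P K M (smod_incl sZ)).
    by rewrite (quot_rmod_rsc oI') mul1r.
  rewrite e (@ct_uact _ M P (rcls I' 1) xi' fset0) ?big_seq_fset0 // => p _.
  by rewrite (quot_rmod_rsc oI') mul1r; apply/(rcls0P oI').
have lB := ct_lift_is_zmod_morphism bDl bDr bal.
have : ct_lift b t = 0 by rewrite t0 (zmod_morphism0 lB).
rewrite (zmod_morphism_sum lB).
under eq_bigr => p _ do rewrite ct_lift_ct // (@bE _ (xi p)) //.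
rewrite -raddf_sum -(raddf0 (cls D)) => /cls_eq.
rewrite subr0 smallest_subgroup_id // => Ds.
rewrite -(subrK (\sum_(p <- A) mono (xi p) p) xi); apply: (subgroupD sD) => //.
apply: D1 => x; rewrite lincomb_split; case: ifPn => [_|/A0//].
exact: oI'.2.1.1.1.
Qed.

End FlatStep.

(** Successive approximation for the identity of R, both filtrations being the same. The invariant
    is that the remainder has value x, the corrections are multiples of combinations of value 0, and
    [flat_step] compares the remainder with some expression of x of the next level. *)
Lemma flat_separated (R : clRingType) (P : contramodule R) :
  countable_base_at0 R -> flat_contra P -> separated P.
Proof.
move=> cR flatP; have [I [oI IS Iall]] := base_seq cR (@two_sided_linearP R).
have Ibase V : open_ideal V -> exists n, I n `<=` V.
  move=> oV; apply: Iall; apply: open_nbhs_nbhs; split; first exact: oV.1.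
  exact: oV.2.1.1.1.
have idc : continuous (idfun : {rmorphism R -> R}) by move=> x; exact: cvg_id.
apply/seteqP; split=> [x xI|_ -> V [oV [[V0 _] _]]]; last first.
  by exists 0 => //; rewrite raddf0.
have xn n : exists2 xi : lincomb R P, (forall p, I n (xi p)) & uact xi = x.
  by apply: (xI (I n)); split; [exact: (oI n).1|exact: (oI n).2.1].
have [xi0 Ixi0 xi0x] := xn 0%N.
have fI n : (idfun : {rmorphism R -> R}) @` I n `<=` I n by move=> _ [a Ia <-].
have step n (xi : lincomb R P) : @uact R P xi = x -> (forall p, I n (xi p)) ->
    exists L : seq (R * lincomb R P),
    [/\ forall u, u \in L -> I n u.1 /\ @uact R P u.2 = 0,
        forall p, I n.+1 ((xi - \sum_(u <- L) phi (mono u.1 u.2)) p)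
      & @uact R P (xi - \sum_(u <- L) phi (mono u.1 u.2)) = x].
  move=> Wxi Ixi; have [xi' Ixi' xi'x] := xn n.+1.
  have [|L [LE LI]] := flat_step flatP (oI n) (oI n.+1) (@IS n) Ixi Ixi'.
    by rewrite xi'x.
  exists L; split=> //; rewrite raddfB /= Wxi raddf_sum big_seq big1 ?subr0 //.
  move=> u /LE[_ u0]; have := csum_uact (mono u.1 tt) (fun=> u.2 : lincomb R P).
  by rewrite lcmap_mono u0 csum0 => h; exact: esym h.
have [rho [eta [_ eta0 e]]] := @approximation_sum R R idfun idc I I oI oI IS IS
  Ibase Ibase fI P [set xi | @uact R P xi = x] [set xi | @uact R P xi = 0] 0%N xi0
  (raddf0 _) step xi0x Ixi0.
rewrite /= -xi0x e -csum_uact.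
rewrite -[RHS](csum0 P (lcbase idc rho)); congr csum.
by apply/funext => k; exact: eta0.
Qed.

(** * Free contramodules are flat *)

Section AdditiveSums.
Variables (R : clRingType) (V : zmodType) (g : R -> V) (W : set R).
Hypotheses (gB : zmod_morphism g) (oW : open_ideal W) (gW : forall w, W w -> g w = 0).

Lemma isum_fin (X : choiceType) (r : X -> R) (A : {fset X}) :
  (forall x, x \notin A -> r x = 0) -> isum r = \sum_(x <- A) r x.
Proof.
move=> r0; apply: isumP => [|U oU].
  apply: fset_null => U oU; exists A => x /r0 ->; exact: oU.2.1.1.1.
exists A; rewrite subrr; split=> [x /r0 ->|]; exact: oU.2.1.1.1.
Qed.

(** The kernel of g contains an open ideal, so it is an open subgroup and absorbs the tail of the
    sum. *)
Lemma additive_isum (X : choiceType) (r : X -> R) (A : {fset X}) :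
  null_family r -> (forall x, x \notin A -> g (r x) = 0) ->
  g (isum r) = \sum_(x <- A) g (r x).
Proof.
move=> rn r0; pose s x := if x \in A then 0 else r x.
pose p : pred X := fun x => x \notin A.
have sn : null_family s.
  rewrite (_ : s = fun x => if p x then r x else 0); first exact: null_family_if.
  by apply/funext => x; rewrite /s /p; case: (x \in A).
have sg : subgroup [set a | g a = 0].
  split=> [|a b /= a0 b0]; first exact: (zmod_morphism0 gB).
  by rewrite /= gB a0 b0 subrr.
have gs : g (isum s) = 0.
  apply: (@isum_subgroup R X s [set a | g a = 0]) => // [|x].
    exact: (open_supgroup oW).
  by rewrite /s /=; case: ifPn => [_|/r0//]; exact: (zmod_morphism0 gB).
have e : isum r - isum s = \sum_(x <- A) r x.
  rewrite -isumB // (@isum_fin _ _ A) => [|x /negbTE xA].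
    rewrite big_seq [RHS]big_seq; apply: eq_bigr => x xA.
    by rewrite /s xA subr0.
  by rewrite /s xA subrr.
by rewrite -(zmod_morphism_sum gB) -e gB gs subr0.
Qed.

End AdditiveSums.

Lemma rsc_isum (R : clRingType) (N : discr_module R) (X : choiceType) (y : N)
    (r : X -> R) (A : {fset X}) :
  null_family r -> (forall x, x \notin A -> rsc y (r x) = 0) ->
  rsc y (isum r) = \sum_(x <- A) rsc y (r x).
Proof.
have [V oV Vy] := open_ideal_sub (@discrP R N y) (ann_subgroup y).
exact: (additive_isum (rscBr y) oV Vy).
Qed.

Lemma seq_fset_bound (T : eqType) (X : choiceType) (Q : T -> X -> Prop) (l : seq T) :
  (forall u, exists A : {fset X}, forall x, x \notin A -> Q u x) ->
  exists A : {fset X}, forall u x, u \in l -> x \notin A -> Q u x.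
Proof.
move=> h; elim: l => [|u l [A AP]]; first by exists fset0.
have [B BP] := h u; exists (A `|` B)%fset => v x.
rewrite in_fsetU negb_or inE => /predU1P[-> /andP[_ /BP]//|vl /andP[xA _]].
exact: AP.
Qed.

Section FreeFlat.
Variables (R : clRingType) (X : choiceType).
Let F := free_contra R X.

Lemma free_coef_is_zmod_morphism x :
  zmod_morphism (fun p : ugroup F => (p : lincomb R X) x).
Proof. by move=> p q; rewrite free_zmodB coefB. Qed.

Section Coordinate.
Variables (N : discr_module R) (x : X).

Let b (y : N) (p : ugroup F) : N := rsc y ((p : lincomb R X) x).

Let bDl y y' p : b (y + y') p = b y p + b y' p.
Proof. exact: rscDl. Qed.
Let bDr y p q : b y (p + q) = b y p + b y q.
Proof. by rewrite /b (zmod_morphismD (free_coef_is_zmod_morphism x)) rscDr. Qed.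
Let bal y (r : lincomb R F) : exists2 A : {fset F},
  (forall p : F, p \notin A -> rsc y (r p) = 0) &
  b y (uact r) = \sum_(p <- A) b (rsc y (r p)) p.
Proof.
have [A A0] := discr_fset y r; exists A => //.
rewrite /b -[uact r]/(phi r) phiE (@rsc_isum _ _ _ _ _ A).
- by apply: eq_bigr => p _; rewrite rscM.
- exact: null_familyMr (coefP r).
- by move=> p /A0 e; rewrite -rscM e rsc0l.
Qed.

(** N (.)_R R[[X]] is the direct sum of copies of N indexed by X; this is the projection to the copy
    at x. *)
Definition free_coord : ctens N F -> N := ct_lift b.

Lemma free_coord_ct y (p : lincomb R X) : free_coord (ct y (p : ugroup F)) = rsc y (p x).
Proof. exact: (ct_lift_ct bDl bDr bal). Qed.

Lemma free_coord_is_zmod_morphism : zmod_morphism free_coord.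
Proof. exact: (ct_lift_is_zmod_morphism bDl bDr bal). Qed.

End Coordinate.

(** Every element is a finite sum of y_x (x) x, because the products y r_x vanish outside a finite
    set, and [free_coord] recovers each y_x. Injectivity thus reduces to that of i. *)
Lemma free_flat : flat_contra F.
Proof.
apply: flat_contra_inj => K M N i q [inj _ _] t it0.
have [l e] := ctens_sum t.
have [A A0] : exists A : {fset X}, forall u x, u \in l -> x \notin A ->
    rsc u.1 ((u.2 : lincomb R X) x) = 0.
  by apply: seq_fset_bound => u; exact: discr_fset.
have -> : t = \sum_(x <- A) ct (\sum_(u <- l) rsc u.1 ((u.2 : lincomb R X) x))
    (eps R x : ugroup F).
  have cB x : zmod_morphism (fun y : K => ct y (eps R x : ugroup F)).
    by move=> y y'; exact: ctBl.
  under eq_bigr => x _ do rewrite (zmod_morphism_sum (cB x)).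
  rewrite e exchange_big /= big_seq [RHS]big_seq; apply: eq_bigr => u ul.
  rewrite {1}(free_eps u.2); apply: ct_csum => x; exact: A0.
rewrite big1 // => x _; rewrite (_ : \sum_(u <- l) _ = 0) ?ct0l //.
apply: inj; rewrite raddf0 raddf_sum.
have := congr1 (@free_coord M x) it0.
have mB := @ctens_map_is_zmod_morphism R F K M i.
have cB := @free_coord_is_zmod_morphism M x.
rewrite (zmod_morphism0 cB) e (zmod_morphism_sum mB) (zmod_morphism_sum cB) => h.
apply: etrans h; apply: eq_bigr => u _.
by rewrite ctens_map_ct free_coord_ct /= rsc_lin.
Qed.

End FreeFlat.

(** * Restrictions of free contramodules along a proflat map are flat *)

Lemma tens_map_is_zmod_morphism (A : pzRingType) (N N' : lmodType A^c)
  (F : lmodType A) (g : {linear N -> N'}) : zmod_morphism (@tens_map A N N' F g).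
Proof.
have tB := tmap_is_zmod_morphism g (idfun : {additive F -> F}).
have tE := tmap_pure g (idfun : {additive F -> F}).
have e u : @tens_map A N N' F g (cls _ u) = cls _ (tmap g idfun u).
  rewrite /tens_map zquot_map_cls // => _ [_ [z [a [w ->]]] <-].
  rewrite tB !tE; apply: sub_gen_smallest.
  exists (g z), a, w; have e : g (rsc z a) = rsc (g z) a := linearZZ g _ _.
  exact: (congr1 (fun u => tpure u w - tpure (g z) (a *: w)) e).
move=> s t; rewrite -[s](@cls_repr _ (@tens_rel A N F)).
by rewrite -[t](@cls_repr _ (@tens_rel A N F)) -raddfB !e tB raddfB.
Qed.

Section KilledModule.
Variables (R : clRingType) (I : set R) (oI : open_ideal I).
Variables (M : lmodType R^c) (kM : forall (y : M) a, I a -> rsc y a = 0).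

Definition kmod of open_ideal I & (forall (y : M) a, I a -> rsc y a = 0) : Type := M.
HB.instance Definition _ := GRing.Zmodule.on (kmod oI kM).

Definition kmod_scale (q : (rquot I)^c) (y : kmod oI kM) : kmod oI kM :=
  rsc (y : M) (repr (q : rquot I)).

Lemma kmod_scale_rcls a y : kmod_scale (rcls I a) y = rsc (y : M) a.
Proof.
apply/eqP; rewrite -subr_eq0 -rscBr; apply/eqP/kM; exact: rcls_repr_mod.
Qed.

Let rclsP (q : (rquot I)^c) : {a : R | q = rcls I a}.
Proof. by exists (repr (q : rquot I)); exact/esym/rcls_repr. Qed.

Fact kmod_scaleA a b x : kmod_scale a (kmod_scale b x) = kmod_scale (a * b) x.
Proof.
have [c ->] := rclsP a; have [d ->] := rclsP b.
rewrite -[(_ : (rquot I)^c) * _]/(rcls I d * rcls I c) -rmorphM !kmod_scale_rcls.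
exact: rscM.
Qed.
Fact kmod_scale1 : left_id 1 kmod_scale.
Proof.
move=> x; rewrite -[1]/(1 : rquot I) -(rmorph1 (rcls I)) kmod_scale_rcls.
exact: rsc1.
Qed.
Fact kmod_scaleDr : right_distributive kmod_scale +%R.
Proof. by move=> a x y; exact: (@rscDl R M). Qed.
Fact kmod_scaleDl x : {morph kmod_scale^~ x : a b / a + b}.
Proof.
move=> a b; have [c ->] := rclsP a; have [d ->] := rclsP b.
rewrite -[(_ : (rquot I)^c) + _]/(rcls I c + rcls I d) -rclsD !kmod_scale_rcls.
exact: rscDr.
Qed.
HB.instance Definition _ := GRing.Zmodule_isLmodule.Build (rquot I)^c (kmod oI kM)
  kmod_scaleA kmod_scale1 kmod_scaleDr kmod_scaleDl.

Lemma kmod_rsc (y : kmod oI kM) a : rsc y (rcls I a) = rsc (y : M) a.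
Proof. exact: kmod_scale_rcls. Qed.

End KilledModule.

Section KilledSub.
Variables (R : clRingType) (I : set R) (oI : open_ideal I).

Section Object.
Variables (M : lmodType R^c) (Z : set M) (sZ : submodule Z).
Hypothesis kZ : forall y, Z y -> forall a, I a -> rsc y a = 0.

Fact ksub_killed (u : smod sZ) a : I a -> rsc u a = 0.
Proof.
move=> Ia; apply: val_inj.
rewrite (_ : val (rsc u a) = rsc (val u) a) ?raddf0; last exact: (rsc_lin (smod_incl sZ)).
by apply: kZ Ia; exact: smodP.
Qed.
Definition ksub : lmodType (rquot I)^c := kmod oI ksub_killed.

Lemma ksub_rsc (u : ksub) a : val (rsc u (rcls I a) : smod sZ) = rsc (val (u : smod sZ)) a.
Proof. by rewrite kmod_rsc; exact: (rsc_lin (smod_incl sZ)). Qed.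

End Object.

Section Map.
Variables (M N : lmodType R^c) (g : {linear M -> N}) (Z : set M) (Y : set N).
Variables (sZ : submodule Z) (sY : submodule Y).
Hypothesis kZ : forall y, Z y -> forall a, I a -> rsc y a = 0.
Hypothesis kY : forall y, Y y -> forall a, I a -> rsc y a = 0.
Hypothesis gZY : forall y, Z y -> Y (g y).

Definition ksub_map : ksub sZ kZ -> ksub sY kY :=
  fun u => smod_in sY (gZY (smodP (u : smod sZ))).

Lemma ksub_mapE (u : smod sZ) : val (ksub_map u : smod sY) = g (val u).
Proof. by []. Qed.

Fact ksub_map_is_zmod_morphism : zmod_morphism ksub_map.
Proof.
move=> u v; apply: val_inj.
rewrite [LHS]ksub_mapE; apply: etrans (congr1 g (raddfB (smod_incl sZ) u v)) _.
rewrite raddfB; apply: esym.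
exact: (raddfB (smod_incl sY) (ksub_map u) (ksub_map v)).
Qed.
Fact ksub_map_is_scalable : scalable ksub_map.
Proof.
move=> q u; rewrite -[q](@rcls_repr _ I); set a := repr _.
apply: val_inj; rewrite [LHS]ksub_mapE.
apply: etrans (congr1 g (ksub_rsc (kZ := kZ) u a)) _.
rewrite rsc_lin; apply: esym; exact: (ksub_rsc (kZ := kY) (ksub_map u) a).
Qed.
HB.instance Definition _ := GRing.isZmodMorphism.Build (ksub sZ kZ) (ksub sY kY)
  ksub_map ksub_map_is_zmod_morphism.
HB.instance Definition _ := GRing.isScalable.Build (rquot I)^c
  (ksub sZ kZ) (ksub sY kY) *:%R ksub_map ksub_map_is_scalable.

End Map.
End KilledSub.

Section DependentProduct.
Variable T : nat -> zmodType.

Definition dprod : Type := forall n, T n.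
HB.instance Definition _ := gen_eqMixin dprod.
HB.instance Definition _ := gen_choiceMixin dprod.

Lemma dprodP (s t : dprod) : (forall n, s n = t n) -> s = t.
Proof. exact: functional_extensionality_dep. Qed.

Definition dprod0 : dprod := fun=> 0.
Definition dprodN (s : dprod) : dprod := fun n => - s n.
Definition dprodD (s t : dprod) : dprod := fun n => s n + t n.

Fact dprodDA : associative dprodD.
Proof. by move=> r s t; apply: dprodP => n; exact: addrA. Qed.
Fact dprodDC : commutative dprodD.
Proof. by move=> s t; apply: dprodP => n; exact: addrC. Qed.
Fact dprod0D : left_id dprod0 dprodD.
Proof. by move=> s; apply: dprodP => n; exact: add0r. Qed.
Fact dprodND : left_inverse dprod0 dprodN dprodD.
Proof. by move=> s; apply: dprodP => n; exact: addNr. Qed.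
HB.instance Definition _ :=
  GRing.isZmodule.Build dprod dprodDA dprodDC dprod0D dprodND.

(* The quotient by ev0 stands in for the direct limit of the T n. *)
Definition ev0 : set dprod := [set s | exists m, forall n, (m <= n)%N -> s n = 0].

Lemma ev0_subgroup : subgroup ev0.
Proof.
split=> [|s t [m sm] [p tp0]]; first by exists 0%N.
exists (maxn m p) => n; rewrite geq_max => /andP[mn pn].
by rewrite -[LHS]/(s n - t n) sm // tp0 // subrr.
Qed.

Lemma cls_ev0 (s t : dprod) :
  cls ev0 s = cls ev0 t <-> exists m, forall n, (m <= n)%N -> s n = t n.
Proof.
split=> [/cls_eq|[m st]]; last first.
  apply/cls_eq; apply: sub_gen_smallest; exists m => n /st e.
  by rewrite -[LHS]/(s n - t n) e subrr.
rewrite smallest_subgroup_id; last exact: ev0_subgroup.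
by move=> [m st]; exists m => n /st/subr0_eq.
Qed.

Lemma dprod_sum (I : Type) (l : seq I) (s : I -> dprod) n :
  (\sum_(i <- l) s i) n = \sum_(i <- l) s i n.
Proof. by apply: (big_morph (fun s : dprod => s n)). Qed.

End DependentProduct.

Section SharpFreeFlat.
Variables (R S : clRingType) (f : {rmorphism R -> S}) (f_cont : continuous f).
Variable I : nat -> set R.
Hypothesis oI : forall n, open_ideal (I n).
Hypothesis IS : forall n, I n.+1 `<=` I n.
Hypothesis Ibase : forall V, open_ideal V -> exists n, I n `<=` V.
Let J n := ext_closure f (I n).
Hypothesis oJ : forall n, open_ideal (J n).
Let B n := quot_module (@taut_map R S f I n).
Hypothesis flatB : forall n, flat_module (B n).

Variable X : choiceType.
Let F := sharp_obj f_cont (free_contra S X).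

Let fin (r : lincomb S X) : ugroup F := r.
Let finB : zmod_morphism fin.
Proof.
move=> r s; apply: esym; apply: etrans (sharpB f_cont _ _) _.
exact: free_zmodB.
Qed.

Definition annz (N : discr_module R) n : set N :=
  [set y | forall a, I n a -> rsc y a = 0].

Lemma annz_submodule N n : submodule (@annz N n).
Proof.
split=> [|r y ay a Ia]; last first.
  rewrite -[r *: y]/(rsc y (r : R)) rscM; apply: ay; exact: (oI n).2.2.
split=> [a _|y z ay az a Ia]; first exact: rsc0l.
by rewrite rscBl ay // az // subrr.
Qed.

Lemma annz_ev N (y : discr_sort N) : exists m, forall n, (m <= n)%N -> annz n y.
Proof.
have [V oV Vy] := open_ideal_sub (@discrP R N y) (ann_subgroup y).
have [m mV] := Ibase oV; exists m => n mn a Ia; apply: Vy; apply: mV.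
exact: (Ile IS mn).
Qed.

Definition annm N n : lmodType (rquot (I n))^c :=
  ksub (oI n) (annz_submodule N n) (fun y ay => ay).

(** The value 0 outside the submodule killed by I_n makes the map total. By [annz_ev] a given y
    meets this default for finitely many n only. *)
Definition toann N n (y : discr_sort N) : annm N n :=
  match pselect (annz n y) with
  | left h => smod_in (annz_submodule N n) h
  | right _ => 0
  end.

Definition annval N n (u : annm N n) : discr_sort N :=
  val (u : smod (annz_submodule N n)).

Lemma annval_inj N n : injective (@annval N n).
Proof. exact: val_inj. Qed.

Lemma annvalD N n (u v : annm N n) : annval (u + v) = annval u + annval v.
Proof. exact: (raddfD (smod_incl (annz_submodule N n)) u v). Qed.

Lemma annval_rsc N n (u : annm N n) a :
  annval (rsc u (rcls (I n) a)) = rsc (annval u) a.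
Proof. exact: ksub_rsc. Qed.

Lemma annvalP N n (u : annm N n) : annz n (annval u).
Proof. exact: smodP. Qed.

Lemma toannK N n (y : discr_sort N) : annz n y -> annval (toann n y) = y.
Proof. by rewrite /toann; case: pselect. Qed.

Lemma toannD N n (y z : discr_sort N) : annz n y -> annz n z ->
  toann n (y + z) = toann n y + toann n z.
Proof.
move=> ay az; apply: annval_inj; rewrite annvalD !toannK // => a Ia.
by rewrite rscDl ay // az // addr0.
Qed.

Lemma annz_rsc N n (y : discr_sort N) a : annz n y -> annz n (rsc y a).
Proof. by move=> ay c Ic; rewrite rscM; apply: ay; exact: (oI n).2.2. Qed.

Lemma toann_rsc N n (y : discr_sort N) a : annz n y ->
  toann n (rsc y a) = rsc (toann n y) (rcls (I n) a).
Proof.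
move=> ay; apply: annval_inj; rewrite annval_rsc !toannK //.
exact: annz_rsc.
Qed.

Lemma quot_scale n a s : (rcls (I n) a) *: (rcls (J n) s : B n) = rcls (J n) (f a * s).
Proof.
rewrite -[LHS]/(rquot_map (@taut_map R S f I n) (rcls (I n) a) * rcls (J n) s).
by rewrite rquot_map_cls rmorphM.
Qed.

Section Detect.
Variables (N : discr_module R) (x : X).

Let T n : zmodType := tens (annm N n) (B n).

(** Additivity in y and balancedness hold at the n-th entry only when I_n kills the elements y
    involved. Hence the values are sequences of tensors modulo those that eventually vanish. *)
Let b (y : N) (p : ugroup F) : zquot (@ev0 T) :=
  cls (@ev0 T) (fun n => tp (toann n y) (rcls (J n) ((p : lincomb S X) x) : B n)).

Let bDl y y' p : b (y + y') p = b y p + b y' p.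
Proof.
rewrite /b -raddfD; apply/cls_ev0.
have [m ym] := annz_ev y; have [m' ym'] := annz_ev y'.
exists (maxn m m') => n; rewrite geq_max => /andP[mn mn'].
by rewrite toannD ?tpDl //; [exact: ym|exact: ym'].
Qed.

Let coefFB : zmod_morphism (fun p : ugroup F => (p : lincomb S X) x).
Proof. by move=> p q; rewrite sharpB free_coef_is_zmod_morphism. Qed.

Let bDr y p q : b y (p + q) = b y p + b y q.
Proof.
rewrite /b -raddfD; apply/cls_ev0; exists 0%N => n _.
by rewrite (zmod_morphismD coefFB) rclsD tpDr.
Qed.

Let bal y (r : lincomb R F) : exists2 A : {fset F},
  (forall p : F, p \notin A -> rsc y (r p) = 0) &
  b y (uact r) = \sum_(p <- A) b (rsc y (r p)) p.
Proof.
have [A A0] := discr_fset y r; exists A => //.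
rewrite /b -raddf_sum; apply/cls_ev0; have [m ym] := annz_ev y.
exists m => n /ym an; rewrite dprod_sum.
pose h (s : S) := tp (toann n y) (rcls (J n) s : B n).
have hB : zmod_morphism h.
  move=> s t; apply: (addIr (h t)); rewrite subrK /h -tpDr -rclsD.
  by rewrite subrK.
have hJ s : J n s -> h s = 0.
  by move=> /(rcls0P (oJ n)) e; rewrite /h e tp0r.
have hE a s : h (f a * s) = tp (toann n (rsc y a)) (rcls (J n) s : B n).
  by rewrite /h toann_rsc // tp_bal quot_scale.
have -> : (uact r : lincomb S X) x = isum (fun p : F => f (r p) * (p : lincomb S X) x).
  by [].
rewrite -/(h _) (additive_isum hB (oJ n) hJ (A := A)).
- by apply: eq_bigr => p _; rewrite hE.
- exact: null_familyMr (null_family_map f_cont (coefP r)).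
- by move=> p /A0 e; rewrite hE e -(rsc0r y) toann_rsc // rmorph0 rsc0r tp0l.
Qed.

Lemma free_tensor_detect (l : seq (N * ugroup F)) : \sum_(u <- l) ct u.1 u.2 = 0 ->
  exists m, forall n, (m <= n)%N ->
    \sum_(u <- l) tp (toann n u.1) (rcls (J n) ((u.2 : lincomb S X) x) : B n) = 0.
Proof.
move=> /(congr1 (ct_lift b)); have lB := ct_lift_is_zmod_morphism bDl bDr bal.
rewrite (zmod_morphism_sum lB) (zmod_morphism0 lB).
under eq_bigr => u _ do rewrite ct_lift_ct //.
rewrite /b -raddf_sum -(raddf0 (cls (@ev0 T))) => /cls_ev0[m h].
by exists m => n /h; rewrite dprod_sum.
Qed.

End Detect.

(** By [taut_csum], eta can be rewritten as a sum with coefficients in I_n, all of which kill y. *)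
Lemma ct_small (N : discr_module R) n (y : N) (eta : lincomb S X) :
  annz n y -> (forall x, J n (eta x)) -> ct y (fin eta) = 0.
Proof.
move=> ay Jeta.
have [rho [q [Irho e]]] := @taut_csum R S f f_cont I oI IS Ibase oJ
  (free_contra S X) X eta (@eps S X) n Jeta.
have -> : fin eta = @csum R F _ rho q by rewrite csum_sharp -e; exact: free_eps.
by apply: ct_csum0 => k; exact: ay.
Qed.

Section Realize.
Variables (N : discr_module R) (x : X) (n : nat).

(** A map opposite to the one of the preceding section, at a fixed level n and placed at the
    coordinate x. The representative of s is immaterial by [ct_small]. *)
Let b (u : annm N n) (s : B n) : ctens N F :=
  ct (annval u) (fin (mono (repr (s : rquot (J n))) x)).

Let bE u s : b u (rcls (J n) s) = ct (annval u) (fin (mono s x)).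
Proof.
apply/eqP; rewrite -subr_eq0 -ctBr -finB -(mono_is_zmod_morphism x); apply/eqP.
apply: (@ct_small _ n); first exact: annvalP.
move=> z /=; case: ifP => _; last exact: (oJ n).2.1.1.1.
exact: (rcls_repr_mod (oJ n)).
Qed.

Let bDl u v s : b (u + v) s = b u s + b v s.
Proof. by rewrite /b annvalD ctDl. Qed.
Let bDr u s t : b u (s + t) = b u s + b u t.
Proof.
rewrite -[s](@rcls_repr _ (J n)) -[t](@rcls_repr _ (J n)).
rewrite -[X in b u X](rclsD (J n)) !bE.
by rewrite (zmod_morphismD (mono_is_zmod_morphism x)) (zmod_morphismD finB) ctDr.
Qed.
Let bal u a s : b (rsc u a) s = b u (a *: s).
Proof.
rewrite -[a](@rcls_repr _ (I n)) -[s](@rcls_repr _ (J n)) quot_scale !bE.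
rewrite annval_rsc -ct_act (sharp_cact f_cont); congr ct.
apply: lincombP => z; rewrite -[LHS]/(phi (mono _ (mono _ x)) z) phi_mono /=.
by case: ifP; rewrite ?mulr0.
Qed.

Lemma free_tensor_realize (l : seq (N * lincomb S X)) :
  (forall u, u \in l -> annz n u.1) ->
  \sum_(u <- l) tp (toann n u.1) (rcls (J n) (u.2 x) : B n) = 0 ->
  \sum_(u <- l) ct u.1 (fin (mono (u.2 x) x)) = 0.
Proof.
move=> al /(congr1 (tens_lift b)); have lB := tens_lift_is_zmod_morphism bDl bDr bal.
rewrite (zmod_morphism_sum lB) (zmod_morphism0 lB) => h; apply: etrans h.
rewrite big_seq [RHS]big_seq; apply: eq_bigr => u /al au.
by rewrite tens_lift_tp // bE toannK.
Qed.

End Realize.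

Section ShortExact.
Variables (K M N : discr_module R) (i : {linear K -> M}) (q : {linear M -> N}).
Hypothesis ex : short_exact i q.
Variable n : nat.

Let annz_map (y : K) : annz n y -> annz n (i y).
Proof. by move=> ay a /ay e; rewrite -rsc_lin e raddf0. Qed.

(** Passing to the elements killed by I_n is only left exact: q need not map [annz M n] onto
    [annz N n]. The third term is therefore the image. *)
Let Y : set N := q @` annz n.
Let sY : submodule Y.
Proof.
have [[Z0 ZB] Zs] := annz_submodule M n.
split=> [|a _ [y Zy <-]]; last by exists (a *: y); [exact: Zs|exact: linearZZ].
split=> [|_ _ [y Zy <-] [z Zz <-]]; first by exists 0 => //; exact: raddf0.
by exists (y - z); [exact: ZB|exact: raddfB].
Qed.
Let kY y : Y y -> forall a, I n a -> rsc y a = 0.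
Proof. by move=> [z az <-] a /az e; rewrite -rsc_lin e raddf0. Qed.
Let qY (y : M) : annz n y -> Y (q y).
Proof. by move=> ay; exists y. Qed.

Definition ann_map : {linear annm K n -> annm M n} :=
  @ksub_map R (I n) (oI n) K M i _ _ (annz_submodule K n) (annz_submodule M n)
    (fun y ay => ay) (fun y ay => ay) annz_map.

Let annq : {linear annm M n -> ksub (oI n) sY kY} :=
  @ksub_map R (I n) (oI n) M N q _ _ (annz_submodule M n) sY
    (fun y ay => ay) kY qY.

Lemma ann_map_toann (y : K) : annz n y -> ann_map (toann n y) = toann n (i y).
Proof.
move=> ay; apply: annval_inj; rewrite toannK; last exact: annz_map.
by apply: etrans (congr1 i (toannK ay)).
Qed.

Let ann_ex : short_exact ann_map annq.
Proof.
have [inj ei eq] := ex; split.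
- move=> u v uv; apply: val_inj; apply: inj.
  exact: (congr1 (@annval M n) uv).
- apply/seteqP; split=> [_ [u _ <-]|u /= u0].
    apply: val_inj; rewrite -[LHS]/(q (i (annval u))).
    by have : range i (i (annval u)) by [exists (annval u)]; rewrite ei.
  have [k _ ki] : range i (annval u).
    rewrite ei /=; exact: (congr1 (@smod_val _ _ _ sY) u0).
  (* Since i is injective, k is killed by whatever kills its image. *)
  have ak : annz n k.
    move=> a Ia; apply: inj; rewrite rsc_lin raddf0 ki; exact: annvalP.
  exists (toann n k) => //; rewrite ann_map_toann //; apply: annval_inj.
  by rewrite toannK ki //; exact: annvalP.
- apply/seteqP; split=> // v _; have [y ay e] := smodP (v : smod sY).
  exists (toann n y) => //; apply: val_inj; rewrite -[RHS]e.
  exact: (congr1 q (toannK ay)).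
Qed.

Lemma ann_tens_inj (t : tens (annm K n) (B n)) :
  tens_map (F := B n) ann_map t = 0 -> t = 0.
Proof.
have [inj _ _] := @flatB n _ _ _ ann_map annq ann_ex; move=> t0; apply: inj; rewrite t0.
by rewrite (zmod_morphism0 (@tens_map_is_zmod_morphism _ _ _ (B n) ann_map)).
Qed.

End ShortExact.

(** A relation in M (.)_R F is detected, for each coordinate x, in the tensor product of M_n and
    S/J_n for large n. Flatness of S/J_n over R/I_n pulls it back to K_n, and [free_tensor_realize]
    returns it to K (.)_R F. Finitely many coordinates suffice: the others have coefficients in J_m,
    which [ct_small] discards. *)
Lemma sharp_free_flat : flat_contra F.
Proof.
apply: flat_contra_inj => K M N i q ex t it0.
have [l e] := ctens_sum t.
have [m lm] : exists m, forall n u, (m <= n)%N -> u \in l -> annz n u.1.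
  elim: l {e} => [|u l [m IH]]; first by exists 0%N.
  have [m' um'] := annz_ev u.1; exists (maxn m m') => n v.
  rewrite geq_max inE => /andP[mn m'n] /predU1P[->|]; [exact: um'|exact: IH].
have iB := @ctens_map_is_zmod_morphism R F K M i.
have il0 : \sum_(u <- [seq (i u.1, u.2) | u <- l]) ct u.1 u.2 = (0 : ctens M F).
  rewrite big_map; apply: etrans it0; rewrite e (zmod_morphism_sum iB).
  by apply: eq_bigr => u _; rewrite ctens_map_ct.
have coord x : \sum_(u <- l) ct u.1 (fin (mono ((u.2 : lincomb S X) x) x)) = 0.
  (* The bound m ensures that [toann] is no default value on the terms of l, while m' depends on x
     and ensures that the detected relation holds. *)
  have [m' h] := free_tensor_detect x il0; pose n := maxn m m'.
  apply: (@free_tensor_realize K x n l) => [u|]; first by apply: lm; exact: leq_maxl.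
  have {h} := h n (leq_maxr _ _); rewrite big_map => h.
  apply: (ann_tens_inj ex).
  have tB := @tens_map_is_zmod_morphism _ _ _ (B n) (ann_map i n).
  rewrite (zmod_morphism_sum tB); apply: etrans h.
  rewrite big_seq [RHS]big_seq; apply: eq_bigr => u ul.
  by rewrite /tp tens_map_pure ann_map_toann //; apply: lm; rewrite ?leq_maxl.
have [A A0] : exists A : {fset X}, forall u x, u \in l -> x \notin A ->
    J m ((u.2 : lincomb S X) x).
  apply: seq_fset_bound => u; exact: null_fsetV (coefP (u.2 : lincomb S X)) (oJ m).
have -> : t = \sum_(x <- A) \sum_(u <- l) ct u.1 (fin (mono ((u.2 : lincomb S X) x) x)).
  rewrite e exchange_big /= big_seq [RHS]big_seq; apply: eq_bigr => u ul.
  rewrite -ct_sumr -(zmod_morphism_sum finB); apply/eqP.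
  rewrite -subr_eq0 -ctBr -[u.2 - _]/(fin u.2 - fin _) -finB; apply/eqP.
  apply: (ct_small (n := m)); first exact: lm.
  by move=> x; rewrite lincomb_split; case: ifPn => [_|xA];
    [exact: (oJ m).2.1.1.1|exact: A0].
by rewrite big1.
Qed.

End SharpFreeFlat.

(** * Base change of contramodules *)

Definition subcontra (R : clRingType) (G : contramodule R) (Z : set (ugroup G)) :
    Prop :=
  subgroup Z /\ forall (X : choiceType) (r : lincomb R X) (p : X -> ugroup G),
    (forall x, Z (p x)) -> Z (csum r p).

Section QuotientContra.
Variables (R : clRingType) (G : contramodule R) (Z : set (ugroup G)).
Hypothesis sZ : subcontra Z.

Lemma cls_csum (X : choiceType) (r : lincomb R X) (p p' : X -> ugroup G) :
  (forall x, cls Z (p x) = cls Z (p' x)) -> cls Z (csum r p) = cls Z (csum r p').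
Proof.
move=> pp'; apply/cls_eq; rewrite smallest_subgroup_id; last exact: sZ.1.
rewrite -csumB; apply: sZ.2 => x.
by have /cls_eq := pp' x; rewrite smallest_subgroup_id //; exact: sZ.1.
Qed.

Definition qact (r : lincomb R (zquot Z)) : zquot Z := cls Z (csum r repr).

Fact qact_unit q : qact (eps R q) = q.
Proof. by rewrite /qact csum_eps cls_repr. Qed.

Fact qact_assoc (Xi : lincomb R (lincomb R (zquot Z))) :
  qact (lcmap qact Xi) = qact (phi Xi).
Proof.
rewrite /qact csum_lcmap -[phi Xi]/(phi Xi) -[X in phi X]lcmap_id -csum_phi.
by apply: cls_csum => s; rewrite /= cls_repr.
Qed.

Definition qcontra : contramodule R := Contramodule qact_unit qact_assoc.

Definition qproj_fun (p : G) : qcontra := cls Z p.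

Fact qproj_subproof (r : lincomb R G) :
  qproj_fun (ctr_act r) = ctr_act (lcmap qproj_fun r).
Proof.
rewrite -[RHS]/(qact (lcmap (qproj_fun : G -> zquot Z) r)) /qact csum_lcmap.
rewrite /qproj_fun -[ctr_act r]/(uact r) -csum_id.
by apply: cls_csum => p; rewrite /= cls_repr.
Qed.
Definition qproj : contra_hom G qcontra := ContraHom qproj_subproof.

Lemma qproj_eq (p p' : ugroup G) : Z (p - p') -> uhom qproj p = uhom qproj p'.
Proof. by move=> h; apply/cls_eq; apply: sub_gen_smallest. Qed.

Lemma qproj_repr (q : ugroup qcontra) : uhom qproj (repr (q : zquot Z)) = q.
Proof. exact: (cls_repr (A := Z)). Qed.

Lemma qcontra_repr (q : ugroup qcontra) (p : ugroup G) :
  q = uhom qproj p -> Z (repr (q : zquot Z) - p).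
Proof.
move=> ->; have : smallest (@subgroup _) Z (repr (cls Z p) - p) by exact: repr_cls.
by rewrite smallest_subgroup_id //; exact: sZ.1.
Qed.

End QuotientContra.

Section BaseChange.
Variables (R S : clRingType) (f : {rmorphism R -> S}) (f_cont : continuous f).
Variable P : contramodule R.
Let G := free_contra S P.

Definition bc_rel (rho : lincomb R P) : ugroup G :=
  (eps S (ctr_act rho) : ugroup G) - (lcbase f_cont rho : ugroup G).

Definition bc_ker : set (ugroup G) := [set xi | forall Z : set (ugroup G),
  subcontra Z -> (forall rho, Z (bc_rel rho)) -> Z xi].

Lemma bc_ker_subcontra : subcontra bc_ker.
Proof.
split=> [|X r p pZ Z sZ relZ]; last by apply: sZ.2 => x; exact: pZ.
split=> [Z sZ _|x y Zx Zy Z sZ relZ]; first exact: sZ.1.1.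
by apply: sZ.1.2; [exact: Zx|exact: Zy].
Qed.

(* S (x)_R P, as the quotient of S[[P]] that makes P -> S[[P]] R-linear *)
Definition base_change : contramodule S := qcontra bc_ker_subcontra.
Let T := base_change.
Let pr : contra_hom G T := qproj bc_ker_subcontra.

Definition bc_unit_fun (p : P) : sharp_obj f_cont T := pr (eps S p).

Let csum_unit (xi : lincomb S P) : csum xi (bc_unit_fun : P -> ugroup T) = uhom pr xi.
Proof. by rewrite [in RHS](free_eps xi) uhom_csum. Qed.

Fact bc_unit_subproof (rho : lincomb R P) :
  bc_unit_fun (ctr_act rho) = ctr_act (lcmap bc_unit_fun rho).
Proof.
rewrite -[RHS]/(@csum R (sharp_obj f_cont T) P rho bc_unit_fun) csum_sharp csum_unit.
by apply: qproj_eq => Z _; apply.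
Qed.
Definition bc_unit : contra_hom P (sharp_obj f_cont T) := ContraHom bc_unit_subproof.

Section Lift.
Variables (Q : contramodule S) (g : contra_hom P (sharp_obj f_cont Q)).

(** The S-linear extension of g to S[[P]]. It kills the relations [bc_rel] because g is R-linear. *)
Let k (xi : G) : Q := csum xi (g : P -> ugroup Q).
Let kP (r : lincomb S G) : k (ctr_act r) = ctr_act (lcmap k r).
Proof.
rewrite -[LHS]/(csum (phi r) (g : P -> ugroup Q)) -[X in phi X]lcmap_id -csum_phi.
by [].
Qed.
Let kh : contra_hom G Q := ContraHom kP.

Let k0 (xi : ugroup G) : bc_ker xi -> uhom kh xi = 0.
Proof.
have kB : zmod_morphism (uhom kh) := @uhom_is_zmod_morphism S G Q kh.
move=> /(_ [set xi | uhom kh xi = 0]); apply.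
  split=> [|X r p p0]; last first.
    apply: etrans (uhom_csum kh r p) _; rewrite -[RHS](csum0 Q r).
    by congr csum; apply/funext.
  split=> [|x y x0 y0]; first exact: (zmod_morphism0 kB).
  apply: etrans (kB x y) _.
  exact: etrans (congr2 (fun u v : ugroup Q => u - v) x0 y0) (subrr _).
move=> rho; apply: etrans (kB _ _) _; apply/eqP; rewrite subr_eq0; apply/eqP.
rewrite -[LHS]/(csum (eps S (ctr_act rho)) (g : P -> ugroup Q)) csum_eps.
rewrite -[RHS]/(csum (lcbase f_cont rho) (g : P -> ugroup Q)) -(csum_sharp f_cont).
by rewrite chomP.
Qed.

Let keq (xi xi' : ugroup G) : bc_ker (xi - xi') -> uhom kh xi = uhom kh xi'.
Proof.
move=> /k0 e; apply: subr0_eq; apply: etrans e.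
by apply: esym; exact: (@uhom_is_zmod_morphism S G Q kh).
Qed.

Definition bc_lift_fun (t : T) : Q := kh (repr (t : zquot bc_ker)).

Fact bc_lift_subproof (r : lincomb S T) :
  bc_lift_fun (ctr_act r) = ctr_act (lcmap bc_lift_fun r).
Proof.
transitivity (uhom kh (csum r (fun t : T => repr (t : zquot bc_ker) : ugroup G))).
  apply: keq; exact: (qcontra_repr (sZ := bc_ker_subcontra)).
by rewrite uhom_csum.
Qed.
Definition bc_lift : contra_hom T Q := ContraHom bc_lift_subproof.

Lemma bc_lift_unit p : bc_lift (bc_unit p) = g p.
Proof.
transitivity (uhom kh (eps S p)).
  apply: keq; exact: (qcontra_repr (sZ := bc_ker_subcontra)).
exact: (@csum_eps S Q P p g).
Qed.

End Lift.

Section Compare.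
Variable N : discr_module S.
Let NR := discr_restr_obj f_cont N.

Let restr_rsc (y : N) a : @rsc R NR y a = rsc y (f a) :> discr_sort N.
Proof. by []. Qed.
Let lcbaseE (rho : lincomb R P) p : lcbase f_cont rho p = f (rho p).
Proof. by []. Qed.

Let c (y : N) (xi : ugroup G) : ctens NR P :=
  \sum_(p \in [set: P]) @ct R NR P (rsc y ((xi : lincomb S P) p)) p.

Lemma bc_cE y (xi : lincomb S P) (A : {fset P}) :
  (forall p, p \notin A -> rsc y (xi p) = 0) ->
  c y xi = \sum_(p <- A) @ct R NR P (rsc y (xi p)) p.
Proof. by move=> A0; apply: fsbigTE => p /A0 ->; exact: (@ct0l R NR P). Qed.

Let coefGB p : zmod_morphism (fun xi : ugroup G => (xi : lincomb S P) p).
Proof. exact: free_coef_is_zmod_morphism. Qed.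

Let cDl y y' xi : c (y + y') xi = c y xi + c y' xi.
Proof.
have [A A0] := discr_fset y xi; have [B B0] := discr_fset y' xi.
rewrite !(@bc_cE _ _ (A `|` B)%fset) => [|p|p|p].
- rewrite -big_split; apply: eq_bigr => p _; rewrite rscDl.
  exact: (@ctDl R NR P).
- by rewrite in_fsetU negb_or => /andP[_ /B0].
- by rewrite in_fsetU negb_or => /andP[/A0].
- by rewrite in_fsetU negb_or => /andP[/A0 e /B0 e']; rewrite rscDl e e' addr0.
Qed.

Let cDr y xi xi' : c y (xi + xi') = c y xi + c y xi'.
Proof.
have [A A0] := discr_fset y xi; have [B B0] := discr_fset y xi'.
have e p : ((xi + xi' : ugroup G) : lincomb S P) p =
    (xi : lincomb S P) p + (xi' : lincomb S P) p := zmod_morphismD (coefGB p) xi xi'.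
rewrite !(@bc_cE _ _ (A `|` B)%fset) => [|p|p|p].
- rewrite -big_split; apply: eq_bigr => p _; rewrite e rscDr.
  exact: (@ctDl R NR P).
- by rewrite in_fsetU negb_or => /andP[_ /B0].
- by rewrite in_fsetU negb_or => /andP[/A0].
- rewrite in_fsetU negb_or e => /andP[/A0 e1 /B0 e2].
  by rewrite rscDr e1 e2 addr0.
Qed.

Let c_csum (X : choiceType) y (r : lincomb S X) (A : {fset X}) (p : X -> ugroup G) :
  (forall x, x \notin A -> rsc y (r x) = 0) ->
  c y (csum r p) = \sum_(x <- A) c (rsc y (r x)) (p x).
Proof.
move=> A0.
have [B B0] : exists B : {fset P}, forall x z, x \in enum_fset A -> z \notin B ->
    rsc (rsc y (r x)) ((p x : lincomb S P) z) = 0.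
  by apply: seq_fset_bound => x; exact: discr_fset.
have ce z : rsc y ((csum r p : lincomb S P) z) =
    \sum_(x <- A) rsc (rsc y (r x)) ((p x : lincomb S P) z).
  have -> : (csum r p : lincomb S P) z = isum (fun x => r x * (p x : lincomb S P) z).
    exact: (phi_lcmap p r z).
  rewrite (@rsc_isum _ _ _ _ _ A).
  - by apply: eq_bigr => x _; rewrite rscM.
  - exact: null_familyMr (coefP r).
  - by move=> x /A0 e; rewrite -rscM e rsc0l.
rewrite (@bc_cE _ _ B) => [|z zB]; last first.
  by rewrite ce big_seq big1 // => x xA; exact: B0.
transitivity (\sum_(z <- B) \sum_(x <- A)
    @ct R NR P (rsc (rsc y (r x)) ((p x : lincomb S P) z)) z).
  apply: eq_bigr => z _; rewrite ce.
  have cB : zmod_morphism (fun w : NR => @ct R NR P w z) by move=> w w'; exact: ctBl.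
  exact: (zmod_morphism_sum cB (enum_fset A)).
rewrite exchange_big /= big_seq [RHS]big_seq; apply: eq_bigr => x xA.
by rewrite (@bc_cE _ _ B) // => z; exact: B0.
Qed.

Let cr y : zmod_morphism (c y).
Proof. by move=> xi xi'; apply: (addIr (c y xi')); rewrite -cDr !subrK. Qed.
Let c_rel y rho : c y (bc_rel rho) = 0.
Proof.
have [A A0] := @discr_fset R NR P y rho.
have e1 : c y (eps S (ctr_act rho)) = @ct R NR P y (uact rho).
  rewrite (@bc_cE y (eps S (ctr_act rho)) [fset (ctr_act rho : P)]%fset).
    by rewrite big_seq_fset1 /= eqxx rsc1.
  by move=> p; rewrite in_fset1 => /negbTE /= ->; rewrite rsc0r.
have e2 : c y (lcbase f_cont rho) = @ct R NR P y (uact rho).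
  have A0' p : p \notin A -> rsc y (lcbase f_cont rho p) = 0.
    by move=> pA; rewrite lcbaseE -restr_rsc; exact: A0.
  rewrite (bc_cE A0') (@ct_uact R NR P y rho A A0).
  by apply: eq_bigr => p _; rewrite lcbaseE -restr_rsc.
by apply: etrans (cr y _ _) _; apply/eqP; rewrite subr_eq0; apply/eqP; rewrite e1.
Qed.

(** Vanishing is required for all z at once: by [c_csum], the value of c at z on a sum involves c at
    the elements z r_x. Only the joint kernel is visibly a subcontramodule. *)
Let c_ker y xi : bc_ker xi -> c y xi = 0.
Proof.
move=> /(_ [set xi | forall z, c z xi = 0]) h; apply: h => [|rho z]; last first.
  exact: c_rel.
split=> [|X r p p0 z]; last first.
  have [A A0] := discr_fset z r; rewrite (c_csum _ A0) big1 // => x _; exact: p0.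
split=> [z|u v u0 v0 z]; first exact: zmod_morphism0.
by rewrite cr u0 v0 subrr.
Qed.

Let c_eq y xi xi' : bc_ker (xi - xi') -> c y xi = c y xi'.
Proof. by move=> /(c_ker y); rewrite cr => /subr0_eq. Qed.

Let b (y : N) (t : ugroup T) : ctens NR P := c y (repr (t : zquot bc_ker)).

Let bE y t xi : t = uhom pr xi -> b y t = c y xi.
Proof. by move=> e; apply: c_eq; exact: (qcontra_repr e). Qed.

Let bDl y y' t : b (y + y') t = b y t + b y' t.
Proof. exact: cDl. Qed.

Let bDr y t t' : b y (t + t') = b y t + b y t'.
Proof.
have prD := zmod_morphismD (@uhom_is_zmod_morphism _ _ _ pr).
have rE (v : ugroup T) : uhom pr (repr (v : zquot bc_ker)) = v by exact: qproj_repr.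
by rewrite /b -cDr; apply: bE; rewrite prD !rE.
Qed.

Let bal y (r : lincomb S T) : exists2 A : {fset T},
  (forall t : T, t \notin A -> rsc y (r t) = 0) &
  b y (uact r) = \sum_(t <- A) b (rsc y (r t)) t.
Proof.
have [A A0] := discr_fset y r; exists A => //.
rewrite (@bE y (uact r) (csum r (fun t : T => repr (t : zquot bc_ker) : ugroup G))) //.
exact: c_csum.
Qed.

Definition bc_to : ctens N T -> ctens NR P := ct_lift b.

Lemma bc_to_is_zmod_morphism : zmod_morphism bc_to.
Proof. exact: (ct_lift_is_zmod_morphism bDl bDr bal). Qed.

Lemma bc_to_ct y (xi : lincomb S P) (A : {fset P}) :
  (forall p, p \notin A -> rsc y (xi p) = 0) ->
  bc_to (ct y (uhom pr (xi : ugroup G))) = \sum_(p <- A) @ct R NR P (rsc y (xi p)) p.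
Proof.
move=> A0; rewrite /bc_to (ct_lift_ct bDl bDr bal) (bE _ (erefl _)).
exact: bc_cE.
Qed.

Let d (y : NR) (p : ugroup P) : ctens N T := @ct S N T y (bc_unit p).

Let uB : zmod_morphism (fun p : ugroup P => bc_unit p : ugroup T).
Proof.
move=> p q; apply: etrans (sharpB f_cont (bc_unit p) (bc_unit q)).
exact: (@uhom_is_zmod_morphism R _ _ bc_unit p q).
Qed.

Let dDl y y' p : d (y + y') p = d y p + d y' p.
Proof. exact: (@ctDl S N T). Qed.
Let dDr y p q : d y (p + q) = d y p + d y q.
Proof. by rewrite /d (zmod_morphismD uB) ctDr. Qed.
Let dal y (r : lincomb R P) : exists2 A : {fset P},
  (forall p : P, p \notin A -> rsc y (r p) = 0) &
  d y (uact r) = \sum_(p <- A) d (rsc y (r p)) p.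
Proof.
have [A A0] := discr_fset y r; exists A => //.
rewrite /d; have -> : bc_unit (uact r) = csum (lcbase f_cont r) (bc_unit : P -> ugroup T).
  by rewrite -csum_sharp /uact chomP.
have A0' p : p \notin A -> rsc (y : N) (lcbase f_cont r p) = 0.
  by move=> pA; rewrite lcbaseE -restr_rsc; exact: A0.
rewrite (ct_csum _ A0'); apply: eq_bigr => p _.
by rewrite lcbaseE -restr_rsc.
Qed.

Definition bc_from : ctens NR P -> ctens N T := ct_lift d.

Lemma bc_from_is_zmod_morphism : zmod_morphism bc_from.
Proof. exact: (ct_lift_is_zmod_morphism dDl dDr dal). Qed.

Lemma bc_toK : cancel bc_to bc_from.
Proof.
have tB := bc_to_is_zmod_morphism; have fB := bc_from_is_zmod_morphism.
apply: ctens_ind => [|y t].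
  split=> [|s t /= es et]; first by rewrite /= (zmod_morphism0 tB) (zmod_morphism0 fB).
  by rewrite /= tB fB es et.
rewrite /= -[t](qproj_repr (sZ := bc_ker_subcontra)).
set xi : lincomb S P := repr _; have [A A0] := discr_fset y xi.
rewrite -/pr (bc_to_ct A0) (zmod_morphism_sum fB) -csum_unit (ct_csum _ A0).
by apply: eq_bigr => p _; exact: (ct_lift_ct dDl dDr dal).
Qed.

End Compare.

(** Injectivity for the restricted modules is transported along [bc_to], which is natural in N and
    injective because [bc_from] is a left inverse. *)
Lemma base_change_flat : flat_contra P -> flat_contra T.
Proof.
move=> flatP; apply: flat_contra_inj => K M N i q ex t it0.
pose iR := discr_restr_hom f_cont i; pose qR := discr_restr_hom f_cont q.
have [inj _ _] := @flatP _ _ _ iR qR ex.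
have iB := @ctens_map_is_zmod_morphism S T K M i.
have iRB := @ctens_map_is_zmod_morphism R P _ _ iR.
have nat : bc_to (@ctens_map S K M T i t) = ctens_map (P := P) iR (bc_to t).
  have kB := @bc_to_is_zmod_morphism K; have mB := @bc_to_is_zmod_morphism M.
  move: {it0} t; apply: ctens_ind => [|y t].
    split=> [|s t /= es et].
      by rewrite /= (zmod_morphism0 kB) (zmod_morphism0 iB) (zmod_morphism0 mB) (zmod_morphism0 iRB).
    by rewrite /= iB kB mB iRB es et.
  rewrite /= -[t](qproj_repr (sZ := bc_ker_subcontra)) ctens_map_ct.
  set xi : lincomb S P := repr _; have [A A0] := discr_fset y xi.
  rewrite (bc_to_ct A0) (zmod_morphism_sum iRB) (@bc_to_ct _ _ _ A) => [|p /A0 e].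
    by apply: eq_bigr => p _; rewrite ctens_map_ct -rsc_lin.
  by rewrite -rsc_lin e raddf0.
have t0 : bc_to t = 0.
  apply: inj; rewrite -nat it0 (zmod_morphism0 iRB).
  exact: (zmod_morphism0 (@bc_to_is_zmod_morphism M)).
apply: etrans (esym (bc_toK t)) _; rewrite t0.
exact: (zmod_morphism0 (@bc_from_is_zmod_morphism K)).
Qed.

End BaseChange.

(** * Comparison of the conditions *)

Lemma linear_of (A : pzRingType) (M N : lmodType A) (g : M -> N) :
  zmod_morphism g -> scalable g -> {l : {linear M -> N} | l = g :> (M -> N)}.
Proof.
move=> gB gZ; pose zB := GRing.isZmodMorphism.Build M N g gB.
pose zS := GRing.isScalable.Build A M N *:%R g gZ.
pose l : {linear M -> N} := HB.pack g zB zS.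
by exists l.
Qed.

Lemma bijective_of (T U : Type) (g : T -> U) :
  injective g -> (forall y, exists x, g x = y) -> bijective g.
Proof.
move=> inj /choice[h hK]; exists h => //.
by move=> x; apply: inj; rewrite hK.
Qed.

Section RingAction.
Variables (S : clRingType) (C : pzRingType) (h : {rmorphism S -> C}) (J : set S).
Hypotheses (oJ : open_ideal J) (hJ : forall s, J s -> h s = 0).

Definition act_rmod : lmodType S^c := restr (conv_rmorphism h) (C^c)^o.

Lemma act_rmod_rsc (y : C) s : rsc (y : act_rmod) s = y * h s.
Proof. by []. Qed.

Fact act_discr_subproof (y : act_rmod) : open [set s : S | rsc y s = 0].
Proof.
apply: (open_supgroup oJ) => [|s Js]; first exact: ann_subgroup.
apply: etrans (act_rmod_rsc (y : C) s) _.
by rewrite (hJ Js) mulr0.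
Qed.
Definition act_discr : discr_module S := DiscrModule act_discr_subproof.

(** The sum is finite, since h kills J and a null family lies in J outside finitely many indices. *)
Definition act_sum (r : lincomb S C) : C := \sum_(c \in [set: C]) h (r c) * c.

Lemma act_sumE (r : lincomb S C) (A : {fset C}) :
  (forall c, c \notin A -> h (r c) = 0) -> act_sum r = \sum_(c <- A) h (r c) * c.
Proof. by move=> A0; apply: fsbigTE => c /A0 ->; rewrite mul0r. Qed.

Lemma act_fset (X : choiceType) (r : lincomb S X) :
  exists A : {fset X}, forall c, c \notin A -> h (r c) = 0.
Proof. by have [A A0] := null_fsetV (coefP r) oJ; exists A => c /A0/hJ. Qed.

Fact act_sum_unit (c : C) : act_sum (eps S c) = c.
Proof.
rewrite (@act_sumE _ [fset c]%fset) ?big_seq_fset1 /= ?eqxx ?rmorph1 ?mul1r //.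
by move=> d; rewrite in_fset1 => /negbTE ->; rewrite rmorph0.
Qed.

(** As h kills an open ideal, it commutes with infinite sums and leaves finitely many outer terms s,
    each with finitely many nonzero inner terms. Both sides become the finite sum of h(Xi s) times
    [act_sum s]. *)
Fact act_sum_assoc (Xi : lincomb S (lincomb S C)) :
  act_sum (lcmap act_sum Xi) = act_sum (phi Xi).
Proof.
have hB : zmod_morphism h := rmorphB h.
have [A A0] := act_fset Xi.
have [D D0] : exists D : {fset C}, forall s c, s \in enum_fset A -> c \notin D ->
    h ((s : lincomb S C) c) = 0.
  by apply: seq_fset_bound => s; exact: act_fset.
pose B := [fset act_sum s | s in A]%fset.
have e1 c : h (lcmap act_sum Xi c) = \sum_(s <- A) (if act_sum s == c then h (Xi s) else 0).
  rewrite lcmapE (additive_isum hB oJ hJ (A := A)).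
  - by apply: eq_bigr => s _; case: ifP; rewrite ?rmorph0.
  - exact: null_family_if (coefP Xi).
  - by move=> s /A0 e; case: ifP; rewrite ?rmorph0.
have e2 c : h (phi Xi c) = \sum_(s <- A) h (Xi s) * h (s c).
  rewrite phiE (additive_isum hB oJ hJ (A := A)).
  - by apply: eq_bigr => s _; rewrite rmorphM.
  - exact: null_familyMr (coefP Xi).
  - by move=> s /A0 e; rewrite rmorphM e mul0r.
rewrite (@act_sumE _ B) => [|c cB]; last first.
  rewrite e1 big_seq big1 // => s sA; case: eqP => // sc.
  by case/negP: cB; rewrite -sc; apply/imfsetP; exists s.
rewrite (@act_sumE _ D) => [|c cD]; last first.
  by rewrite e2 big_seq big1 // => s sA; rewrite D0 ?mulr0.
transitivity (\sum_(s <- A) h (Xi s) * act_sum s).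
  under eq_bigr => c _ do rewrite e1 mulr_suml.
  rewrite exchange_big /= big_seq [RHS]big_seq; apply: eq_bigr => s sA.
  have sB : act_sum s \in B by apply/imfsetP; exists s.
  rewrite (big_fsetD1 _ sB) /= eqxx big_seq big1 ?addr0 // => c.
  by rewrite !inE eq_sym => /andP[/negbTE -> _]; rewrite mul0r.
under [RHS]eq_bigr => c _ do rewrite e2 mulr_suml.
rewrite exchange_big /= big_seq [RHS]big_seq; apply: eq_bigr => s sA.
rewrite (@act_sumE s D) => [|c]; last exact: D0.
by rewrite mulr_sumr; apply: eq_bigr => c _; rewrite mulrA.
Qed.

Definition act_contra : contramodule S := Contramodule act_sum_unit act_sum_assoc.

Lemma act_contra_mono s (c : C) : @ctr_act S act_contra (mono s c) = h s * c.
Proof.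
rewrite -[LHS]/(act_sum (mono s c)) (@act_sumE _ [fset c]%fset).
  by rewrite big_seq_fset1 /= eqxx.
by move=> d; rewrite in_fset1 /= => /negbTE ->; rewrite rmorph0.
Qed.

(** The image of the single open ideal J is already 0. *)
Lemma act_contra_separated : separated act_contra.
Proof.
apply/seteqP; split=> [x|_ -> V [_ [[V0 _] _]]]; last first.
  by exists 0 => //; rewrite raddf0.
move=> /(_ J) [|r Jr <-]; first by split; [exact: oJ.1|exact: oJ.2.1].
rewrite /= -(raddf0 (@uact S act_contra)).
rewrite -[LHS]/(act_sum r) -[RHS]/(act_sum 0).
rewrite !(@act_sumE _ fset0) ?big_seq_fset0 // => c _; first exact: rmorph0.
by apply: hJ; exact: Jr.
Qed.

End RingAction.

Section Conditions.
Variables (R S : clRingType) (f : {rmorphism R -> S}) (f_cont : continuous f).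

Lemma fhom_diamond_inj (M N : discr_module S) :
  injective (@fhom _ _ (f_diamond f_cont) M N).
Proof.
move=> g h gh; apply: linear_ext => y.
exact: (congr1 (fun l : {linear restr (conv_rmorphism f) M -> restr (conv_rmorphism f) N}
  => l y) gh).
Qed.

Lemma diamond_full (M N : discr_module S) (g : M -> N) :
  bijective (@fhom _ _ (f_diamond f_cont) M N) -> zmod_morphism g ->
  (forall y a, g (rsc y (f a)) = rsc (g y) (f a)) ->
  forall y s, g (rsc y s) = rsc (g y) s.
Proof.
move=> [h _ hK] gB gf y s.
pose g' : restr (conv_rmorphism f) M -> restr (conv_rmorphism f) N := g.
have gZ : scalable g' by move=> a z; exact: gf.
have [l lE] := linear_of (gB : zmod_morphism g') gZ.
have hE z : h l z = g z.
  transitivity (l z); last by rewrite lE.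
  exact: (congr1 (fun v : {linear restr (conv_rmorphism f) M -> restr (conv_rmorphism f) N}
    => v z) (hK l)).
by rewrite -!hE (rsc_lin (h l)).
Qed.

Lemma sharp_hom_inj (P Q : contramodule S) : injective (@sharp_hom R S f f_cont P Q).
Proof.
move=> g h gh; apply: contra_hom_ext => p.
exact: (congr1 (fun l : contra_hom (sharp_obj f_cont P) (sharp_obj f_cont Q) => l p) gh).
Qed.

Lemma sharp_hom_bij (P Q : contramodule S) :
  (forall (g : contra_hom (sharp_obj f_cont P) (sharp_obj f_cont Q)) (r : lincomb S P),
     g (ctr_act r) = ctr_act (lcmap g r)) ->
  bijective (@sharp_hom R S f f_cont P Q).
Proof.
move=> h; apply: bijective_of; first exact: sharp_hom_inj.
by move=> g; exists (ContraHom (h g)); apply: contra_hom_ext.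
Qed.

Lemma sharp_hom_lin (P Q : contramodule S)
    (g : contra_hom (sharp_obj f_cont P) (sharp_obj f_cont Q)) :
  bijective (@sharp_hom R S f f_cont P Q) ->
  forall r : lincomb S P, g (ctr_act r) = ctr_act (lcmap g r).
Proof. by move=> [g' _ g'K] r; have <- := g'K g; exact: (chomP (g' g) r). Qed.

Section Epi.
Variables (I : set R) (J : set S) (fIJ : f @` I `<=` J).
Hypotheses (oI : open_ideal I) (oJ : open_ideal J).
Variables (C : pzRingType) (h k : {rmorphism rquot J -> C}).
Hypothesis hk : h \o rquot_map fIJ =1 k \o rquot_map fIJ.

Let hS : {rmorphism S -> C} := h \o rcls J.
Let kS : {rmorphism S -> C} := k \o rcls J.

Let hJ s : J s -> hS s = 0.
Proof. by move=> /(rcls0P oJ) e; rewrite /hS /= e rmorph0. Qed.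
Let kJ s : J s -> kS s = 0.
Proof. by move=> /(rcls0P oJ) e; rewrite /kS /= e rmorph0. Qed.
Let hkf a : hS (f a) = kS (f a).
Proof. by have := hk (rcls I a); rewrite /= rquot_map_cls. Qed.
Let hkE : hS =1 kS -> h =1 k.
Proof. by move=> e q; rewrite -[q]rcls_repr; exact: e. Qed.

Lemma diamond_epi : fully_faithful (f_diamond f_cont) -> h =1 k.
Proof.
move=> ff; apply: hkE => s.
pose M := act_discr oJ hJ; pose N := act_discr oJ kJ.
have gf (y : M) a : (idfun : M -> N) (rsc y (f a)) =
    rsc ((idfun : M -> N) y) (f a).
  by rewrite -[LHS]/((y : C) * hS (f a)) hkf.
have gB : zmod_morphism (idfun : M -> N) by [].
have ffMN := ff M N.
have e1 := @diamond_full M N idfun ffMN gB gf.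
(* The identity of C is R-linear between the two structures, so by fullness it is S-linear; at 1
   this says h(s) = k(s). *)
have e2 := e1 (1 : C) s.
have e3 : (1 : C) * hS s = (1 : C) * kS s by exact: e2.
by rewrite !mul1r in e3.
Qed.

Lemma separ_epi : fully_faithful (f_sharp_separ f_cont) -> h =1 k.
Proof.
move=> ff; apply: hkE => s.
pose P := act_contra oJ hJ; pose Q := act_contra oJ kJ.
have gP (r : lincomb R P) : (idfun : P -> Q) (@ctr_act R (sharp_obj f_cont P) r) =
    @ctr_act R (sharp_obj f_cont Q) (lcmap (idfun : P -> Q) r).
  rewrite (_ : lcmap _ r = r) ?lcmap_id //.
  rewrite -[LHS]/(act_sum hS (lcbase f_cont r)) -[RHS]/(act_sum kS (lcbase f_cont r)).
  rewrite /act_sum; apply: eq_fsbigr => c _.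
  by rewrite -[LHS]/(hS (f (r c)) * c) -[RHS]/(kS (f (r c)) * c) hkf.
pose g : contra_hom (sharp_obj f_cont P) (sharp_obj f_cont Q) := @ContraHom R
  (sharp_obj f_cont P) (sharp_obj f_cont Q) idfun gP.
pose sP : Separ S := exist _ P (act_contra_separated oJ hJ).
pose sQ : Separ S := exist _ Q (act_contra_separated oJ kJ).
have /= := sharp_hom_lin g (ff sP sQ) (mono s (1 : C)).
rewrite (_ : lcmap _ _ = mono s (1 : C)); last exact: lcmap_id.
move=> e; have := act_contra_mono oJ hJ s 1; have := act_contra_mono oJ kJ s 1.
by rewrite !mulr1 => ek eh; exact: etrans (esym eh) (etrans e ek).
Qed.

End Epi.

Section Base.
Variable I : nat -> set R.
Hypothesis oI : forall n, open_ideal (I n).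
Hypothesis IS : forall n, I n.+1 `<=` I n.
Hypothesis Ibase : forall V, open_ideal V -> exists n, I n `<=` V.
Let J n := ext_closure f (I n).
Hypothesis oJ : forall n, open_ideal (J n).

Section Diamond.
Hypothesis epi : forall n, ring_epimorphism (rquot_map (@taut_map R S f I n)).
Variables (M N : discr_module S).
Variable l : {linear restr (conv_rmorphism f) M -> restr (conv_rmorphism f) N}.

Let lr (y : M) a : l (rsc y (f a)) = rsc (l y : N) (f a).
Proof. exact: (linearZZ l (a : R^c) y). Qed.
Let lB (y z : M) : l (y - z : M) = (l y : N) - (l z : N).
Proof. exact: (raddfB l). Qed.
Let l0 : l (0 : M) = (0 : N).
Proof. exact: (raddf0 l). Qed.

(** The annihilator of z contains some J_m, and modulo J_m an element of J_n is a finite sum of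
    f(a)t with a in I_n. *)
Lemma taut_ann n (z : N) : (forall a, I n a -> rsc z (f a) = 0) ->
  forall s, J n s -> rsc z s = 0.
Proof.
move=> zI s Js; have [V oV Vz] := open_ideal_sub (@discrP S N z) (ann_subgroup z).
have [m mV] := taut_base f_cont Ibase oV.
have [L [LI /mV/Vz /= h]] := taut_dense oI oJ m Js.
rewrite -(subrK (\sum_(u <- L) f u.1 * u.2) s) rscDr h add0r rsc_sumr big_seq.
by rewrite big1 // => u /LI Iu; rewrite -rscM zI // rsc0l.
Qed.

(** Take n such that J_n kills y. Then (u, v) |-> l(y u) v descends to S/J_n in both variables, in
    the second one by [taut_ann], and is balanced over R/I_n. Its values at (s, 1) and (1, s) are
    the two sides. *)
Lemma diamond_rsc (y : M) s : l (rsc y s) = rsc (l y : N) s.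
Proof.
have [V oV Vy] := open_ideal_sub (@discrP S M y) (ann_subgroup y).
have [n nV] := taut_base f_cont Ibase oV.
have yJ j : J n j -> rsc y j = 0 by move=> /nV/Vy.
have lJ t j : J n j -> rsc (l (rsc y t) : N) j = 0.
  move=> Jj; apply: (@taut_ann n) Jj => a Ia; rewrite -lr rscM yJ //.
  by apply: (oJ n).2.2; apply: taut_map; exists a.
pose b (u v : rquot (J n)) : N := rsc (l (rsc y (repr u)) : N) (repr v).
have bE u v : b (rcls _ u) (rcls _ v) = rsc (l (rsc y u) : N) v.
  have e : rsc y (repr (rcls (J n) u)) = rsc y u.
    apply: subr0_eq; rewrite -rscBr; apply: yJ.
    exact: (rcls_repr_mod (oJ n)).
  rewrite /b e; apply: subr0_eq; rewrite -rscBr; apply: lJ.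
  exact: (rcls_repr_mod (oJ n)).
have lD (x z : M) : l (x + z : M) = (l x : N) + (l z : N) by exact: (raddfD l).
have bDl u u' v : b (u + u') v = b u v + b u' v.
  rewrite -[u](@rcls_repr _ (J n)) -[u'](@rcls_repr _ (J n)) -[v](@rcls_repr _ (J n)).
  by rewrite -(rclsD (J n)) !bE rscDr lD rscDl.
have bDr u v v' : b u (v + v') = b u v + b u v'.
  rewrite -[u](@rcls_repr _ (J n)) -[v'](@rcls_repr _ (J n)) -[v](@rcls_repr _ (J n)).
  by rewrite -(rclsD (J n)) !bE rscDr.
have bal u a v : b (u * rquot_map (@taut_map R S f I n) a) v =
    b u (rquot_map (@taut_map R S f I n) a * v).
  rewrite -[u](@rcls_repr _ (J n)) -[a](@rcls_repr _ (I n)) -[v](@rcls_repr _ (J n)).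
  by rewrite rquot_map_cls -!rmorphM !bE -rscM lr rscM.
have := epi_bilinear (@epi n) bDl bDr bal (rcls _ s).
by rewrite -!(rmorph1 (rcls (J n))) !bE !rsc1.
Qed.

End Diamond.

Lemma epi_diamond :
  (forall n, ring_epimorphism (rquot_map (@taut_map R S f I n))) ->
  fully_faithful (f_diamond f_cont).
Proof.
move=> epi M N; apply: bijective_of; first exact: fhom_diamond_inj.
move=> l; have lZ : scalable ((l : {linear restr (conv_rmorphism f) M ->
    restr (conv_rmorphism f) N}) : M -> N).
  by move=> s y; exact: (diamond_rsc epi l y s).
have lB : zmod_morphism ((l : {linear restr (conv_rmorphism f) M ->
    restr (conv_rmorphism f) N}) : M -> N).
  by move=> x y; exact: (raddfB (l : {linear restr (conv_rmorphism f) M ->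
    restr (conv_rmorphism f) N})).
have [m mE] := linear_of lB lZ; exists m.
by apply: linear_ext => y; rewrite -[LHS]/(m y) mE.
Qed.

Lemma epi_flat : countable_base_at0 S ->
  (forall n, ring_epimorphism (rquot_map (@taut_map R S f I n))) ->
  fully_faithful (f_sharp_flat f_cont).
Proof.
move=> cS epi [P flatP] [Q flatQ]; apply: sharp_hom_bij => g r.
have sepQ : separated Q := flat_separated cS flatQ.
exact: (@separated_hom R S f f_cont I oI IS Ibase oJ P Q g sepQ epi r).
Qed.

Lemma flat_contra_ff :
  (forall n, flat_module (quot_module (@taut_map R S f I n))) ->
  fully_faithful (f_sharp_flat f_cont) -> fully_faithful (f_sharp f_cont).
Proof.
move=> flatB ff P Q; apply: sharp_hom_bij => g r.
pose F := free_contra S P.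
have flatF : flat_contra F := @free_flat S P.
have flatRF : flat_contra (sharp_obj f_cont F) :=
  sharp_free_flat f_cont oI IS Ibase oJ flatB P.
pose T := base_change f_cont (sharp_obj f_cont F).
have flatT : flat_contra T := base_change_flat f_cont flatRF.
have piP (Xi : lincomb S F) : @ctr_act S P (@ctr_act S F Xi) =
    ctr_act (lcmap (@ctr_act S P) Xi) by rewrite ctr_assoc.
pose pi : contra_hom F P := ContraHom piP.
pose h := contra_comp g (sharp_hom f_cont pi).
pose u := bc_unit f_cont (sharp_obj f_cont F).
have uP : forall Xi : lincomb S F, u (ctr_act Xi) = ctr_act (lcmap u Xi).
  exact: (sharp_hom_lin u (ff (exist _ F flatF) (exist _ T flatT))).
have hE (xi : F) : h xi = bc_lift h (u xi) by rewrite bc_lift_unit.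
have hP (Xi : lincomb S F) : h (ctr_act Xi) = @ctr_act S Q (lcmap h Xi).
  rewrite hE uP chomP lcmap_comp; apply: (congr1 (@ctr_act S Q)).
  by apply: eq_lcmap => xi; exact: esym (hE xi).
(* Linearity descends from S[[P]] to P along the section [eps] of the projection [pi]: h restricts
   to g on the elements [eps p], and the combination chosen here has sum r in S[[P]]. *)
have := hP (lcmap (@eps S P) r).
rewrite lcmap_comp (eq_lcmap (h := g)) => [<-|p]; last by rewrite /= ctr_unit.
congr (g _); apply: (congr1 (@ctr_act S P)); apply: lincombP => x.
rewrite -[RHS]/(phi (lcmap (@eps S P) r) x) phi_lcmap (@isum1 _ _ x) /= ?eqxx ?mulr1 //.
by move=> y /negbTE yx; rewrite eq_sym yx mulr0.
Qed.

End Base.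
End Conditions.

Theorem corollary7p8 (R S : clRingType) (f : {rmorphism R -> S})
    (f_cont : continuous f)
    (R_base : countable_base_at0 R) (S_base : countable_base_at0 S)
    (f_proflat : left_proflat f) :
  [<-> fully_faithful (f_diamond f_cont);
       fully_faithful (f_sharp_flat f_cont);
       fully_faithful (f_sharp_separ f_cont);
       fully_faithful (f_sharp f_cont);
       top_ring_proepimorphism f].
Proof.
have [_ taut flatf] := f_proflat.
have [I [tI IS Iall]] := base_seq R_base taut.
have oI n : open_ideal (I n) by have [] := tI n.
have oJ n : open_ideal (ext_closure f (I n)) by have [] := tI n.
have Ibase V : open_ideal V -> exists n, I n `<=` V.
  move=> [oV [[[V0 _] _] _]]; apply: Iall; exact: open_nbhs_nbhs.
have flatB n : flat_module (quot_module (@taut_map R S f I n)).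
  by apply: flatf => //; [exact: (oI n).1|exact: (oI n).2|exact: (oJ n).1|exact: (oJ n).2].
have epi : top_ring_proepimorphism f ->
    forall n, ring_epimorphism (rquot_map (@taut_map R S f I n)).
  move=> [_ h] n.
  by apply: h; [exact: (oI n).1|exact: (oI n).2|exact: (oJ n).1|exact: (oJ n).2].
have c15 : fully_faithful (f_diamond f_cont) -> top_ring_proepimorphism f.
  move=> ff; split=> // K L fKL oK iK oL iL C h k hk.
  exact: (diamond_epi (conj oL iL) hk ff).
have c35 : fully_faithful (f_sharp_separ f_cont) -> top_ring_proepimorphism f.
  move=> ff; split=> // K L fKL oK iK oL iL C h k hk.
  exact: (separ_epi (conj oL iL) hk ff).
have c52 : top_ring_proepimorphism f -> fully_faithful (f_sharp_flat f_cont).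
  by move=> /epi; exact: (epi_flat f_cont oI IS Ibase oJ S_base).
have c24 : fully_faithful (f_sharp_flat f_cont) -> fully_faithful (f_sharp f_cont).
  exact: (flat_contra_ff oI IS Ibase oJ flatB).
have c43 : fully_faithful (f_sharp f_cont) -> fully_faithful (f_sharp_separ f_cont).
  by move=> ff X Y; exact: (ff (sval X) (sval Y)).
have c51 : top_ring_proepimorphism f -> fully_faithful (f_diamond f_cont).
  by move=> /epi; exact: (epi_diamond f_cont oI Ibase oJ).
(* The cycle (1), ..., (5) is assembled from (1) <=> (5) and (5) => (2) => (4) => (3) => (5). *)
tfae.
- by move=> /c15/c52.
- by move=> /c24/c43.
- by move=> /c35/c52/c24.
- by move=> /c43/c35.
- exact: c51.
Qed.
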